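(* For every $n\ge8$, $$\mathrm{ex}(n,\mathbf A\mathbf B\mathbf D)=\left\lfloor\tfrac18 n^2\right\rfloor.$$ Moreover, for $n\ge11$ the families $\mathcal F_{n,k}$ with optimally chosen $k$ are (up to isomorphism) the only extremal systems (triple systems on $n$ vertices containing none of $\mathbf A,\mathbf B,\mathbf D$ and having $\lfloor\frac18n^2\rfloor$ triples), except that $\mathcal Q^{4\times4}$ is also extremal in the case $n=16$.
   Context: A triple system on a finite vertex set $V$, $|V|=n$, is a family $\mathcal F$ of distinct $3$-element subsets (triples) of $V$. We write $124$ for $\{1,2,4\}$ etc. $\mathbf A=\{124,135,236\}$ (on 6 vertices), $\mathbf B=\{125,134,234\}$ and $\mathbf D=\{123,134,235\}$ (each on 5 vertices). A triple system contains a configuration if some of its triples form a system isomorphic to it (not necessarily induced). $\mathrm{ex}(n,X_1\dots X_k)$ denotes the maximum number of triples in a triple system on $n$ vertices that contains none of $X_1,\dots,X_k$. For a positive integer $k$ with $2k<n$, $\mathcal F_{n,k}$ is the following triple system: partition the $n$-element vertex set into $k$ pairs $A_1,\dots,A_k$ and a set $B$ of size $n-2k$; $\mathcal F_{n,k}$ consists of all $k(n-2k)$ triples $A_i\cup\{b\}$ with $1\le i\le k$, $b\in B$. An optimally chosen $k$ is one maximizing $k(n-2k)$ for the given $n$, i.e. as close as possible to $n/4$ (unique unless $n\equiv2\pmod4$, in which case both $k=\frac{n\pm2}{4}$ are optimal). $\mathcal Q^{4\times4}$ is the triple system of size $32$ whose vertices are the 16 points of a $4\times4$ square lattice and whose triples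 are all 3-element subsets of the 4 rows and of the 4 columns. *)

(* Defs.v *)
(* World: MathComp. *)
From mathcomp Require Import all_boot.

Set Implicit Arguments.
Unset Strict Implicit.
Unset Printing Implicit Defensive.

Definition triple_system (V : finType) (F : {set {set V}}) : bool :=
  [forall T in F, #|T| == 3].

Definition isomorphic (U V : finType) (F : {set {set U}}) (G : {set {set V}}) :
    Prop :=
  exists2 f : U -> V, bijective f & [set f @: T | T : {set U} in F] = G.

Record configuration := Configuration {
  conf_order : nat;
  conf_triples : {set {set 'I_conf_order}} }.

(* The labels in [s] run from 1 to [m]; label [j] is the vertex [j - 1] of
   ['I_m]. *)
Definition conf_of (m : nat) (s : seq (seq nat)) : configuration :=
  Configuration [set T in [seq [set i : 'I_m | i.+1 \in t] | t <- s]].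

Definition confA := conf_of 6 [:: [:: 1; 2; 4]; [:: 1; 3; 5]; [:: 2; 3; 6]].
Definition confB := conf_of 5 [:: [:: 1; 2; 5]; [:: 1; 3; 4]; [:: 2; 3; 4]].
Definition confD := conf_of 5 [:: [:: 1; 2; 3]; [:: 1; 3; 4]; [:: 2; 3; 5]].

(* Containment is not induced: other triples of [F] may lie inside the copy. *)
Definition contains (V : finType) (F : {set {set V}}) (X : configuration) :
    bool :=
  [exists f : {ffun 'I_(conf_order X) -> V},
     injectiveb f && ([set f @: T | T : {set _} in conf_triples X] \subset F)].

Definition avoids (V : finType) (F : {set {set V}}) (Xs : seq configuration) :
    bool :=
  all (fun X => ~~ contains F X) Xs.

Definition ex (n : nat) (Xs : seq configuration) : nat :=
  \max_(F : {set {set 'I_n}} | triple_system F && avoids F Xs) #|F|.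

(* A_i = {2i, 2i+1} for i < k, and B = {2k, ..., n-1}. *)
Definition Fnk (n k : nat) : {set {set 'I_n}} :=
  [set [set v : 'I_n | v./2 == i] :|: [set b]
      | i : 'I_k, b : 'I_n in [set b : 'I_n | 2 * k <= b]].

Definition admissible (n k : nat) : bool := (0 < k) && (2 * k < n).

Definition optimal (n k : nat) : Prop :=
  admissible n k /\
  forall j, admissible n j -> j * (n - 2 * j) <= k * (n - 2 * k).

Definition Q44 : {set {set 'I_4 * 'I_4}} :=
  [set T : {set 'I_4 * 'I_4} | (#|T| == 3) &&
     ([exists i, T \subset [set p | p.1 == i]] ||
      [exists j, T \subset [set p | p.2 == j]])].

(* Main.v *)
Require Import Defs.
From mathcomp Require Import all_boot.
From mathcomp Require Import zify.

Set Implicit Arguments.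
Unset Strict Implicit.
Unset Printing Implicit Defensive.

(** The problem becomes a count of triangles in graphs. The shadow of a triple
    system F joins two vertices that lie in a common triple. If F contains
    none of A, B, D, then its shadow has no gem, that is, no vertex whose
    neighbourhood contains a path on four vertices ([shadow_gemfree]);
    conversely no family of triangles of a gem-free graph contains A, B or D
    ([gemfree_avoids]). So the question is how many triangles a gem-free graph
    on n vertices can have, and which graphs attain the maximum.

    In a gem-free graph a vertex outside a K4 has at most one neighbour in it.
    Hence two K4s share at most one vertex, and a triangle that meets a K4 in
    two vertices lies in it. In every triangle outside the K4s two edges lie in
    no other triangle ([tri_page_or_tet]); these triangles form books, sets of
    triangles on a common edge. The two private edges chosen in each such
    triangle form the light graph L, which is triangle-free and has two edges
    per triangle.

    Without K4s, Mantel's theorem for L gives 2t <= n^2/4 for the number t of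
    triangles. If t = n^2/8 up to rounding, then L is complete bipartite with at
    most one missing edge, and the spines of the books must match up one of its
    two sides perfectly. That side is then even, which excludes a missing edge
    and leaves the graph of F_{n,k}
    ([k4free_extremal]).

    K4s cost more than they bring in, but only just. Give v the weight
    x(v) = p(v) + 4k(v), where p(v) is its degree in L and k(v) the number of
    K4s through v; the weights add up to 4t. The ends of an edge of L have
    disjoint neighbourhoods within L and the K4s, and the degrees of the four
    vertices of a K4 add up to at most n + 8. Adding these inequalities with
    suitable multipliers gives, with kappa the number of K4s,
        3 sum x^2 + sum pk + 8(n - 16) kappa <= 6nt    ([weighted_count]).
    By Cauchy's inequality t <= n^2/8 for n >= 16. For n > 16 a graph with a K4
    misses the bound (for n = 2 mod 4 this needs at least four K4s, which a
    deletion argument provides), and for n = 16 equality forces two K4s through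
    every vertex, and this makes it the rook's graph of the 4 x 4 square
    ([sixteen_isomorphic]).

    For n < 16 some vertices of a K4 are deleted: all four, or a single one,
    or two or three at which at most two triangles outside the K4 hang. The
    neighbourhoods of its four vertices outside the K4 are disjoint, and where
    further triangles hang they have at least two elements, so few cases survive
    ([triangles8] to [triangles11], [deficient12] to [deficient15]). *)

(** * Gem-free graphs: cliques, K4s and pages *)

Lemma double_count (I J : finType) (A : {set I}) (B : {set J}) (R : I -> J -> bool) :
  \sum_(x in A) #|[set y in B | R x y]| = \sum_(y in B) #|[set x in A | R x y]|.
Proof.
have E (T : finType) (C : {set T}) (P : pred T) :
    #|[set x in C | P x]| = \sum_(x in C) (P x : nat).
  rewrite -sum1_card (eq_bigl (fun x => (x \in C) && P x)); last first.
    by move=> x; rewrite inE.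
  by rewrite big_mkcondr; apply: eq_bigr => x _; case: (P x).
under eq_bigr do rewrite E.
by rewrite exchange_big; apply: eq_bigr => y _; rewrite E.
Qed.

Lemma card_by_fibres (I J : finType) (A : {set I}) (B : {set J}) (R : I -> J -> bool) :
  (forall x, x \in A -> exists2 y, y \in B & R x y) ->
  (forall x y z, x \in A -> y \in B -> z \in B -> R x y -> R x z -> y = z) ->
  #|A| = \sum_(y in B) #|[set x in A | R x y]|.
Proof.
move=> ex un; rewrite -double_count -sum1_card; apply: eq_bigr => x xA.
have [y yB Rxy] := ex x xA.
rewrite -(cards1 y); apply: eq_card => z; rewrite !inE.
apply/eqP/andP => [-> // | [zB Rxz]]; exact: un Rxz Rxy.
Qed.

Section Cliques.
Variables (V : finType) (e : rel V).

Definition clique (S : {set V}) : bool :=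
  [forall x in S, forall y in S, (x != y) ==> e x y].

Definition cliques (k : nat) : {set {set V}} :=
  [set S : {set V} | (#|S| == k) && clique S].

Definition nbr (v : V) : {set V} := [set u | e v u].

(** Induced subgraphs keep the vertex type and lose edges, so that all graphs below live on
    one type and carry their vertex set separately. *)
Definition induced (U : {set V}) : rel V :=
  fun x y => [&& e x y, x \in U & y \in U].

Lemma cliqueP (S : {set V}) :
  reflect {in S &, forall x y, x != y -> e x y} (clique S).
Proof.
apply: (iffP 'forall_in_forall_inP) => [h x y xS yS | h x xS y yS].
  exact/implyP/h.
by apply/implyP/h.
Qed.

Lemma clique_edge k S x y :
  S \in cliques k -> x \in S -> y \in S -> x != y -> e x y.
Proof. by rewrite inE => /andP[_ /cliqueP h]; apply: h. Qed.

Lemma cliques_card k S : S \in cliques k -> #|S| = k.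
Proof. by rewrite inE => /andP[/eqP]. Qed.

End Cliques.

(** Cliques with at least two vertices inherit membership in U from their edges; a singleton
    is a clique of the induced graph even outside U. *)
Lemma cliques_induced (V : finType) (e : rel V) (U : {set V}) k :
  1 < k -> cliques (induced e U) k = [set S in cliques e k | S \subset U].
Proof.
move=> k1; apply/setP => S; rewrite !inE -andbA; case: eqP => //= cS.
apply/cliqueP/andP => [h | [/cliqueP h SU] x y xS yS xy]; last first.
  by rewrite /induced h // !(subsetP SU).
split.
  by apply/cliqueP => x y xS yS xy; have /and3P[] := h x y xS yS xy.
apply/subsetP => x xS; have: 0 < #|S :\ x| by have := cardsD1 x S; rewrite xS; lia.
case/card_gt0P => y; rewrite !inE => /andP[yx yS].
by have /and3P[] := h x y xS yS (contra_neq esym yx).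
Qed.

(** A graph with its edges inside W. The gem is the vertex a joined to the path x, b, c, y;
    the conclusion x = y says that the path cannot have four distinct vertices. *)
Record gemfree_on (V : finType) (e : rel V) (W : {set V}) : Prop := GemfreeOn {
  gf_sym : symmetric e;
  gf_irr : irreflexive e;
  gf_supp : forall x y, e x y -> x \in W;
  gf_gem : forall a x b c y, e a x -> e a b -> e a c -> e a y ->
    e x b -> e b c -> e c y -> x != c -> b != y -> x = y }.

Section Local.
Variables (V : finType) (e : rel V) (W : {set V}).
Hypothesis G : gemfree_on e W.

Local Notation tri := (cliques e 3).
Local Notation tet := (cliques e 4).

Lemma edge_neq x y : e x y -> x != y.
Proof. by apply: contraTneq => ->; rewrite (gf_irr G). Qed.

Lemma edge_supp_r x y : e x y -> y \in W.
Proof. by rewrite (gf_sym G); apply: (gf_supp G). Qed.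

Lemma gemfree_induced U : gemfree_on (induced e U) (W :&: U).
Proof.
split.
- by move=> x y; rewrite /induced (gf_sym G) [(x \in U) && _]andbC.
- by move=> x; rewrite /induced (gf_irr G).
- by move=> x y /and3P[exy xU _]; rewrite inE xU (gf_supp G exy).
- move=> a x b c y /and3P[? _ _] /and3P[? _ _] /and3P[? _ _] /and3P[? _ _].
  move=> /and3P[? _ _] /and3P[? _ _] /and3P[? _ _].
  exact: (gf_gem G (a := a) (b := b) (c := c)).
Qed.

Lemma clique_sub k S : 1 < k -> S \in cliques e k -> S \subset W.
Proof.
move=> k1 SK; apply/subsetP => x xS.
have: 0 < #|S :\ x|.
  by have := cardsD1 x S; rewrite xS (cliques_card SK); lia.
case/card_gt0P => y; rewrite !inE => /andP[yx yS].
by apply: (gf_supp G (clique_edge SK xS yS _)); rewrite eq_sym.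
Qed.

Lemma triangle_mk x y z : e x y -> e y z -> e x z -> [set x; y; z] \in tri.
Proof.
move=> xy yz xz; rewrite inE; apply/andP; split.
  rewrite -setUA cardsU1 cards2 !inE negb_or (edge_neq xy) (edge_neq xz) (edge_neq yz).
  by [].
apply/cliqueP => u v; rewrite !inE -!orbA.
by move=> /or3P[] /eqP-> /or3P[] /eqP->; rewrite ?eqxx // (gf_sym G) ?xy ?yz ?xz //
   (gf_sym G) ?xy ?yz ?xz.
Qed.

Lemma other_vertex (S : {set V}) x y k : x \in S -> y \in S -> x != y ->
  #|S| = k.+3 -> exists2 z, z \in S & (z != x) && (z != y).
Proof.
move=> xS yS xy cS.
have: 0 < #|S :\ x :\ y|.
  have := cardsD1 x S; have := cardsD1 y (S :\ x).
  by rewrite !inE xS yS (eq_sym y) xy /=; lia.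
case/card_gt0P => z; rewrite !inE => /and3P[zy zx zS].
by exists z; rewrite // zx zy.
Qed.

Lemma triangle_third T x y : T \in tri -> x \in T -> y \in T -> x != y ->
  exists z, [/\ T = [set x; y; z], e x y, e y z & e x z].
Proof.
move=> TT xT yT xy; have cT := cliques_card TT.
have [z zT /andP[zx zy]] := other_vertex xT yT xy cT.
exists z; have [xz yz] : x != z /\ y != z by rewrite ![_ == z]eq_sym.
have [exy eyz exz] : [/\ e x y, e y z & e x z] by split; apply: clique_edge TT _ _ _.
split=> //; apply/esym/eqP; rewrite eqEcard cT.
rewrite (cliques_card (triangle_mk exy eyz exz)) leqnn andbT.
by apply/subsetP => u; rewrite !inE -orbA => /or3P[] /eqP->.
Qed.

Lemma triangle_vertex T x : T \in tri -> x \in T ->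
  exists y z, [/\ T = [set x; y; z], e x y, e y z & e x z].
Proof.
move=> TT xT; have: 0 < #|T :\ x|.
  by have := cardsD1 x T; rewrite xT (cliques_card TT); lia.
case/card_gt0P => y; rewrite !inE => /andP[yx yT].
have [z H] := triangle_third TT xT yT (contra_neq esym yx).
by exists y, z.
Qed.

(** If x, y, u, w is a K4 and z is a further neighbour of x and y, then z, y, u, w is a path in
    the neighbourhood of x. *)
Lemma tet_closed Q x y z : Q \in tet -> x \in Q -> y \in Q -> x != y ->
  e z x -> e z y -> z \in Q.
Proof.
move=> QK xQ yQ xy zx zy; apply/negPn/negP => zQ.
have cQ := cliques_card QK.
have [u uQ /andP[ux uy]] := other_vertex xQ yQ xy cQ.
have: 0 < #|Q :\ x :\ y :\ u|.
  have := cardsD1 x Q; have := cardsD1 y (Q :\ x); have := cardsD1 u (Q :\ x :\ y).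
  by rewrite !inE xQ yQ uQ ux uy (eq_sym y) xy /=; lia.
case/card_gt0P => w; rewrite !inE => /and4P[wu wy wx wQ].
have E a b : a \in Q -> b \in Q -> a != b -> e a b by apply: clique_edge QK.
have yz : y != z by apply: contraNneq zQ => <-.
have zu : z != u by apply: contraNneq zQ => ->.
have zw : z = w.
  have [xz yw' uy' ux'] : [/\ e x z, y != w, y != u & x != u].
    by rewrite (gf_sym G) ![y == _]eq_sym ![x == _]eq_sym.
  apply: (gf_gem G xz (E _ _ xQ yQ xy) (E _ _ xQ uQ ux')) => //; apply: E => //.
  - by rewrite eq_sym.
  - by rewrite eq_sym.
by rewrite zw wQ in zQ.
Qed.

Lemma tet_eq Q Q' x y : Q \in tet -> Q' \in tet -> x != y ->
  x \in Q -> y \in Q -> x \in Q' -> y \in Q' -> Q = Q'.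
Proof.
move=> QK QK' xy xQ yQ xQ' yQ'; apply/eqP; rewrite eqEcard.
rewrite (cliques_card QK) (cliques_card QK') leqnn andbT.
apply/subsetP => z zQ; have [-> //|zx] := eqVneq z x; have [-> //|zy] := eqVneq z y.
by apply: (tet_closed QK' xQ' yQ' xy); apply: clique_edge QK _ _ _.
Qed.

Lemma tet_triangle Q T x y : Q \in tet -> T \in tri -> x != y ->
  x \in Q -> y \in Q -> x \in T -> y \in T -> T \subset Q.
Proof.
move=> QK TT xy xQ yQ xT yT; apply/subsetP => z zT.
have [-> //|zx] := eqVneq z x; have [-> //|zy] := eqVneq z y.
by apply: (tet_closed QK xQ yQ xy); apply: clique_edge TT _ _ _.
Qed.

(** The vertex p is a page of T when both edges of T at p lie in no triangle other than T; the
    opposite edge of T is then the spine of a book of triangles. *)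
Definition is_page (T : {set V}) (p : V) : bool :=
  (p \in T) && [forall u in T, (u != p) ==> (nbr e p :&: nbr e u \subset T)].

(** A triangle that shares no edge with others has three pages, of which one is chosen. *)
Definition page (T : {set V}) : option V := [pick p | is_page T p].

Definition paged : {set {set V}} := [set T in tri | page T].

Lemma is_pageP (T : {set V}) p : reflect (p \in T /\
   forall u z, u \in T -> u != p -> e p z -> e u z -> z \in T) (is_page T p).
Proof.
apply: (iffP andP) => [[pT /forall_inP h]|[pT h]]; split=> //.
  move=> u z uT up pz uz; have /implyP/(_ up)/subsetP := h u uT.
  by apply; rewrite !inE pz.
apply/forall_inP => u uT; apply/implyP => up; apply/subsetP => z; rewrite !inE.
by case/andP; apply: h.
Qed.

(** If two edges ab, ac of a triangle abc lie in further triangles abu, acw, then u, b, c, w is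
    a path in the neighbourhood of a unless u = w, and then a, b, c, u is a K4. So outside
    the K4s at most one edge of a triangle is shared, and the vertex opposite to it is a page. *)
Lemma tri_page_or_tet T : T \in tri ->
  page T \/ exists2 Q, Q \in tet & T \subset Q.
Proof.
move=> TT; case: (boolP [exists Q in tet, T \subset Q]) => [/exists_inP|noQ].
  by right.
left; rewrite /page; case: pickP => // noP.
have: exists p, is_page T p; last by case=> p; rewrite noP.
have [a aT] : exists a, a \in T by apply/card_gt0P; rewrite (cliques_card TT).
have [b [c [TE ab bc ac]]] := triangle_vertex TT aT.
have key x y z : T = [set x; y; z] -> e x y -> e y z -> e x z ->
   [exists u, [&& u \notin T, e x u & e y u]] ->
   [exists u, [&& u \notin T, e x u & e z u]] -> False.
  move=> Txyz xy yz xz /existsP[u /and3P[uT xu yu]] /existsP[w /and3P[wT xw zw]].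
  have ne v v' : v \notin T -> v' \in T -> v != v'.
    by move=> vT v'T; apply: contraNneq vT => ->.
  have uw : u = w.
    apply: (gf_gem G (a := x) (b := y) (c := z)) => //.
    - by rewrite (gf_sym G).
    - by apply: ne => //; rewrite Txyz !inE eqxx orbT.
    - by rewrite eq_sym; apply: ne => //; rewrite Txyz !inE eqxx ?orbT.
  subst w; case/negP: noQ; apply/exists_inP; exists (u |: T); last exact: subsetUr.
  rewrite inE cardsU1 uT (cliques_card TT) /=; apply/cliqueP => v v'.
  have eu v0 : v0 \in T -> e u v0.
    by rewrite Txyz !inE -orbA => /or3P[] /eqP->; rewrite (gf_sym G).
  rewrite !in_setU1 => /orP[/eqP->|vT] /orP[/eqP->|v'T] vv'.
  - by rewrite eqxx in vv'.
  - exact: eu.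
  - by rewrite (gf_sym G) eu.
  - exact: clique_edge TT _ _ _.
have pg x y z : T = [set x; y; z] ->
   ~~ [exists u, [&& u \notin T, e x u & e y u]] ->
   ~~ [exists u, [&& u \notin T, e x u & e z u]] -> is_page T x.
  move=> Txyz N1 N2; apply/is_pageP; split; first by rewrite Txyz !inE eqxx.
  move=> u w; rewrite {1}Txyz !inE => uT ux xw uw; apply/negPn/negP => wT.
  move: uT; rewrite (negPf ux) /= => /orP[] /eqP uE; subst u.
    by case/negP: N1; apply/existsP; exists w; rewrite wT xw.
  by case/negP: N2; apply/existsP; exists w; rewrite wT xw.
have Tb : T = [set b; a; c] by rewrite TE [[set a; b]]setUC.
have Tc : T = [set c; a; b] by rewrite TE setUC setUA.
have ba : e b a by rewrite (gf_sym G).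
have ca : e c a by rewrite (gf_sym G).
have cb : e c b by rewrite (gf_sym G).
have sw x y : [exists u, [&& u \notin T, e x u & e y u]] = [exists u, [&& u \notin T, e y u & e x u]].
  by apply: eq_existsb => u; rewrite [e x u && _]andbC.
case Pab: [exists u, [&& u \notin T, e a u & e b u]]; last first.
  case Pac: [exists u, [&& u \notin T, e a u & e c u]]; last first.
    by exists a; apply: (pg a b c); rewrite ?Pab ?Pac.
  exists b; apply: (pg b a c) => //; first by rewrite (sw b a) Pab.
  apply/negP => Pbc; apply: (key c a b) => //; first by rewrite (sw c a).
  by rewrite (sw c b).
exists c; apply: (pg c a b) => //; apply/negP => P.
  by apply: (key a b c) => //; rewrite (sw a c).
by apply: (key b a c) => //; rewrite ?(sw b a) ?(sw b c).
Qed.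

Lemma pageP T p : page T = Some p -> is_page T p.
Proof. by rewrite /page; case: pickP => // q ? [<-]. Qed.

Lemma page_notet (T Q : {set V}) p : page T = Some p -> T \in tri -> Q \in tet -> T \subset Q -> False.
Proof.
move=> /pageP/is_pageP[pT h] TT QK TQ.
have [y [z [TE py yz pz]]] := triangle_vertex TT pT.
have: 0 < #|Q :\: T|.
  by rewrite cardsD (setIidPr TQ) (cliques_card TT) (cliques_card QK).
case/card_gt0P => w; rewrite !inE => /andP[wT wQ]; case/negP: (wT).
have yT : y \in T by rewrite TE !inE eqxx orbT.
have ne v : v \in T -> v != w by move=> vT; apply: contraNneq wT => <-.
have ew v : v \in T -> e v w.
  by move=> vT; apply: clique_edge QK (subsetP TQ _ vT) wQ (ne v vT).
by apply: (h y w yT _ (ew p pT) (ew y yT)); rewrite eq_sym (edge_neq py).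
Qed.

End Local.

(** * The shadow of a triple system *)

Definition shadow (V : finType) (F : {set {set V}}) : rel V :=
  fun x y => (x != y) && [exists T in F, (x \in T) && (y \in T)].

Lemma containsP (V : finType) (F : {set {set V}}) m (s : seq (seq nat)) :
  reflect (exists2 f : 'I_m -> V, injective f &
    forall t, t \in s -> f @: [set i : 'I_m | i.+1 \in t] \in F)
  (contains F (conf_of m s)).
Proof.
apply: (iffP existsP) => [[f /andP[/injectiveP fi /subsetP sub]]|[f fi h]].
  exists f => // t ts; apply: sub; apply/imsetP; exists [set i : 'I_m | i.+1 \in t] => //.
  by rewrite inE; apply/mapP; exists t.
exists (finfun f); apply/andP; split.
  by apply/injectiveP => i j; rewrite !ffunE; apply: fi.
apply/subsetP => _ /imsetP[T + ->]; rewrite inE => /mapP[t ts ->].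
rewrite (eq_imset (g := f)); first exact: h.
by move=> i; rewrite ffunE.
Qed.

(** Containment from an explicit list of vertices, where the label j of the configuration is
    the entry j - 1 of the list. *)
Lemma contains_nth (V : finType) (F : {set {set V}}) m (s : seq (seq nat)) (vs : seq V) x0 :
  size vs = m -> uniq vs ->
  all (all (fun j => 0 < j <= m)) s ->
  all (fun t => [set x in [seq nth x0 vs j.-1 | j <- t]] \in F) s ->
  contains F (conf_of m s).
Proof.
move=> sz un bd /allP FF; apply/containsP; exists (fun i : 'I_m => nth x0 vs i).
  by move=> i j /eqP; rewrite nth_uniq ?sz // => /eqP/val_inj.
move=> t ts; have /allP bt := allP bd t ts.
have := FF t ts; congr (_ \in F); apply/setP => x; rewrite inE.
apply/mapP/imsetP => [[j jt ->]|[i + ->]]; last by rewrite inE => it; exists i.+1.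
have /andP[j0 jm] := bt j jt.
have jm' : j.-1 < m by case: j j0 jm {jt}.
by exists (Ordinal jm') => //; rewrite inE /= prednK.
Qed.

Lemma seq3E (V : finType) (a b c : V) : [set x in [:: a; b; c]] = [set a; b; c].
Proof. by apply/setP => x; rewrite !inE orbA. Qed.

Ltac distinct := rewrite /= !inE !negb_or; repeat (apply/andP; split); rewrite // eq_sym //.

Section ShadowGemfree.
Variables (V : finType) (F : {set {set V}}).
Hypotheses (F3 : triple_system F) (av : avoids F [:: confA; confB; confD]).
Local Notation S := (shadow F).
Local Notation "a &- b &- c" := ([set a; b; c] \in F) (at level 40, b at level 39, c at level 39).

Let f213 a b c : a &- b &- c -> b &- a &- c.
Proof. by rewrite [[set b; a]]setUC. Qed.

Let f132 a b c : a &- b &- c -> a &- c &- b.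
Proof. by rewrite setUAC. Qed.

Let f231 a b c : a &- b &- c -> b &- c &- a.
Proof. by move/f213/f132. Qed.

Let f312 a b c : a &- b &- c -> c &- a &- b.
Proof. by move/f132/f213. Qed.

Let noA p1 p2 p3 p4 p5 p6 : uniq [:: p1; p2; p3; p4; p5; p6] ->
  p1 &- p2 &- p4 -> p1 &- p3 &- p5 -> p2 &- p3 &- p6 -> False.
Proof.
move=> un t1 t2 t3; have /and3P[/negP nA _ _] := av; case: nA.
by apply: (@contains_nth _ _ _ _ [:: p1; p2; p3; p4; p5; p6] p1); rewrite //= !seq3E t1 t2 t3.
Qed.

Let noB p1 p2 p3 p4 p5 : uniq [:: p1; p2; p3; p4; p5] ->
  p1 &- p2 &- p5 -> p1 &- p3 &- p4 -> p2 &- p3 &- p4 -> False.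
Proof.
move=> un t1 t2 t3; have /and3P[_ /negP nB _] := av; case: nB.
by apply: (@contains_nth _ _ _ _ [:: p1; p2; p3; p4; p5] p1); rewrite //= !seq3E t1 t2 t3.
Qed.

Let noD p1 p2 p3 p4 p5 : uniq [:: p1; p2; p3; p4; p5] ->
  p1 &- p2 &- p3 -> p1 &- p3 &- p4 -> p2 &- p3 &- p5 -> False.
Proof.
move=> un t1 t2 t3; have /and4P[_ _ /negP nD _] := av; case: nD.
by apply: (@contains_nth _ _ _ _ [:: p1; p2; p3; p4; p5] p1); rewrite //= !seq3E t1 t2 t3.
Qed.

Let F3n a b c : a &- b &- c -> [/\ a != b, b != c & a != c].
Proof.
move=> abc; have /eqP := forall_inP F3 _ abc.
have [->|ab] := eqVneq a b; first by rewrite setUid cards2; case: eqP.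
have [->|bc] := eqVneq b c; first by rewrite -setUA setUid cards2; case: eqP.
by have [->|//] := eqVneq a c; rewrite setUAC setUid cards2; case: eqP.
Qed.

Let S_sym : symmetric S.
Proof.
move=> x y; rewrite /shadow eq_sym; congr (_ && _).
by apply: eq_existsb => T; rewrite [(x \in T) && _]andbC.
Qed.

Let shadow_third x y : S x y -> exists u, x &- y &- u.
Proof.
case/andP => xy /exists_inP[T TF /andP[xT yT]]; have /eqP cT := forall_inP F3 T TF.
have [z zT /andP[zx zy]] := other_vertex xT yT xy cT.
exists z; suff <- : T = [set x; y; z] by [].
apply/esym/eqP; rewrite eqEcard cT; apply/andP; split.
  by apply/subsetP => w; rewrite !inE -orbA => /or3P[] /eqP->.
by rewrite setUC cardsU1 cards2 xy !inE negb_or zx zy.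
Qed.

(** Three triples on the edges of a triangle xyz of the shadow form A if their third vertices
    differ and B if exactly two of them agree; otherwise they are three triples of a K4. *)
Let S_triangle x y z : S x y -> S y z -> S x z -> x &- y &- z \/
  exists u, [/\ x &- y &- u, y &- z &- u & x &- z &- u].
Proof.
move=> xy yz xz; have [nxy nyz nxz] : [/\ x != y, y != z & x != z].
  by split; [case/andP: xy|case/andP: yz|case/andP: xz].
have [u xyu] := shadow_third xy; have [v yzv] := shadow_third yz.
have [w xzw] := shadow_third xz.
have [uz|uz] := eqVneq u z; first by left; rewrite -uz.
have [vx|vx] := eqVneq v x; first by left; subst v; apply: f312.
have [wy|wy] := eqVneq w y; first by left; subst w; apply: f132.
have [_ yu xu] := F3n xyu; have [_ zv yv] := F3n yzv; have [_ zw xw] := F3n xzw.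
rewrite ![_ == z]eq_sym in uz; rewrite ![_ == x]eq_sym in vx; rewrite ![_ == y]eq_sym in wy.
have zy : z != y by rewrite eq_sym.
have yx : y != x by rewrite eq_sym.
have [uv|uv] := eqVneq u v; have [uw|uw] := eqVneq u w.
- by right; exists u; subst v w.
- subst v; by case: (@noB x z y u w _ xzw xyu (f213 yzv)); distinct.
- subst w; by case: (@noB y z x u v _ yzv (f213 xyu) (f213 xzw)); distinct.
have [vw|vw] := eqVneq v w.
  subst w; by case: (@noB x y z v u _ xyu xzw yzv); distinct.
by case: (@noA x y z u w v _ xyu xzw yzv); distinct.
Qed.

(** A triple that meets a K4 with three triples in just two vertices forms D with two of them.
    Hence triangles of the shadow with two vertices in such a K4 stay inside it, which makes
    the missing fourth triple harmless. *)
Let kite_closed x y z u : x &- y &- u -> y &- z &- u -> x &- z &- u -> x != z ->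
  forall a b w, a \in [:: x; y; z; u] -> b \in [:: x; y; z; u] -> a != b ->
  S w a -> S w b -> w \in [:: x; y; z; u].
Proof.
have base x' y' z' u' w : x' &- y' &- u' -> y' &- z' &- u' -> x' &- z' &- u' ->
    w \notin [:: x'; y'; z'; u'] -> x' &- u' &- w \/ x' &- y' &- w -> False.
  move=> xyu yzu xzu; rewrite !inE !negb_or => /and4P[wx wy wz wu].
  have [xy yu xu] := F3n xyu; have [yz zu _] := F3n yzu; have [xz _ _] := F3n xzu.
  case=> [xuw|xyw].
    by apply: (@noD x' y' u' w z' _ xyu xuw (f132 yzu)); distinct.
  by apply: (@noD x' u' y' w z' _ (f132 xyu) xyw (f312 yzu)); distinct.
move=> xyu yzu xzu xz a b w aQ bQ ab.
have pair c d v : c \in [:: x; y; z; u] -> d \in [:: x; y; z; u] -> c != d ->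
    v \notin [:: x; y; z; u] -> c &- d &- v -> False.
  move=> cQ dQ cd vQ cdv.
  have Q1 : v \notin [:: y; z; x; u] by move: vQ; rewrite !inE; case: (v == x); case: (v == y); case: (v == z).
  have Q2 : v \notin [:: z; x; y; u] by move: vQ; rewrite !inE; case: (v == x); case: (v == y); case: (v == z).
  have Q3 : v \notin [:: x; z; y; u] by move: vQ; rewrite !inE; case: (v == x); case: (v == y); case: (v == z).
  have b1 := base _ _ _ _ _ xyu yzu xzu vQ.
  have b2 := base _ _ _ _ _ yzu (f213 xzu) (f213 xyu) Q1.
  have b3 := base _ _ _ _ _ (f213 xzu) xyu (f213 yzu) Q2.
  have b4 := base _ _ _ _ _ xzu (f213 yzu) xyu Q3.
  move: cQ dQ cd cdv; rewrite !inE => /or4P[] /eqP-> /or4P[] /eqP->; rewrite ?eqxx // => _ h.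
  - by apply: b1; right.
  - by apply: b4; right.
  - by apply: b1; left.
  - by apply: b1; right; apply: f213.
  - by apply: b2; right.
  - by apply: b2; left.
  - by apply: b4; right; apply: f213.
  - by apply: b2; right; apply: f213.
  - by apply: b3; left.
  - by apply: b1; left; apply: f213.
  - by apply: b2; left; apply: f213.
  - by apply: b3; left; apply: f213.
move=> wa wb; apply: contraT => wQ.
have Sab : S a b.
  rewrite /shadow ab /=; apply/exists_inP; move: aQ bQ ab.
  by rewrite !inE => /or4P[] /eqP-> /or4P[] /eqP->; rewrite ?eqxx // => _;
    (by exists [set x; y; u]; rewrite // !inE !eqxx ?orbT) ||
    (by exists [set y; z; u]; rewrite // !inE !eqxx ?orbT) ||
    (by exists [set x; z; u]; rewrite // !inE !eqxx ?orbT).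
have [abw|[v [abv bwv awv]]] : a &- b &- w \/ exists v, [/\ a &- b &- v, b &- w &- v & a &- w &- v].
  by apply: S_triangle; rewrite // S_sym.
  by case: (pair a b w).
have vQ : v \in [:: x; y; z; u] by apply: contraT => vQ; case: (pair a b v).
by have [_ _ av'] := F3n awv; case: (pair a v w) => //; apply: f132.
Qed.

(** The three triangles of a gem either are all triples, and then form D, or one of them spans a
    K4 with three triples; that K4 then absorbs the other triangles, one after another, along
    shared edges, leaving no room for the five vertices of the gem. *)
Lemma shadow_gemfree : gemfree_on S [set: V].
Proof.
split=> //.
- by move=> x; rewrite /shadow eqxx.
move=> a x b c y ax ab ac ay xb bc cy xc by'.
have [nax nab nac nay] : [/\ a != x, a != b, a != c & a != y].
  by split; [case/andP: ax|case/andP: ab|case/andP: ac|case/andP: ay].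
have [nxb nbc ncy] : [/\ x != b, b != c & c != y].
  by split; [case/andP: xb|case/andP: bc|case/andP: cy].
have flip u v : S u v -> S v u by rewrite S_sym.
have [axb|[u [axu xbu abu]]] := S_triangle ax xb ab; last first.
  have K := kite_closed axu xbu abu nab.
  have cQ : c \in [:: a; x; b; u].
    by apply: (K a b) => //; rewrite ?inE ?eqxx ?orbT //; apply: flip.
  have yQ : y \in [:: a; x; b; u].
    by apply: (K a c) => //; rewrite ?inE ?eqxx ?orbT //; apply: flip.
  have cu : c = u.
    by move: cQ; rewrite !inE (eq_sym c a) (negPf nac) (eq_sym c x) (negPf xc) (eq_sym c b) (negPf nbc) => /eqP.
  move: yQ; rewrite !inE (eq_sym y a) (negPf nay) (eq_sym y b) (negPf by') -cu (eq_sym y c) (negPf ncy) !orbF.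
  by move/eqP.
have [abc|[u [abu bcu acu]]] := S_triangle ab bc ac; last first.
  have K := kite_closed abu bcu acu nac.
  have xQ : x \in [:: a; b; c; u].
    by apply: (K a b) => //; rewrite ?inE ?eqxx ?orbT //; apply: flip.
  have yQ : y \in [:: a; b; c; u].
    by apply: (K a c) => //; rewrite ?inE ?eqxx ?orbT //; apply: flip.
  move: xQ; rewrite !inE (eq_sym x a) (negPf nax) (negPf nxb) (negPf xc) => /eqP->.
  by move: yQ; rewrite !inE (eq_sym y a) (negPf nay) (eq_sym y b) (negPf by') (eq_sym y c) (negPf ncy) => /eqP->.
have [acy|[u [acu cyu ayu]]] := S_triangle ac cy ay; last first.
  have K := kite_closed acu cyu ayu nay.
  have bQ : b \in [:: a; c; y; u].
    by apply: (K a c) => //; rewrite ?inE ?eqxx ?orbT //; apply: flip.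
  have xQ : x \in [:: a; c; y; u].
    by apply: (K a b) => //; rewrite ?inE ?eqxx ?orbT //; apply: flip.
  have bu : b = u.
    by move: bQ; rewrite !inE (eq_sym b a) (negPf nab) (negPf nbc) (negPf by') => /eqP.
  move: xQ; rewrite !inE (eq_sym x a) (negPf nax) (negPf xc) -bu (negPf nxb) orbF.
  by move/eqP.
apply/eqP; apply: contraT => xy; by case: (@noD b c a x y _ (f231 abc) (f312 axb) (f213 acy)); distinct.
Qed.

Lemma sub_shadow_triangles : F \subset cliques S 3.
Proof.
apply/subsetP => T TF; rewrite inE (forall_inP F3) //=; apply/cliqueP => x y xT yT xy.
by rewrite /shadow xy; apply/exists_inP; exists T; rewrite ?xT.
Qed.

End ShadowGemfree.

(** Each of A, B, D has a gem in its shadow: around the vertices 1, 1, 3 there are the paths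
    4-2-3-5, 5-2-3-4, 4-1-2-5. *)
Lemma gemfree_avoids (V : finType) (e : rel V) W (F : {set {set V}}) :
  gemfree_on e W -> F \subset cliques e 3 ->
  triple_system F /\ avoids F [:: confA; confB; confD].
Proof.
move=> G /subsetP FT; split.
  by apply/forall_inP => T /FT/cliques_card->.
have E m (f : 'I_m -> V) (t : seq nat) (i j : 'I_m) : injective f -> f @: [set i : 'I_m | i.+1 \in t] \in F ->
    i.+1 \in t -> j.+1 \in t -> i != j -> e (f i) (f j).
  move=> fi tF it jt ij; apply: (clique_edge (FT _ tF)); rewrite ?(inj_eq fi) //;
    by apply: imset_f; rewrite inE.
rewrite /avoids /= andbT; apply/and3P; split; apply/negP => /containsP[f fi h].
- have h1 := h [:: 1; 2; 4] isT; have h2 := h [:: 1; 3; 5] isT; have h3 := h [:: 2; 3; 6] isT.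
  pose o i (H : i < 6) := @Ordinal 6 i H.
  have : f (@o 3 isT) = f (@o 4 isT).
    apply: (gf_gem G (a := f (@o 0 isT)) (b := f (@o 1 isT)) (c := f (@o 2 isT)));
      rewrite ?(inj_eq fi) //;
      first [by apply: (E _ _ _ _ _ fi h1)|by apply: (E _ _ _ _ _ fi h2)|by apply: (E _ _ _ _ _ fi h3)].
  by move/fi.
- have h1 := h [:: 1; 2; 5] isT; have h2 := h [:: 1; 3; 4] isT; have h3 := h [:: 2; 3; 4] isT.
  pose o i (H : i < 5) := @Ordinal 5 i H.
  have : f (@o 4 isT) = f (@o 3 isT).
    apply: (gf_gem G (a := f (@o 0 isT)) (b := f (@o 1 isT)) (c := f (@o 2 isT)));
      rewrite ?(inj_eq fi) //;
      first [by apply: (E _ _ _ _ _ fi h1)|by apply: (E _ _ _ _ _ fi h2)|by apply: (E _ _ _ _ _ fi h3)].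
  by move/fi.
have h1 := h [:: 1; 2; 3] isT; have h2 := h [:: 1; 3; 4] isT; have h3 := h [:: 2; 3; 5] isT.
pose o i (H : i < 5) := @Ordinal 5 i H.
have : f (@o 3 isT) = f (@o 4 isT).
  apply: (gf_gem G (a := f (@o 2 isT)) (b := f (@o 0 isT)) (c := f (@o 1 isT)));
    rewrite ?(inj_eq fi) //;
    first [by apply: (E _ _ _ _ _ fi h1)|by apply: (E _ _ _ _ _ fi h2)|by apply: (E _ _ _ _ _ fi h3)].
by move/fi.
Qed.

(** * The light graph and weighted degrees *)

Section Light.
Variables (V : finType) (e : rel V) (W : {set V}).
Hypothesis G : gemfree_on e W.

Local Notation tri := (cliques e 3).
Local Notation tet := (cliques e 4).

(** The edges at the chosen page of a triangle outside the K4s. *)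
Definition light : rel V := fun u v =>
  [exists T in paged e, [&& u \in T, v \in T, u != v &
                          (page e T == Some u) || (page e T == Some v)]].

Lemma lightP u v : reflect (exists T, [/\ T \in tri, u \in T, v \in T, u != v &
    page e T = Some u \/ page e T = Some v]) (light u v).
Proof.
apply: (iffP exists_inP) => [[T]|[T [TT uT vT uv pT]]].
  rewrite inE => /andP[TT _] /and4P[uT vT uv pT]; exists T; split=> //.
  by case/orP: pT => /eqP; [left|right].
exists T; first by rewrite inE TT; case: pT => ->.
by rewrite uT vT uv; case: pT => ->; rewrite eqxx ?orbT.
Qed.

Lemma light_sym : symmetric light.
Proof.
move=> u v; apply/lightP/lightP => -[T [TT uT vT uv pT]]; exists T; split=> //.
- by rewrite eq_sym.
- by case: pT; [right|left].
- by rewrite eq_sym.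
- by case: pT; [right|left].
Qed.

Lemma light_edge u v : light u v -> e u v.
Proof. by case/lightP => T [TT uT vT uv _]; apply: clique_edge TT _ _ _. Qed.

Lemma page_edge_unique T T' p u : T \in tri -> T' \in tri -> page e T = Some p ->
  p \in T' -> u \in T -> u \in T' -> u != p -> T' = T.
Proof.
move=> TT TT' /pageP/is_pageP[pT h] pT' uT uT' up.
apply/eqP; rewrite eqEcard (cliques_card TT) (cliques_card TT') leqnn andbT.
apply/subsetP => z zT'.
have [-> //|zp] := eqVneq z p; have [-> //|zu] := eqVneq z u.
by apply: (h u z) => //; apply: clique_edge TT' _ _ _; rewrite // eq_sym.
Qed.

Lemma light_uniq u v T T' : light u v -> T \in tri -> T' \in tri ->
  u \in T -> v \in T -> u \in T' -> v \in T' -> T = T'.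
Proof.
case/lightP => S [ST uS vS uv pS] TT TT' uT vT uT' vT'.
have key S' : S' \in tri -> u \in S' -> v \in S' -> S' = S.
  move=> S'T uS' vS'; case: pS => pS.
    by apply: (page_edge_unique ST S'T pS uS' vS vS'); rewrite eq_sym.
  exact: (page_edge_unique ST S'T pS vS' uS uS' uv).
by rewrite (key T) // (key T').
Qed.

Lemma light_page u v T : light u v -> T \in tri -> u \in T -> v \in T ->
  page e T = Some u \/ page e T = Some v.
Proof.
move=> uv TT uT vT; case/lightP: (uv) => S [ST uS vS _ pS].
by rewrite (light_uniq uv TT ST).
Qed.

Lemma page_light T p u : T \in tri -> page e T = Some p -> u \in T -> u != p ->
  light p u.
Proof.
move=> TT pT uT up; apply/lightP; exists T; split=> //; last by left.
  by have /pageP/is_pageP[] := pT.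
by rewrite eq_sym.
Qed.

Lemma light_no_tet u v Q : light u v -> Q \in tet -> u \in Q -> v \in Q -> False.
Proof.
case/lightP => S [ST uS vS uv pS] QK uQ vQ.
have SQ := tet_triangle G QK ST uv uQ vQ uS vS.
by case: pS => pS; apply: (page_notet G pS ST QK SQ).
Qed.

(** Three light edges uv, vw, uw would have the triangle uvw as their only triangle, and its
    page would lie on all three edges. *)
Lemma light_trifree u v w : light u v -> light v w -> light u w -> False.
Proof.
move=> uv vw uw.
have TT := triangle_mk G (light_edge uv) (light_edge vw) (light_edge uw).
have [uT vT wT] : [/\ u \in [set u; v; w], v \in [set u; v; w] & w \in [set u; v; w]].
  by rewrite !inE !eqxx !orbT.
have nuv := edge_neq G (light_edge uv).
have nvw := edge_neq G (light_edge vw).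
have nuw := edge_neq G (light_edge uw).
move: (light_page uv TT uT vT) (light_page vw TT vT wT) (light_page uw TT uT wT).
case: (page e _) => [p|]; last by case.
have P x y : Some p = Some x \/ Some p = Some y -> (p == x) || (p == y).
  by case=> -[->]; rewrite eqxx ?orbT.
move=> /P puv /P pvw /P puw; move: puv pvw puw.
case: (eqVneq p u) => [->|_] /=; first by rewrite (negPf nuv) (negPf nuw).
by move=> /eqP-> _; rewrite (negPf nvw).
Qed.

(** Neighbours of v within the K4s. *)
Definition tnbr (v : V) : {set V} :=
  [set u | (u != v) && [exists Q in tet, (u \in Q) && (v \in Q)]].
Definition lnbr (v : V) : {set V} := [set u | light v u].
Definition tets_at (v : V) : {set {set V}} := [set Q in tet | v \in Q].

Lemma tets_atE v Q : (Q \in tets_at v) = (Q \in tet) && (v \in Q).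
Proof. by rewrite inE. Qed.

Lemma pagedE T : (T \in paged e) = (T \in tri) && page e T.
Proof. by rewrite inE. Qed.

Lemma tnbrP u v : reflect (u != v /\ exists Q, [/\ Q \in tet, u \in Q & v \in Q])
  (u \in tnbr v).
Proof.
rewrite inE; apply: (iffP andP) => -[uv].
  by case/exists_inP => Q QK /andP[uQ vQ]; split=> //; exists Q.
by case=> Q [QK uQ vQ]; split=> //; apply/exists_inP; exists Q; rewrite ?uQ.
Qed.

Lemma tnbr_edge u v : u \in tnbr v -> e v u.
Proof.
by case/tnbrP => uv [Q [QK uQ vQ]]; apply: clique_edge QK _ _ _; rewrite // eq_sym.
Qed.

Lemma card_tnbr v : #|tnbr v| = 3 * #|tets_at v|.
Proof.
rewrite (card_by_fibres (B := tets_at v) (R := fun u Q => u \in Q)).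
- rewrite mulnC -sum_nat_const; apply: eq_bigr => Q; rewrite inE => /andP[QK vQ].
  have := cardsD1 v Q; rewrite vQ (cliques_card QK) => -[->].
  apply: eq_card => u; rewrite inE [RHS]inE.
  apply/andP/andP => [[/tnbrP[uv _] uQ]|[]]; rewrite !inE // => uv uQ.
  by split=> //; rewrite uv; apply/exists_inP; exists Q; rewrite ?uQ.
- move=> u /tnbrP[uv [Q [QK uQ vQ]]]; exists Q => //.
  by rewrite inE QK.
- move=> u Q Q' /tnbrP[uv _]; rewrite !tets_atE => /andP[QK vQ] /andP[QK' vQ'] uQ uQ'.
  exact: (tet_eq G QK QK' uv uQ vQ uQ' vQ').
Qed.

Lemma tnbr_light_disjoint v : [disjoint lnbr v & tnbr v].
Proof.
apply/pred0P => u /=; apply/negP => /andP[]; rewrite inE => vu /tnbrP[uv [Q [QK uQ vQ]]].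
exact: (light_no_tet vu QK vQ uQ).
Qed.

(** The degree of v when spines, and edges in no triangle at all, are left out. *)
Definition mdeg v := #|lnbr v| + 3 * #|tets_at v|.

Lemma mdegE v : mdeg v = #|lnbr v :|: tnbr v|.
Proof.
rewrite cardsU; have := tnbr_light_disjoint v; rewrite -setI_eq0 => /eqP->.
by rewrite cards0 subn0 card_tnbr.
Qed.

Lemma mnbr_edge v u : u \in lnbr v :|: tnbr v -> e v u.
Proof. by case/setUP => [|/tnbr_edge //]; rewrite inE => /light_edge. Qed.

(** The only common neighbour b of the ends of a light edge ac is joined to one of them by a
    spine, since light edges form no triangle and abc is in no K4. *)
Lemma light_mdeg a c : light a c -> mdeg a + mdeg c <= #|W|.
Proof.
move=> ac; rewrite !mdegE -cardsUI.
have -> : (lnbr a :|: tnbr a) :&: (lnbr c :|: tnbr c) = set0.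
  apply/setP => u; rewrite inE [RHS]inE; apply/negP => /andP[ua uc].
  have eac := light_edge ac; have eau := mnbr_edge ua; have ecu := mnbr_edge uc.
  (* A K4 containing u and an end of ac would contain the triangle acu, which has a page. *)
  have TT := triangle_mk G eac ecu eau.
  have [aT cT uT] : [/\ a \in [set a; c; u], c \in [set a; c; u] & u \in [set a; c; u]].
    by rewrite !inE !eqxx !orbT.
  have nac := edge_neq G eac.
  have light_of v : v \in [set a; c; u] -> u \in lnbr v :|: tnbr v -> light v u.
    move=> vT; case/setUP => [|/tnbrP[uv [Q [QK uQ vQ]]]]; first by rewrite inE.
    have TQ := tet_triangle G QK TT uv uQ vQ uT vT.
    by case: (light_page ac TT aT cT) => pT; case: (page_notet G pT TT QK TQ).
  exact: (light_trifree ac (light_of c cT uc) (light_of a aT ua)).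
rewrite cards0 addn0; apply: subset_leq_card; apply/subsetP => u.
by case/setUP => /mnbr_edge; apply: (edge_supp_r G).
Qed.

Definition outer (Q : {set V}) (v : V) : {set V} := nbr e v :\: Q.

Lemma outer_disjoint Q x y : Q \in tet -> x \in Q -> y \in Q -> x != y ->
  [disjoint outer Q x & outer Q y].
Proof.
move=> QK xQ yQ xy; apply/pred0P => z /=; apply/negP; rewrite !inE.
case/andP => /andP[zQ xz] /andP[_ yz]; case/negP: zQ.
by apply: (tet_closed G QK xQ yQ xy); rewrite (gf_sym G).
Qed.

Lemma sum_outer Q : Q \in tet -> \sum_(v in Q) #|outer Q v| + 4 <= #|W|.
Proof.
move=> QK; have QW := clique_sub G (isT : 1 < 4) QK.
have -> : #|W| = #|W :\: Q| + 4.
  by have := cardsID Q W; rewrite (setIidPr QW) (cliques_card QK); lia.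
rewrite leq_add2r.
have -> : \sum_(v in Q) #|outer Q v| = \sum_(v in Q) #|[set u in W :\: Q | e v u]|.
  apply: eq_bigr => v vQ; apply: eq_card => u; rewrite !inE.
  by case evu: (e v u); rewrite ?andbF // !andbT (edge_supp_r G evu) andbT.
rewrite double_count -sum1_card; apply: leq_sum => u; rewrite inE => /andP[uQ _].
apply/card_le1P => x; rewrite inE => /andP[xQ xu] y; rewrite !inE.
apply/andP/eqP => [[yQ yu]|-> //]; apply/eqP/negPn/negP => yx; case/negP: uQ.
by apply: (tet_closed G QK yQ xQ yx); rewrite (gf_sym G).
Qed.

Lemma card_nbr_outer Q v : Q \in tet -> v \in Q -> #|nbr e v| = #|outer Q v| + 3.
Proof.
move=> QK vQ; rewrite /outer -(cardsID Q (nbr e v)) addnC; congr (_ + _).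
have := cardsD1 v Q; rewrite vQ (cliques_card QK) => -[->].
apply: eq_card => u; rewrite !inE; case uQ: (u \in Q); rewrite ?andbF // !andbT.
apply/idP/idP => [vu|uv]; first by rewrite eq_sym (edge_neq G).
by apply: clique_edge QK _ _ _; rewrite // eq_sym.
Qed.

Lemma sum_mdeg_tet Q : Q \in tet -> \sum_(v in Q) mdeg v <= #|W| + 8.
Proof.
move=> QK; apply: (@leq_trans (\sum_(v in Q) (#|outer Q v| + 3))).
  apply: leq_sum => v vQ; rewrite -card_nbr_outer // mdegE.
  by apply: subset_leq_card; apply/subsetP => u /mnbr_edge; rewrite inE.
rewrite big_split sum_nat_const (cliques_card QK) /=.
by have := sum_outer QK; lia.
Qed.

Lemma sum_tets_at : \sum_(v in W) #|tets_at v| = 4 * #|tet|.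
Proof.
rewrite double_count mulnC -sum_nat_const; apply: eq_bigr => Q QK.
rewrite -(cliques_card QK); apply: eq_card => v; rewrite inE.
by case vQ: (v \in Q); rewrite ?andbF // (subsetP (clique_sub G (isT : 1 < 4) QK)).
Qed.

Lemma card_tri : #|tri| = #|paged e| + 4 * #|tet|.
Proof.
have pT : paged e \subset tri by apply/subsetP => T; rewrite inE => /andP[].
rewrite -(cardsID (paged e) tri) (setIidPr pT); congr (_ + _).
rewrite (card_by_fibres (B := tet) (R := fun T Q : {set V} => T \subset Q)).
- rewrite mulnC -sum_nat_const; apply: eq_bigr => Q QK.
  rewrite -[RHS]/('C(4, 3)) -(cliques_card QK) -cards_draws; apply: eq_card => T.
  rewrite inE [RHS]inE; case TQ: (T \subset Q); rewrite ?andbF //= andbT.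
  apply/idP/eqP => [|cT]; first by rewrite inE => /andP[_ /cliques_card].
  have TT : T \in tri.
    rewrite inE cT eqxx; apply/cliqueP => x y xT yT xy.
    by apply: clique_edge QK _ _ xy; apply: (subsetP TQ).
  rewrite !inE; move: (TT); rewrite inE => ->; rewrite andbT /=.
  apply/negP; case pg: (page e T) => [p|//] _.
  exact: (page_notet G pg TT QK TQ).
- move=> T; rewrite in_setD => /andP[TP TT].
  have [pg|[Q QK TQ]] := tri_page_or_tet G TT; last by exists Q.
  by rewrite pagedE TT pg in TP.
- move=> T Q Q'; rewrite in_setD => /andP[_ TT] QK QK' TQ TQ'.
  have [a aT] : exists a, a \in T by apply/card_gt0P; rewrite (cliques_card TT).
  have [b [c [TE ab bc ac]]] := triangle_vertex G TT aT.
  have bT : b \in T by rewrite TE !inE eqxx orbT.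
  by apply: (tet_eq G QK QK' (edge_neq G ab)); rewrite ?(subsetP TQ) ?(subsetP TQ').
Qed.

Lemma sum_lnbr : \sum_(v in W) #|lnbr v| = 4 * #|paged e|.
Proof.
rewrite mulnC -sum_nat_const.
under eq_bigr => v _.
  rewrite (card_by_fibres (B := paged e) (R := fun (u : V) (T : {set V}) => (u \in T) && (v \in T))); last first.
  - move=> u T T'; rewrite !pagedE inE => vu /andP[TT _] /andP[TT' _] /andP[uT vT] /andP[uT' vT'].
    exact: (light_uniq vu).
  - move=> u; rewrite inE => /lightP[T [TT vT uT uv pT]]; exists T; last by rewrite uT.
    by rewrite inE TT; case: pT => ->.
  over.
rewrite exchange_big /=; apply: eq_bigr => T; rewrite inE => /andP[TT].
case pT: (page e T) => [p|//] _.
have /pageP/is_pageP[pinT _] := pT.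
have [a [b [TE pa ab pb]]] := triangle_vertex G TT pinT.
have npa := edge_neq G pa; have nab := edge_neq G ab; have npb := edge_neq G pb.
have [aT bT] : a \in T /\ b \in T by rewrite TE !inE !eqxx !orbT.
have TW := clique_sub G (isT : 1 < 3) TT.
rewrite (big_setID T) /= (setIidPr TW) [X in _ + X]big1 ?addn0; last first.
  move=> v; rewrite inE => /andP[vT _]; apply/eqP; rewrite cards_eq0.
  by apply/eqP/setP => u; rewrite !inE (negPf vT) !andbF.
have sp : [set x in lnbr p | (x \in T) && (p \in T)] = [set a; b].
  apply/setP => x; rewrite !inE pinT andbT; apply/andP/orP => [[px]|].
    rewrite TE !inE => /orP[/orP[/eqP xp|->]|->]; try by [left|right].
    by move/light_edge: px; rewrite xp (gf_irr G).
  by case=> /eqP->; split=> //; apply: (page_light TT pT) => //; rewrite eq_sym.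
have sa x y : x \in T -> y \in T -> p != x -> p != y -> x != y ->
    [set z in lnbr x | (z \in T) && (x \in T)] = [set p].
  move=> xT yT px py xy; apply/setP => z; rewrite !inE xT andbT; apply/andP/eqP.
    case=> xz zT; case: (light_page xz TT xT zT); rewrite pT => -[] E //.
    by rewrite E eqxx in px.
  by move=> ->; rewrite light_sym; split=> //; apply: (page_light TT pT) => //; rewrite eq_sym.
have sumT (f : V -> nat) : \sum_(v in T) f v = f p + (f a + f b).
  rewrite TE -setUA big_setU1 ?inE ?negb_or ?npa //=.
  by rewrite big_setU1 ?inE //= big_set1.
rewrite sumT sp (sa a b) // (sa b a) //; last by rewrite eq_sym.
by rewrite cards2 nab !cards1.
Qed.

(** The degree sums over light edges and over K4s are added with the factors 3 and 16. These
    make the terms in p^2 and k^2 of the left-hand side sum (p + 3k)(3p + 16k) equal to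
    those of 3 sum (p + 4k)^2, where p + 4k is the weight whose total is four times the number
    of triangles; one pk is left over. *)
Lemma weighted_count :
  3 * \sum_(v in W) (#|lnbr v| + 4 * #|tets_at v|) ^ 2
    + \sum_(v in W) #|lnbr v| * #|tets_at v| + 8 * #|W| * #|tet|
  <= 6 * #|W| * #|tri| + 128 * #|tet|.
Proof.
have H1 : 2 * \sum_(v in W) mdeg v * #|lnbr v| <= #|W| * (4 * #|paged e|).
  have E1 : \sum_(v in W) mdeg v * #|lnbr v| = \sum_(v in W) \sum_(u in W | light v u) mdeg v.
    apply: eq_bigr => v _; rewrite sum_nat_const mulnC; congr (_ * _); apply: eq_card => u.
    rewrite inE unfold_in /=; case vu: (light v u); rewrite ?andbF //.
    by rewrite (edge_supp_r G (light_edge vu)).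
  have E2 : \sum_(v in W) mdeg v * #|lnbr v| = \sum_(v in W) \sum_(u in W | light v u) mdeg u.
    rewrite E1 !pair_big_dep /= (reindex_inj (h := fun x : V * V => (x.2, x.1))) /=; last first.
      by move=> [a b] [c d] [-> ->].
    by apply: eq_bigl => -[a b] /=; rewrite light_sym andbCA.
  rewrite mul2n -addnn {1}E1 E2 -big_split /= -sum_lnbr big_distrr /=.
  apply: leq_sum => v vW; rewrite -big_split /= mulnC -sum_nat_const.
  apply: (@leq_trans (\sum_(u in W | light v u) #|W|)).
    by apply: leq_sum => u /andP[_ vu]; apply: light_mdeg.
  rewrite !sum_nat_const leq_mul2r; apply/orP; right; apply: subset_leq_card.
  by apply/subsetP => u; rewrite unfold_in /= inE => /andP[].
have H2 : \sum_(v in W) mdeg v * #|tets_at v| <= #|tet| * (#|W| + 8).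
  have -> : \sum_(v in W) mdeg v * #|tets_at v| = \sum_(Q in tet) \sum_(v in Q) mdeg v.
    transitivity (\sum_(v in W) \sum_(Q in tet | v \in Q) mdeg v).
      apply: eq_bigr => v _; rewrite sum_nat_const mulnC; congr (_ * _).
      by apply: eq_card => Q; rewrite [RHS]unfold_in /= tets_atE.
    rewrite (exchange_big_dep (fun Q => Q \in tet)) /=; last by move=> v Q _ /andP[].
    apply: eq_bigr => Q QK; apply: eq_bigl => v; rewrite QK /=.
    by case vQ: (v \in Q); rewrite ?andbF // (subsetP (clique_sub G (isT : 1 < 4) QK)).
  by rewrite -sum_nat_const; apply: leq_sum => Q; apply: sum_mdeg_tet.
(* In each vertex: 3(p + 4k)^2 + pk = (p + 3k)(3p + 16k). *)
have E : 3 * \sum_(v in W) (#|lnbr v| + 4 * #|tets_at v|) ^ 2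
    + \sum_(v in W) #|lnbr v| * #|tets_at v| =
    3 * \sum_(v in W) mdeg v * #|lnbr v| + 16 * \sum_(v in W) mdeg v * #|tets_at v|.
  rewrite !big_distrr /= -!big_split /=; apply: eq_bigr => v _; rewrite /mdeg -mulnn; move: #|lnbr v| #|tets_at v| => p k. clear; lia.
rewrite E card_tri; nia.
Qed.

End Light.

(** * Mantel's theorem and its near-extremal graphs *)

Section Mantel.
Variables (V : finType) (L : rel V) (W : {set V}).
Hypothesis Lsym : symmetric L.
Hypothesis Ltri : forall x y z, L x y -> L y z -> L x z -> False.

(** Edges inside A are counted twice in [arcs A A]. *)
Definition arcs (A B : {set V}) : nat := \sum_(u in A) #|[set w in B | L u w]|.

Lemma arcsC A B : arcs A B = arcs B A.
Proof.
rewrite /arcs double_count; apply: eq_bigr => w _; apply: eq_card => u.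
by rewrite !inE Lsym.
Qed.

Lemma arcsUr (A B C : {set V}) : [disjoint B & C] -> arcs A (B :|: C) = arcs A B + arcs A C.
Proof.
move=> dBC; rewrite /arcs -big_split /=; apply: eq_bigr => u _.
rewrite -cardsUI [X in _ + X](_ : _ = 0) ?addn0.
  by apply: eq_card => w; rewrite !inE andb_orl.
apply/eqP; rewrite cards_eq0; apply/eqP/setP => w; rewrite !inE.
apply/negP => /andP[/andP[wB _] /andP[wC _]].
by move/pred0P: dBC => /(_ w) /=; rewrite wB wC.
Qed.

Lemma arcsUl (A B C : {set V}) : [disjoint A & B] -> arcs (A :|: B) C = arcs A C + arcs B C.
Proof. by move=> dAB; rewrite arcsC arcsUr // ![arcs C _]arcsC. Qed.

Lemma arcs_gt0 A B : (0 < arcs A B) -> exists u w, [/\ u \in A, w \in B & L u w].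
Proof.
rewrite lt0n => A0; have [u uA] : exists2 u, u \in A & 0 < #|[set w in B | L u w]|.
  apply/exists_inP; apply: contraNT A0 => /exists_inPn h.
  by rewrite /arcs big1 // => u uA; have := h u uA; rewrite lt0n negbK => /eqP.
by case/card_gt0P => w; rewrite inE => /andP[wB Luw]; exists u, w.
Qed.

Lemma arcs_eq0 A B x y : arcs A B = 0 -> x \in A -> y \in B -> ~~ L x y.
Proof.
move=> AB0 xA yB; apply/negP => Lxy; move: AB0; rewrite /arcs (bigD1 x) //=.
have : 0 < #|[set w in B | L x w]| by apply/card_gt0P; exists y; rewrite inE yB.
by lia.
Qed.

(** X is the neighbourhood of a vertex of maximum degree, so X contains no edge, and the edges
    are counted from the vertices outside X, each of degree at most |X|. The last clause:
    if equality holds and u, w are adjacent in Y, then both have degree |X|, and their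
    disjoint neighbourhoods miss the chosen vertex. *)
Lemma mantel_cut : exists X Y : {set V}, [/\ X :|: Y = W, [disjoint X & Y],
  arcs X X = 0, arcs W W + arcs Y Y <= 2 * (#|X| * #|Y|) &
  0 < arcs Y Y -> arcs W W + arcs Y Y = 2 * (#|X| * #|Y|) -> 2 * #|X| < #|W| ].
Proof.
have [->|[v0 v0W]] := set_0Vmem W.
  by exists set0, set0; rewrite setU0 -setI_eq0 setI0 /arcs !big_set0 cards0.
have [v vW vmax] : exists2 v, v \in W & forall u, u \in W ->
    #|[set w in W | L u w]| <= #|[set w in W | L v w]|.
  by case: (arg_maxnP (fun u => #|[set w in W | L u w]|) v0W) => v vW h; exists v.
set X := [set w in W | L v w] in vmax *; set Y := W :\: X.
have XW : X \subset W by apply/subsetP => w; rewrite inE => /andP[].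
have XY : X :|: Y = W by rewrite -{1}(setIidPr XW) setID.
have dXY : [disjoint X & Y].
  by rewrite -setI_eq0 /Y setDE setICA setICr setI0.
have vX w : w \in X -> L v w by rewrite inE => /andP[].
have XX : arcs X X = 0.
  apply/eqP; rewrite -leqn0 leqNgt; apply/negP => /arcs_gt0[u [w [uX wX uw]]].
  exact: (Ltri (vX u uX) uw (vX w wX)).
have WW : arcs W W + arcs Y Y = 2 * arcs Y W.
  by rewrite -{1 2 3}XY arcsUl // !arcsUr // XX (arcsC X Y); lia.
have le u : u \in Y -> #|[set w in W | L u w]| <= #|X|.
  by rewrite inE => /andP[_ uW]; apply: vmax.
have YW := leqif_sum (fun u uY => leqif_eq (le u uY)).
have YWle : arcs Y W <= #|X| * #|Y|.
  by rewrite mulnC -sum_nat_const; have [] := YW.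
exists X, Y; split=> //; first by rewrite WW leq_pmul2l.
move=> /arcs_gt0[u [w [uY wY uw]]]; rewrite WW => /eqP; rewrite eqn_pmul2l //.
rewrite [#|X| * _]mulnC -sum_nat_const /arcs (snd YW) => /forall_inP full.
have /eqP du := full u uY; have /eqP dw := full w wY.
have vu z : z \in Y -> ~~ L z v.
  by rewrite !inE Lsym => /andP[+ zW]; rewrite zW.
set A := [set x in W | L u x] in du; set B := [set x in W | L w x] in dw.
have AB0 : A :&: B = set0.
  apply/setP => x; rewrite !inE; apply/negP => /andP[/andP[_ ux] /andP[_ wx]].
  exact: (Ltri uw wx ux).
have : #|A :|: B| < #|W|.
  apply: proper_card; apply/properP; split.
    by apply/subsetP => x; rewrite !inE => /orP[] /andP[].
  by exists v => //; rewrite !inE !negb_or !negb_and !vu // !orbT.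
by rewrite cardsU AB0 cards0 du dw; lia.
Qed.

Lemma mantel : 2 * arcs W W <= #|W| ^ 2.
Proof.
have [X [Y [XY dXY _ le _]]] := mantel_cut.
have cW : #|W| = #|X| + #|Y| by rewrite -XY cardsU disjoint_setI0 // cards0 subn0.
have [AGM _] := nat_AGM2 #|X| #|Y|; rewrite cW; lia.
Qed.

(** An edge inside Y would make the cut attain n^2/4, so |X| = n/2, against the last clause of
    [mantel_cut]. *)
Lemma mantel_near t : arcs W W = 4 * t -> #|W| ^ 2 <= 8 * t + 4 ->
  exists X Y : {set V}, [/\ X :|: Y = W, [disjoint X & Y],
    arcs X X = 0, arcs Y Y = 0 & #|X| * #|Y| <= 2 * t + 1 ].
Proof.
have [X [Y [XY dXY XX le eq]]] := mantel_cut; move=> W4t W8t.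
have cW : #|W| = #|X| + #|Y| by rewrite -XY cardsU disjoint_setI0 // cards0 subn0.
have [AGM _] := nat_AGM2 #|X| #|Y|; rewrite -cW in AGM.
exists X, Y; split=> //; last by lia.
apply/eqP; rewrite -leqn0 leqNgt; apply/negP => YY.
(* An edge inside Y is counted from both ends. *)
have YY2 : 1 < arcs Y Y.
  have [u [w [uY wY uw]]] := arcs_gt0 YY.
  have uNw : u != w by apply/eqP => E; move: uw; rewrite -E => Luu; apply: (Ltri Luu Luu Luu).
  rewrite /arcs (bigD1 u) //= (bigD1 w) /=; last by rewrite wY eq_sym.
  have : 0 < #|[set x in Y | L u x]| by apply/card_gt0P; exists w; rewrite inE wY.
  have : 0 < #|[set x in Y | L w x]| by apply/card_gt0P; exists u; rewrite inE uY Lsym.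
  by lia.
have XYW : 4 * (#|X| * #|Y|) = #|W| ^ 2 by lia.
have := eq YY _; rewrite cW => /(_ ltac:(lia)) lt.
move: XYW; rewrite cW -mulnn; nia.
Qed.

End Mantel.

(** * Graphs without K4 *)

(** The shadow of a book family: Y is the union of the spines, X the set of pages. *)
Record paired_join (V : finType) (e : rel V) (X Y : {set V}) : Prop := PairedJoin {
  pj_disj : [disjoint X & Y];
  pj_join : {in X & Y, forall x y, e x y};
  pj_indep : {in X &, forall x x', ~~ e x x'};
  pj_mate : {in Y, forall y, exists z, [/\ z \in Y, e y z &
              forall z', z' \in Y -> e y z' -> z' = z]} }.

Definition pairs (V : finType) (e : rel V) (Y : {set V}) : {set {set V}} :=
  [set S in cliques e 2 | S \subset Y].

Section Bipartite.
Variables (V : finType) (e : rel V) (W : {set V}).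
Hypothesis G : gemfree_on e W.
Local Notation tri := (cliques e 3).
Local Notation L := (light e).

Lemma pair_mk (Y : {set V}) y z : y \in Y -> z \in Y -> e y z -> [set y; z] \in pairs e Y.
Proof.
move=> yY zY yz; rewrite !inE cards2 (edge_neq G yz) /=; apply/andP; split.
  apply/cliqueP => u v; rewrite !inE => /orP[] /eqP-> /orP[] /eqP-> //; rewrite ?eqxx //.
  by rewrite (gf_sym G).
by apply/subsetP => u; rewrite !inE => /orP[] /eqP->.
Qed.

Lemma pairsP (Y S : {set V}) y : S \in pairs e Y -> y \in S ->
  exists z, [/\ S = [set y; z], y \in Y, z \in Y & e y z].
Proof.
rewrite inE => /andP[SK SY] yS; have cS := cliques_card SK.
have: 0 < #|S :\ y| by have := cardsD1 y S; rewrite yS; lia.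
case/card_gt0P => z; rewrite !inE => /andP[zy zS]; exists z.
have yz : y != z by rewrite eq_sym.
split; rewrite ?(subsetP SY) //; last exact: clique_edge SK yS zS yz.
apply/esym/eqP; rewrite eqEcard cS cards2 yz andbT.
by apply/subsetP => u; rewrite !inE => /orP[] /eqP->.
Qed.

Lemma card_matched (Y : {set V}) :
  {in Y, forall y, exists z, [/\ z \in Y, e y z & forall z', z' \in Y -> e y z' -> z' = z]} ->
  #|Y| = 2 * #|pairs e Y|.
Proof.
move=> M; rewrite (card_by_fibres (B := pairs e Y) (R := fun (y : V) (S : {set V}) => y \in S)).
- rewrite mulnC -sum_nat_const; apply: eq_bigr => S; rewrite inE => /andP[SK SY].
  rewrite -(cliques_card SK); apply: eq_card => y; rewrite inE.
  by case yS: (y \in S); rewrite ?andbF // (subsetP SY).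
- move=> y yY; have [z [zY yz _]] := M y yY.
  by exists [set y; z]; [apply: pair_mk|rewrite !inE eqxx].
- move=> y S S' yY SP S'P /(pairsP SP)[z [-> _ zY yz]] /(pairsP S'P)[z' [-> _ z'Y yz']].
  by have [w [_ _ h]] := M y yY; rewrite (h z) // (h z').
Qed.

Section Core.
Variables X Y : {set V}.
Hypotheses (XY : X :|: Y = W) (dXY : [disjoint X & Y]).
Hypothesis miss : forall x x' y y', x \in X -> x' \in X -> y \in Y -> y' \in Y ->
  ~~ L x y -> ~~ L x' y' -> x = x' /\ y = y'.
Hypothesis X2 : 1 < #|X|.

Let notXY x : x \in X -> x \in Y -> False.
Proof. by move=> xX xY; move/pred0P: dXY => /(_ x) /=; rewrite xX xY. Qed.

(** Spines xx' and yy' on both sides would put the light edge xy into the two triangles xx'y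
    and xyy'. *)
Let corner x x' y y' : x \in X -> x' \in X -> y \in Y -> y' \in Y ->
  e x x' -> e y y' -> L x y -> L x y' -> L x' y -> False.
Proof.
move=> xX x'X yY y'Y xx' yy' xy xy' x'y.
have [exy exy' ex'y] : [/\ e x y, e x y' & e x' y] by split; apply: light_edge.
have T1 := triangle_mk G xx' ex'y exy; have T2 := triangle_mk G exy yy' exy'.
have E : [set x; x'; y] = [set x; y; y'].
  by apply: (light_uniq xy T1 T2); rewrite !inE eqxx ?orbT.
have : x' \in [set x; y; y'] by rewrite -E !inE eqxx orbT.
rewrite !inE eq_sym (negPf (edge_neq G xx')) /= => /orP[] /eqP E'; subst x'.
  exact: (notXY x'X yY).
exact: (notXY x'X y'Y).
Qed.

(** Spines live in one side only, by [corner] applied at a corner opposite to the missing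
    light edge, if any. Every y in Y has a light edge xy, whose triangle supplies a spine at
    y; two spines yz and yz' would put a light edge xy into two triangles. *)
Lemma bipartite_paired a b : a \in Y -> b \in Y -> e a b ->
  {in X &, forall x x', ~~ e x x'} /\
  {in Y, forall y, exists z, [/\ z \in Y, e y z & forall z', z' \in Y -> e y z' -> z' = z]}.
Proof.
move=> aY bY ab; have nab := edge_neq G ab.
have indep : {in X &, forall x x', ~~ e x x'}.
  move=> c d cX dX; apply/negP => cd; have ncd := edge_neq G cd.
  have dc : e d c by rewrite (gf_sym G).
  have ba : e b a by rewrite (gf_sym G).
  have one x x' y y' : x \in X -> x' \in X -> y \in Y -> y' \in Y ->
      ~~ L x y -> (x != x') || (y != y') -> L x' y'.
    move=> xX x'X yY y'Y xy ne; apply: contraT => x'y'.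
    by have [E E'] := miss xX x'X yY y'Y xy x'y'; rewrite E E' !eqxx in ne.
  have nba : b != a by rewrite eq_sym.
  have ndc : d != c by rewrite eq_sym.
  case ca: (L c a); last first.
    by apply: (corner dX cX bY aY dc ba); apply: (one c _ a); rewrite ?ca ?ncd ?nab ?orbT.
  case cb: (L c b); last first.
    by apply: (corner dX cX aY bY dc ab) => //; apply: (one c _ b); rewrite ?cb ?ncd ?nba ?orbT.
  case da: (L d a); first exact: (corner cX dX aY bY cd ab).
  by apply: (corner cX dX bY aY cd ba) => //; apply: (one d _ a); rewrite ?da ?ndc ?nab ?orbT.
split=> // y yY.
have good y1 y2 y3 : y1 \in Y -> y2 \in Y -> y3 \in Y ->
    exists x, [/\ x \in X, L x y1, L x y2 & L x y3].
  move=> y1Y y2Y y3Y.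
  have /card_gt1P[x [x' [xX x'X xx']]] := X2.
  have one y4 y5 : y4 \in Y -> y5 \in Y -> ~~ L x y4 -> L x' y5.
    move=> y4Y y5Y xy; apply: contraT => x'y'.
    by have [E _] := miss xX x'X y4Y y5Y xy x'y'; rewrite E eqxx in xx'.
  case: (boolP (L x y1)) => [l1|n1]; last first.
    by exists x'; split=> //; apply: (one y1).
  case: (boolP (L x y2)) => [l2|n2]; last first.
    by exists x'; split=> //; apply: (one y2).
  case: (boolP (L x y3)) => [l3|n3]; last first.
    by exists x'; split=> //; apply: (one y3).
  by exists x.
have [x [xX xy _ _]] := good y y y yY yY yY.
have /lightP[T [TT xT yT nxy _]] := xy.
have [z [TE exy yz xz]] := triangle_third G TT xT yT nxy.
have zY : z \in Y.
  have := edge_supp_r G xz; rewrite -XY inE => /orP[zX|//].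
  by move: (indep x z xX zX); rewrite xz.
exists z; split=> // z' z'Y yz'.
have [u [uX uy uz uz']] := good y z z' yY zY z'Y.
have T1 := triangle_mk G (light_edge uy) yz (light_edge uz).
have T2 := triangle_mk G (light_edge uy) yz' (light_edge uz').
have E : [set u; y; z] = [set u; y; z'].
  by apply: (light_uniq uy T1 T2); rewrite !inE eqxx ?orbT.
have : z' \in [set u; y; z] by rewrite E !inE eqxx orbT.
rewrite !inE => /orP[/orP[/eqP E'|/eqP E']|/eqP //].
  by subst z'; case: (notXY uX z'Y).
by subst z'; move: yz'; rewrite (gf_irr G).
Qed.

End Core.

Lemma arcs_light : arcs L W W = 4 * #|paged e|.
Proof.
rewrite -(sum_lnbr G); apply: eq_bigr => v _; apply: eq_card => u; rewrite !inE.
by case vu: (L v u); rewrite ?andbF // (edge_supp_r G (light_edge vu)).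
Qed.

Hypothesis K0 : cliques e 4 = set0.

Let tE : #|tri| = #|paged e|.
Proof. by rewrite (card_tri G) K0 cards0 muln0 addn0. Qed.

Lemma k4free_bound : 8 * #|tri| <= #|W| ^ 2.
Proof.
have := mantel W (@light_sym V e) (light_trifree G).
by rewrite arcs_light tE; lia.
Qed.

(** The light graph is bipartite with |X||Y| <= 2t + 1. The matched side has even size, so
    |X||Y| is even, and no light edge is missing. *)
Lemma k4free_extremal : 5 < #|W| -> #|W| ^ 2 <= 8 * #|tri| + 4 ->
  exists X Y : {set V}, [/\ X :|: Y = W, paired_join e X Y,
    1 < #|X| & #|X| * #|Y| = 2 * #|tri|].
Proof.
move=> W6 Wt.
have Lsupp x y (xy : L x y) := gf_supp G (light_edge xy).
have := mantel_near (W := W) (@light_sym V e) (light_trifree G) (t := #|tri|).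
rewrite arcs_light tE -tE => /(_ erefl Wt)[X [Y [XY dXY XX YY XYle]]].
have cW : #|W| = #|X| + #|Y| by rewrite -XY cardsU disjoint_setI0 // cards0 subn0.
have AXY : arcs L X Y = 2 * #|tri|.
  have := arcs_light; rewrite -tE -XY (arcsUl (@light_sym V e)) // !arcsUr // XX YY.
  by rewrite (arcsC (@light_sym V e) Y X); lia.
have missXY x x' y y' : x \in X -> x' \in X -> y \in Y -> y' \in Y ->
    ~~ L x y -> ~~ L x' y' -> x = x' /\ y = y'.
  move=> xX x'X yY y'Y xy x'y'.
  pose d x := #|[set y in Y | ~~ L x y]|.
  have sd : \sum_(x in X) d x + arcs L X Y = #|X| * #|Y|.
    rewrite -sum_nat_const /arcs -big_split /=; apply: eq_bigr => z _.
    rewrite -(cardsID [set w | ~~ L z w] Y); congr (_ + _); apply: eq_card => w;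
      rewrite !inE //= ?negbK //; by rewrite andbC.
  (* d x counts the missing light edges at x. *)
  have d1 : \sum_(x in X) d x <= 1 by lia.
  have dx : 0 < d x by apply/card_gt0P; exists y; rewrite inE yY.
  have dx' : 0 < d x' by apply/card_gt0P; exists y'; rewrite inE y'Y.
  have E : x = x'.
    apply/eqP/negPn/negP => ne; move: d1; rewrite (bigD1 x) //= (bigD1 x') /=; first by lia.
    by rewrite x'X eq_sym.
  subst x'; split=> //; apply/eqP/negPn/negP => ne.
  have : [set y; y'] \subset [set y in Y | ~~ L x y].
    by apply/subsetP => w; rewrite !inE => /orP[] /eqP->; rewrite ?yY ?y'Y.
  move=> /subset_leq_card; rewrite cards2 ne /= -/(d x).
  by move: d1; rewrite (bigD1 x) //=; lia.
have arcs_le A B : arcs L A B <= #|A| * #|B|.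
  rewrite -sum_nat_const; apply: leq_sum => x _; apply: subset_leq_card.
  by apply/subsetP => w; rewrite inE => /andP[].
have tXY := arcs_le X Y; rewrite AXY in tXY.
have [X2 Y2] : 1 < #|X| /\ 1 < #|Y|.
  move: Wt W6 tXY; rewrite cW -mulnn.
  move: #|X| #|Y| #|tri| => x y t; clear; nia.
have fin A B : A :|: B = W -> [disjoint A & B] -> #|A| * #|B| = #|X| * #|Y| ->
   1 < #|A| -> 
   (forall x x' y y', x \in A -> x' \in A -> y \in B -> y' \in B ->
    ~~ L x y -> ~~ L x' y' -> x = x' /\ y = y') ->
   arcs L A B = 2 * #|tri| ->
   (exists a b, [/\ a \in B, b \in B & e a b]) ->
   exists X Y : {set V}, [/\ X :|: Y = W, paired_join e X Y,
    1 < #|X| & #|X| * #|Y| = 2 * #|tri|].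
  move=> AB dAB cAB A2 mAB aAB [a [b [aB bB ab]]].
  have [ind mat] := bipartite_paired AB dAB mAB A2 aB bB ab.
  have cB := card_matched mat.
  have full : #|A| * #|B| = 2 * #|tri|.
    have := arcs_le A B; have : #|A| * #|B| <= 2 * #|tri| + 1 by rewrite cAB.
    by rewrite aAB cB mulnCA; lia.
  exists A, B; split=> //; split=> // x y xA yB.
  apply: light_edge; apply: contraT => xy.
  have : arcs L A B < #|A| * #|B|.
    rewrite -sum_nat_const /arcs (bigD1 x) //= [X in _ < X](bigD1 x) //= -addSn.
    apply: leq_add.
      apply: proper_card; apply/properP; split.
        by apply/subsetP => w; rewrite inE => /andP[].
      by exists y; rewrite // inE (negPf xy) andbF.
    apply: leq_sum => z _; apply: subset_leq_card.
    by apply/subsetP => w; rewrite inE => /andP[].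
  by rewrite aAB full ltnn.
have [p [a [p' [a' [L1 L2 aE]]]]] : exists p a p' a', [/\ L p a, L p' a', p = p' & e a a'].
  have : 0 < #|paged e| by rewrite -tE; nia.
  case/card_gt0P => T; rewrite pagedE => /andP[TT]; case pg: (page e T) => [p|//] _.
  have /pageP/is_pageP[pT _] := pg.
  have [a [b [TE pa ab pb]]] := triangle_vertex G TT pT.
  exists p, a, p, b; split=> //; apply: (page_light TT pg);
    by rewrite ?TE ?inE ?eqxx ?orbT // eq_sym (edge_neq G).
move=> aa'; subst p'.
have pW : p \in X :|: Y by rewrite XY (Lsupp _ _ L1).
have aW : a \in X :|: Y by rewrite XY (Lsupp a p) // light_sym.
have a'W : a' \in X :|: Y by rewrite XY (Lsupp a' p) // light_sym.
case/setUP: pW => [pX|pY].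
  apply: (fin X Y) => //; exists a, a'; split=> //.
    by case/setUP: aW => // aX; move: (arcs_eq0 XX pX aX); rewrite L1.
  by case/setUP: a'W => // aX; move: (arcs_eq0 XX pX aX); rewrite L2.
apply: (fin Y X); rewrite 1?setUC 1?disjoint_sym 1?mulnC //.
- move=> x x' y y' xY x'Y yX y'X xy x'y'.
  by have [-> ->] : y = y' /\ x = x' by apply: missXY; rewrite // light_sym.
- by rewrite (arcsC (@light_sym V e)) AXY mulnC.
exists a, a'; split=> //.
  by case/setUP: aW => // aY; move: (arcs_eq0 YY pY aY); rewrite L1.
by case/setUP: a'W => // aY; move: (arcs_eq0 YY pY aY); rewrite L2.
Qed.

End Bipartite.

(** * Deleting vertices of a K4 *)

Lemma leq_card_rel (I J : finType) (A : {set I}) (B : {set J}) (R : I -> J -> bool) :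
  (forall x, x \in A -> exists2 y, y \in B & R x y) ->
  (forall x x' y, x \in A -> x' \in A -> y \in B -> R x y -> R x' y -> x = x') ->
  #|A| <= #|B|.
Proof.
move=> ex inj; apply: (@leq_trans (\sum_(x in A) #|[set y in B | R x y]|)).
  rewrite -sum1_card; apply: leq_sum => x xA; have [y yB Rxy] := ex x xA.
  by apply/card_gt0P; exists y; rewrite inE yB.
rewrite double_count -sum1_card; apply: leq_sum => y yB.
apply/card_le1P => x; rewrite inE => /andP[xA Rxy] x'; rewrite !inE.
by apply/andP/eqP => [[x'A Rx'y]|-> //]; apply: inj Rx'y Rxy.
Qed.

Section Deletion.
Variables (V : finType) (e : rel V) (W : {set V}).
Hypothesis G : gemfree_on e W.
Local Notation tri := (cliques e 3).
Local Notation tet := (cliques e 4).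

Definition hanging (Q : {set V}) (v : V) : {set {set V}} :=
  [set T in tri | T :&: Q == [set v]].

Lemma hangingP Q v (T : {set V}) : T \in hanging Q v ->
  [/\ T \in tri, v \in T, v \in Q & forall u, u \in T -> u \in Q -> u = v].
Proof.
rewrite inE => /andP[TT /eqP E].
have /setIP[vT vQ] : v \in T :&: Q by rewrite E set11.
by split=> // u uT uQ; apply/set1P; rewrite -E inE uT.
Qed.

Lemma hanging_mk (Q : {set V}) v (T : {set V}) : T \in tri -> v \in T -> v \in Q ->
  (forall u, u \in T -> u \in Q -> u = v) -> T \in hanging Q v.
Proof.
move=> TT vT vQ h; rewrite in_set TT; apply/eqP/setP => u; rewrite !inE.
apply/andP/eqP => [[uT uQ]|-> //]; exact: h.
Qed.

Lemma hanging_outer Q v T u : T \in hanging Q v -> u \in T -> u != v -> u \in outer e Q v.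
Proof.
case/hangingP => TT vT vQ h uT uv; rewrite !inE; apply/andP; split.
  by apply: contra uv => uQ; rewrite (h u).
by apply: clique_edge TT _ _ _; rewrite // eq_sym.
Qed.

Lemma hanging_bin Q v : #|hanging Q v| <= 'C(#|outer e Q v|, 2).
Proof.
have inj : {in hanging Q v &, injective (fun T : {set V} => T :\ v)}.
  move=> T T' Th T'h E; have [_ vT _ _] := hangingP Th; have [_ vT' _ _] := hangingP T'h.
  by rewrite -(setD1K vT) E setD1K.
rewrite -(card_in_imset inj) -cards_draws.
apply: subset_leq_card; apply/subsetP => _ /imsetP[T Th ->]; rewrite inE.
have [TT vT vQ h] := hangingP Th; apply/andP; split.
  by apply/subsetP => u /setD1P[uv uT]; apply: hanging_outer Th uT uv.
by have := cardsD1 v T; rewrite vT (cliques_card TT) => ?; apply/eqP; lia.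
Qed.
(* An injection from the hanging triangles at v to the outer neighbours of v: a triangle
   outside the K4s goes to a light neighbour of v in it, a triangle of another K4 to the
   fourth vertex of that K4. *)
Let rep v (T : {set V}) (u : V) : bool :=
  if page e T then [&& u \in T, u != v & light e v u]
  else (u \notin T) && ((u |: T) \in tet).

Let rep_ex Q v T : Q \in tet -> T \in hanging Q v -> exists2 u, u \in outer e Q v & rep v T u.
Proof.
move=> QK Th; have [TT vT vQ h] := hangingP Th; rewrite /rep.
case pg: (page e T) => [p|] /=.
  have /pageP/is_pageP[pT _] := pg.
  have [pv|pv] := eqVneq p v.
    have [x [y [TE vx xy vy]]] := triangle_vertex G TT vT.
    have xT : x \in T by rewrite TE !inE eqxx orbT.
    have xv : x != v by rewrite eq_sym (edge_neq G).
    exists x; first exact: hanging_outer Th xT xv.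
    by rewrite xT xv; apply: (page_light TT) => //; rewrite -pv.
  exists p; first exact: hanging_outer Th pT pv.
  by rewrite pT pv light_sym; apply: (page_light TT pg); rewrite // eq_sym.
have [|[Q' QK' TQ']] := tri_page_or_tet G TT; first by rewrite pg.
have : 0 < #|Q' :\: T| by rewrite cardsD (setIidPr TQ') (cliques_card TT) (cliques_card QK').
case/card_gt0P => z /setDP[zQ' zT].
have E : z |: T = Q'.
  apply/eqP; rewrite eqEcard cardsU1 zT (cliques_card TT) (cliques_card QK') andbT.
  by apply/subsetP => u; rewrite !inE => /orP[/eqP->|/(subsetP TQ')].
have zv : z != v by apply: contraNneq zT => ->.
exists z; last by rewrite zT E.
rewrite !inE; apply/andP; split; last first.
  by apply: clique_edge QK' (subsetP TQ' _ vT) zQ' _; rewrite eq_sym.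
apply/negP => zQ; have QQ' := tet_eq G QK QK' zv zQ vQ zQ' (subsetP TQ' _ vT).
have [x [y [TE vx xy vy]]] := triangle_vertex G TT vT.
have xT : x \in T by rewrite TE !inE eqxx orbT.
have xv : x = v by apply: (h x xT); rewrite QQ' (subsetP TQ' _ xT).
by move: vx; rewrite xv (gf_irr G).
Qed.

Let rep_inj Q v T T' u : T \in hanging Q v -> T' \in hanging Q v ->
  rep v T u -> rep v T' u -> T = T'.
Proof.
case/hangingP => TT vT _ _ /hangingP[TT' vT' _ _]; rewrite /rep.
case: (page e T) => [p|] /=; case: (page e T') => [p'|] /=.
- by case/and3P => uT uv vu /and3P[uT' _ _]; apply: (light_uniq vu TT TT').
- case/and3P => uT uv vu /andP[uT' QK].
  by case: (light_no_tet G vu QK); rewrite !inE ?vT' ?eqxx ?orbT.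
- case/andP => uT' QK /and3P[uT uv vu].
  by case: (light_no_tet G vu QK); rewrite !inE ?vT ?eqxx ?orbT.
case/andP => uT QK /andP[uT' QK'].
have uv : u != v by apply: contraNneq uT => ->.
have E : u |: T = u |: T' by apply: (tet_eq G QK QK' uv); rewrite !inE ?vT ?vT' ?eqxx ?orbT.
by rewrite -(setU1K uT) E setU1K.
Qed.

Lemma hanging_outer_le Q v : Q \in tet -> #|hanging Q v| <= #|outer e Q v|.
Proof.
move=> QK; apply: (@leq_card_rel _ _ _ _ (rep v)).
  by move=> T; apply: (rep_ex QK).
by move=> T T' u Th T'h _; apply: (rep_inj Th T'h).
Qed.

(** If v is in no other K4, then all triangles at v are sent to light neighbours of v. A
    triangle whose page is v offers two of them, and otherwise the spine at v ends in a
    vertex that is never used; so the injection can avoid one outer neighbour. *)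
Lemma hanging_full Q v : Q \in tet -> 0 < #|hanging Q v| ->
  #|outer e Q v| <= #|hanging Q v| -> exists Q', [/\ Q' \in tet, v \in Q' & Q' != Q].
Proof.
move=> QK /card_gt0P[T Th] full.
case: (boolP [exists Q' in tet, (v \in Q') && (Q' != Q)]) => [/exists_inP[Q' QK' /andP[]]|/exists_inPn noQ].
  by exists Q'.
have pg T' : T' \in hanging Q v -> page e T'.
  move=> /hangingP[TT' vT' vQ h]; have [//|[Q' QK' TQ']] := tri_page_or_tet G TT'.
  have := noQ Q' QK'; rewrite (subsetP TQ') //= negbK => /eqP E; subst Q'.
  have [x [y [TE vx _ _]]] := triangle_vertex G TT' vT'.
  have xT : x \in T' by rewrite TE !inE eqxx orbT.
  by move: vx; rewrite (h x xT (subsetP TQ' x xT)) (gf_irr G).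
have [TT vT vQ h] := hangingP Th.
(* It remains to find an outer neighbour that the injection can avoid. *)
suff [w wB hw] : exists2 w, w \in outer e Q v & forall T', T' \in hanging Q v ->
    exists2 u, u \in outer e Q v :\ w & rep v T' u.
  have := leq_card_rel hw (fun T T' u Th T'h _ => rep_inj Th T'h).
  by have := cardsD1 w (outer e Q v); rewrite wB; lia.
have [p pgT] : exists p, page e T = Some p.
  by have := pg T Th; case: (page e T) => [p|//]; exists p.
have /pageP/is_pageP[pT _] := pgT.
have [pv|pv] := eqVneq p v.
  subst p; have [x [y [TE vx xy vy]]] := triangle_vertex G TT vT.
  have [xT yT] : x \in T /\ y \in T by rewrite TE !inE !eqxx !orbT.
  have [xv yv] : x != v /\ y != v by rewrite ![_ == v]eq_sym !(edge_neq G).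
  exists x; first exact: hanging_outer Th xT xv.
  move=> T' T'h; have [u uB ru] := rep_ex QK T'h.
  have [ux|ux] := eqVneq u x; last by exists u; rewrite // in_setD1 ux.
  exists y; first by rewrite in_setD1 eq_sym (edge_neq G xy) (hanging_outer Th yT yv).
  have ry z : z \in T -> z != v -> rep v T z.
    by move=> zT zv; rewrite /rep pgT zT zv (page_light TT pgT).
  have -> : T' = T by apply: (rep_inj T'h Th ru); rewrite ux ry.
  exact: ry.
have [w [TE vp pw vw]] := triangle_third G TT vT pT (contra_neq esym pv).
have wT : w \in T by rewrite TE !inE eqxx !orbT.
have wv : w != v by rewrite eq_sym (edge_neq G).
exists w; first exact: hanging_outer Th wT wv.
move=> T' T'h; have [u uB ru] := rep_ex QK T'h; exists u => //.
rewrite in_setD1 uB andbT; apply/eqP => uw; subst u.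
have := pg T' T'h; move: ru; rewrite /rep; case: (page e T') => // _ /and3P[_ _ lvw] _.
case: (light_page lvw TT vT wT); rewrite pgT => -[E].
  by rewrite E eqxx in pv.
by move: pw; rewrite E (gf_irr G).
Qed.

Lemma tri_split (Q Z U : {set V}) : Q \in tet -> Z \subset Q ->
  #|[set T in tri | T \subset U]| <=
  #|[set T in tri | (T \subset Q :&: U) && ~~ [disjoint T & Z]]|
   + \sum_(v in Z) #|hanging Q v| + #|[set T in tri | T \subset U :\: Z]|.
Proof.
move=> QK ZQ; set A := [set T in tri | _]; set B := [set T in tri | _ && _]; set C := [set T in _ | _].
pose H := [set T in tri | [exists v in Z, T \in hanging Q v]].
have sub : A \subset B :|: H :|: C.
  apply/subsetP => T /setIdP[TT TU]; apply/setUP.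
  case dTZ: [disjoint T & Z].
    by right; apply/setIdP; rewrite subsetD TU dTZ.
  have /set0Pn[v /setIP[vT vZ]] : T :&: Z != set0 by rewrite setI_eq0 dTZ.
  have vQ := subsetP ZQ v vZ; left; apply/setUP.
  case: (boolP [exists u in T, (u \in Q) && (u != v)]) => [/exists_inP[u uT /andP[uQ uv]]|/exists_inPn no].
    by left; apply/setIdP; rewrite subsetI TU dTZ (tet_triangle G QK TT uv uQ vQ uT vT).
  right; apply/setIdP; split=> //; apply/exists_inP; exists v => //.
  apply: hanging_mk => // u uT uQ.
  by have := no u uT; rewrite uQ negbK => /eqP.
apply: leq_trans (subset_leq_card sub) _.
apply: leq_trans (leq_card_setU _ _) _; rewrite leq_add2r.
apply: leq_trans (leq_card_setU _ _) _; rewrite leq_add2l.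
rewrite (card_by_fibres (B := Z) (R := fun (T : {set V}) v => T \in hanging Q v)).
- apply: leq_sum => v _; apply: subset_leq_card; apply/subsetP => T.
  by case/setIdP.
- by move=> T /setIdP[_ /exists_inP].
move=> T v w _ _ _ /hangingP[_ vT vQ _] /hangingP[_ _ _ h]; exact: h.
Qed.

Definition del (Z : {set V}) : rel V := induced e (W :\: Z).

Lemma gemfree_del Z : gemfree_on (del Z) (W :\: Z).
Proof.
have := gemfree_induced G (W :\: Z); by rewrite (setIidPr (subsetDl _ _)).
Qed.

Lemma cliques_del k Z : 1 < k -> cliques (del Z) k = [set S in cliques e k | S \subset W :\: Z].
Proof. exact: cliques_induced. Qed.

Lemma tri_W : tri = [set T in tri | T \subset W].
Proof.
apply/setP => T; apply/idP/setIdP => [TT|[]//].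
by rewrite (clique_sub G _ TT).
Qed.

Lemma tri_del (Q Z : {set V}) : Q \in tet -> Z \subset Q ->
  #|tri| <= 4 + \sum_(v in Z) #|hanging Q v| + #|cliques (del Z) 3|.
Proof.
move=> QK ZQ; rewrite {1}tri_W; apply: leq_trans (tri_split W QK ZQ) _.
rewrite cliques_del // !leq_add2r.
rewrite -[4]/'C(4, 3) -(cliques_card QK) -cards_draws; apply: subset_leq_card.
apply/subsetP => T /setIdP[TT /andP[+ _]]; rewrite subsetI => /andP[TQ _].
by rewrite inE TQ (cliques_card TT).
Qed.

Lemma tri_del1 (Q : {set V}) v : Q \in tet -> v \in Q ->
  #|tri| <= 3 + #|hanging Q v| + #|cliques (del [set v]) 3|.
Proof.
move=> QK vQ; have vsQ : [set v] \subset Q by rewrite sub1set.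
rewrite {1}tri_W; apply: leq_trans (tri_split W QK vsQ) _.
rewrite cliques_del // big_set1 !leq_add2r.
have c4 : #|[set T : {set V} | (T \subset Q) && (#|T| == 3)]| = 4.
  by rewrite cards_draws (cliques_card QK).
have Qv : Q :\ v \in [set T : {set V} | (T \subset Q) && (#|T| == 3)].
  rewrite inE subD1set; apply/eqP.
  by have := cardsD1 v Q; rewrite vQ (cliques_card QK); lia.
have := cardsD1 (Q :\ v) [set T : {set V} | (T \subset Q) && (#|T| == 3)].
rewrite c4 Qv => c3; apply: (@leq_trans #|[set T : {set V} | (T \subset Q) && (#|T| == 3)] :\ (Q :\ v)|); last by lia.
apply: subset_leq_card.
apply/subsetP => T /setIdP[TT /andP[+ TZ]]; rewrite subsetI => /andP[TQ _].
rewrite !inE TQ (cliques_card TT) !andbT; apply: contraNneq TZ => ->.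
by rewrite disjoint_sym disjoints1 !inE eqxx.
Qed.

Lemma tri_bin : #|tri| <= 'C(#|W|, 3).
Proof.
rewrite -cards_draws; apply: subset_leq_card; apply/subsetP => T TT.
by rewrite inE (cliques_card TT) (clique_sub G _ TT).
Qed.

Lemma tet_elems (Q : {set V}) : Q \in tet -> exists a b c d,
  [/\ uniq [:: a; b; c; d], [/\ a \in Q, b \in Q, c \in Q & d \in Q] &
      forall f : V -> nat, \sum_(v in Q) f v = f a + f b + f c + f d].
Proof.
move=> QK; have := cliques_card QK; rewrite cardE; have := enum_uniq (mem Q).
have := fun x => mem_enum (mem Q) x.
have := fun f : V -> nat => @big_enum _ addn 0 _ Q f.
case: (enum Q) => [|a [|b [|c [|d [|]]]]] //= S M U _.
exists a, b, c, d; split=> //; first by split; rewrite -M !inE eqxx ?orbT.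
by move=> f; rewrite -S !big_cons big_nil addn0 !addnA.
Qed.

End Deletion.

(** * Graphs on at most eleven vertices *)

Section Small.
Variable V : finType.
Implicit Types (e : rel V) (W Q Z : {set V}).

Definition bare_edge e (u v : V) : Prop :=
  e u v /\ forall T, T \in cliques e 3 -> u \in T -> v \in T -> False.

(** Two outer neighbours carry at most one hanging triangle. The second bound packs this
    and h <= o into an inequality that remains linear when summed over a K4. *)
Lemma hanging_profile e W Q v : gemfree_on e W -> Q \in cliques e 4 ->
  let h := #|hanging e Q v| in let o := #|outer e Q v| in
  h <= o /\ (h = 0 \/ h + 3 <= 2 * o).
Proof.
move=> G QK; have := hanging_bin e Q v; have := hanging_outer_le G v QK.
move: #|hanging e Q v| #|outer e Q v| => h [|[|[|o]]] ho.
- by rewrite bin_small // => hb; split; lia.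
- by rewrite bin_small // => hb; split; lia.
- by rewrite binn => hb; split; lia.
by move=> _; split; lia.
Qed.

Lemma busy_profile e W Q v : gemfree_on e W -> Q \in cliques e 4 ->
  0 < #|hanging e Q v| -> #|hanging e Q v| + 3 <= 2 * #|outer e Q v|.
Proof. by move=> G QK h; have [_ [h0|//]] := hanging_profile v G QK; rewrite h0 in h. Qed.

Lemma card_del W Z : Z \subset W -> #|W :\: Z| = #|W| - #|Z|.
Proof. by move=> ZW; rewrite cardsD (setIidPr ZW). Qed.

(** Call a vertex of the K4 idle when no triangle hangs at it, and busy otherwise. Two idle
    vertices are deleted at the price of four triangles. The other two have no common neighbour
    outside the K4, so the edge between them is left in no triangle. *)
Lemma two_idle e W Q p p' : gemfree_on e W -> Q \in cliques e 4 ->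
  p \in Q -> p' \in Q -> p != p' -> hanging e Q p = set0 -> hanging e Q p' = set0 ->
  exists f U, [/\ gemfree_on f U, #|U| = #|W| - 2,
    #|cliques e 3| <= 4 + #|cliques f 3| & exists u v, bare_edge f u v].
Proof.
move=> G QK pQ p'Q pp' hp hp'.
have ZQ : [set p; p'] \subset Q by apply/subsetP => x; rewrite !inE => /orP[] /eqP->.
have QW := clique_sub G (isT : 1 < 4) QK.
exists (del e W [set p; p']), (W :\: [set p; p']); split.
- exact: gemfree_del.
- by rewrite card_del ?cards2 ?pp' // (subset_trans ZQ).
- have := tri_del G QK ZQ; rewrite big_setU1 ?inE //= big_set1 hp hp' cards0; lia.
have : 1 < #|Q :\: [set p; p']| by rewrite cardsD (setIidPr ZQ) cards2 pp' (cliques_card QK).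
case/card_gt1P => u [v [/setDP[uQ uZ] /setDP[vQ vZ] uv]].
exists u, v; split.
  by rewrite /del /induced (clique_edge QK uQ vQ uv) !in_setD uZ vZ !(subsetP QW).
move=> T; rewrite cliques_del // => /setIdP[TT TW] uT vT.
have TQ := tet_triangle G QK TT uv uQ vQ uT vT.
have : T \subset Q :\: [set p; p'].
  by rewrite subsetD TQ; move: TW; rewrite subsetD => /andP[].
move=> /subset_leq_card; rewrite cardsD (setIidPr ZQ) cards2 pp'.
by rewrite (cliques_card QK) (cliques_card TT).
Qed.

Lemma busy_one (ha hb hc hd oa ob oc od : nat) :
  ha = 0 \/ ha + 3 <= 2 * oa -> hb = 0 \/ hb + 3 <= 2 * ob ->
  hc = 0 \/ hc + 3 <= 2 * oc -> hd = 0 \/ hd + 3 <= 2 * od ->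
  oa + ob + oc + od <= 3 ->
  [\/ ha + hb + hc + hd = ha, ha + hb + hc + hd = hb, ha + hb + hc + hd = hc |
     ha + hb + hc + hd = hd].
Proof.
case=> [->|a2]; last first.
  by case=> [->|b2]; case=> [->|c2]; case=> [->|d2]; move=> le; try (exfalso; lia); apply: Or41; rewrite ?addn0.
case=> [->|b2]; last first.
  by case=> [->|c2]; case=> [->|d2]; move=> le; try (exfalso; lia); apply: Or42; rewrite ?add0n ?addn0.
case=> [->|c2]; last by case=> [->|d2]; move=> le; try (exfalso; lia); apply: Or43; rewrite ?add0n ?addn0.
by move=> _ _; apply: Or44.
Qed.

(** Numbers of hanging triangles at three vertices of which at most one is idle, when only four
    outer vertices are available. *)
Lemma busy_two_of_three (h1 h2 h3 o1 o2 o3 : nat) :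
  h1 = 0 \/ h1 + 3 <= 2 * o1 -> h2 = 0 \/ h2 + 3 <= 2 * o2 -> h3 = 0 \/ h3 + 3 <= 2 * o3 ->
  0 < h1 + h2 -> 0 < h1 + h3 -> 0 < h2 + h3 -> o1 + o2 + o3 <= 4 -> h1 + h2 + h3 <= 2.
Proof.
by case=> [->|?]; case=> [->|?]; case=> [->|?] ? ? ? ?; lia.
Qed.

(** With seven outer vertices, five hanging triangles are only possible if one vertex attains
    h = o = 3. *)
Lemma full_vertex (ha hb hc hd oa ob oc od : nat) :
  ha <= oa -> hb <= ob -> hc <= oc -> hd <= od ->
  hb + 3 <= 2 * ob -> hc + 3 <= 2 * oc -> hd + 3 <= 2 * od ->
  oa + ob + oc + od + 4 <= 11 -> 4 < ha + hb + hc + hd ->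
  ha + hb + hc + hd = 5 /\
  [\/ hb = 3 /\ ob = 3, hc = 3 /\ oc = 3 | hd = 3 /\ od = 3].
Proof.
move=> a b c d b' c' d' o h; split; first by lia.
have [b2|b3] := leqP ob 2; last by apply: Or31; lia.
have [c2|c3] := leqP oc 2; last by apply: Or32; lia.
by apply: Or33; lia.
Qed.

(** With at most three vertices outside the K4, only one vertex has two outer neighbours. *)
Lemma three_idle e W Q : gemfree_on e W -> Q \in cliques e 4 -> #|W| <= 7 ->
  exists2 c, c \in Q & #|cliques e 3| <= 4 + #|cliques (del e W (Q :\ c)) 3|.
Proof.
move=> G QK W7; have [a [b [c [d [U [aQ bQ cQ dQ] S]]]]] := tet_elems QK.
have So := sum_outer G QK; rewrite S in So.
have P v := hanging_profile v G QK.
have [_ Pa] := P a; have [_ Pb] := P b; have [_ Pc] := P c; have [_ Pd] := P d.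
have key x : x \in Q -> #|hanging e Q a| + #|hanging e Q b| + #|hanging e Q c| + #|hanging e Q d| = #|hanging e Q x| ->
   exists2 c, c \in Q & #|cliques e 3| <= 4 + #|cliques (del e W (Q :\ c)) 3|.
  move=> xQ E; exists x => //; apply: leq_trans (tri_del G QK (subD1set Q x)) _.
  have := S (fun v => #|hanging e Q v|); rewrite (big_setD1 x) //= E => /eqP.
  by rewrite -[X in _ == X]addn0 eqn_add2l => /eqP->; rewrite addn0.
have So3 : #|outer e Q a| + #|outer e Q b| + #|outer e Q c| + #|outer e Q d| <= 3.
  by move: So W7; clear; lia.
have := busy_one Pa Pb Pc Pd So3.
by case=> E; [apply: (key a)|apply: (key b)|apply: (key c)|apply: (key d)].
Qed.

Lemma card_del3 e W Q c : gemfree_on e W -> Q \in cliques e 4 -> c \in Q ->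
  #|W :\: (Q :\ c)| = #|W| - 3.
Proof.
move=> G QK cQ; have QW := clique_sub G (isT : 1 < 4) QK.
rewrite card_del ?(subset_trans (subD1set _ _)) //.
by have := cardsD1 c Q; rewrite cQ (cliques_card QK); lia.
Qed.

Lemma outside_edge e W Q c u v : gemfree_on e W -> Q \in cliques e 4 -> c \in Q ->
  e u c -> e u v -> u \notin Q -> v \in Q -> v = c.
Proof.
move=> G QK cQ uc uv uQ vQ; apply: contraNeq uQ => vc.
exact: (tet_closed G QK vQ cQ vc).
Qed.

Lemma triangles6 e W : gemfree_on e W -> #|W| = 6 -> #|cliques e 3| <= 5.
Proof.
move=> G W6; have [K0|[Q QK]] := set_0Vmem (cliques e 4).
  by have := k4free_bound G K0; rewrite W6; lia.
have [|c cQ le] := three_idle G QK; first by rewrite W6.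
have := tri_bin (gemfree_del G (Q :\ c)); rewrite (card_del3 G) // W6 binn; lia.
Qed.

(** With more than four triangles, the three vertices outside Q minus c form a triangle. It
    contains c, so an edge from it to another vertex of Q would give a vertex outside Q two
    neighbours in Q. Hence every edge lies in Q or in this triangle. *)
Lemma triangles6_bare e W u v : gemfree_on e W -> #|W| = 6 -> bare_edge e u v ->
  #|cliques e 3| <= 4.
Proof.
move=> G W6 [uv bare]; have [K0|[Q QK]] := set_0Vmem (cliques e 4).
  by have := k4free_bound G K0; rewrite W6; lia.
have [|c cQ le] := three_idle G QK; first by rewrite W6.
suff : #|cliques (del e W (Q :\ c)) 3| = 0 by lia.
apply/eqP; rewrite cards_eq0; apply/eqP/setP => T; rewrite [RHS]inE; apply/negP.
rewrite cliques_del // => /setIdP[TT TW].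
have TE : T = W :\: (Q :\ c).
  by apply/eqP; rewrite eqEcard TW (card_del3 G) // W6 (cliques_card TT).
have QW := clique_sub G (isT : 1 < 4) QK.
have cT : c \in T by rewrite TE !inE eqxx (subsetP QW).
have notQ x : x \in T -> x != c -> x \notin Q.
  by move=> xT xc; move: xT; rewrite TE !inE xc => /andP[].
have key x y : e x y -> x \in T -> y \notin T -> x \in Q.
  move=> xy xT yT; have yQ : y \in Q.
    by move: yT; rewrite TE !inE (edge_supp_r G xy) andbT negbK => /andP[].
  apply: contraT => xQ.
  have xc : x != c by apply: contraNneq xQ => ->.
  have yc := outside_edge G QK cQ (clique_edge TT xT cT xc) xy xQ yQ.
  by rewrite yc cT in yT.
have inQ x : x \notin T -> x \in W -> x \in Q.
  by rewrite TE !inE => + xW; rewrite xW andbT negbK => /andP[].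
have uvQ : u \in Q -> v \in Q -> False.
  move=> uQ vQ; have [w wQ /andP[wu wv]] := other_vertex uQ vQ (edge_neq G uv) (cliques_card QK).
  have TT' : [set u; v; w] \in cliques e 3.
    by apply: (triangle_mk G uv); apply: clique_edge QK _ _ _; rewrite // eq_sym.
  by apply: (bare _ TT'); rewrite !inE eqxx ?orbT.
have vu : e v u by rewrite (gf_sym G).
have uW := gf_supp G uv; have vW := gf_supp G vu.
case: (boolP (u \in T)) => uT; case: (boolP (v \in T)) => vT.
- exact: bare TT uT vT.
- by apply: uvQ; [apply: (key u v)|apply: inQ].
- by apply: uvQ; [apply: inQ|apply: (key v u)].
- by apply: uvQ; apply: inQ.
Qed.

(** More than six triangles force two K4s with a common vertex c that cover W, and an edge
    between the two would give a vertex outside one of them two neighbours in it. *)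
Lemma triangles7 e W : gemfree_on e W -> #|W| = 7 -> #|cliques e 3| <= 6 \/
  #|cliques e 3| <= 8 /\
  forall u v, e u v -> exists Q, [/\ Q \in cliques e 4, u \in Q & v \in Q].
Proof.
move=> G W7; have [K0|[Q QK]] := set_0Vmem (cliques e 4).
  by left; have := k4free_bound G K0; rewrite W7; lia.
have [|c cQ le] := three_idle G QK; first by rewrite W7.
set R := W :\: (Q :\ c) in le *.
have cR : #|R| = 4 by rewrite (card_del3 G) // W7.
have GR := gemfree_del G (Q :\ c).
have [K0|[Q' Q'K]] := set_0Vmem (cliques (del e W (Q :\ c)) 4).
  by left; have := k4free_bound GR K0; rewrite -/R cR; lia.
have := tri_bin GR; rewrite -/R cR => le4; right; split.
  by apply: leq_trans le _; rewrite -[8]/(4 + 'C(4, 3)) leq_add2l.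
move: Q'K; rewrite cliques_del // => /setIdP[Q'K Q'R].
have Q'E : Q' = R by apply/eqP; rewrite eqEcard Q'R cR (cliques_card Q'K).
have QW := clique_sub G (isT : 1 < 4) QK.
have cQ' : c \in Q' by rewrite Q'E !inE eqxx (subsetP QW).
move=> u v uv; have vu : e v u by rewrite (gf_sym G).
have uW := gf_supp G uv; have vW := gf_supp G vu.
have inQ x : x \notin Q' -> x \in W -> x \in Q.
  by rewrite Q'E !inE => + xW; rewrite xW andbT negbK => /andP[].
have key x y : e x y -> x \in Q' -> y \notin Q' -> y \in W -> x \in Q.
  move=> xy xT yT yW; have yQ := inQ y yT yW.
  apply: contraT => xQ.
  have xc : x != c by apply: contraNneq xQ => ->.
  have yc := outside_edge G QK cQ (clique_edge Q'K xT cQ' xc) xy xQ yQ.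
  by rewrite yc cQ' in yT.
case: (boolP (u \in Q')) => uT; case: (boolP (v \in Q')) => vT.
- by exists Q'.
- by exists Q; split; [|apply: (key u v)|apply: inQ].
- by exists Q; split; [|apply: inQ|apply: (key v u)].
- by exists Q; split=> //; apply: inQ.
Qed.

Lemma triangles7_bare e W u v : gemfree_on e W -> #|W| = 7 -> bare_edge e u v ->
  #|cliques e 3| <= 6.
Proof.
move=> G W7 [uv bare]; have [//|[_ /(_ u v uv)[Q [QK uQ vQ]]]] := triangles7 G W7.
have [w wQ /andP[wu wv]] := other_vertex uQ vQ (edge_neq G uv) (cliques_card QK).
have TT' : [set u; v; w] \in cliques e 3.
  by apply: (triangle_mk G uv); apply: clique_edge QK _ _ _; rewrite // eq_sym.
by case: (bare _ TT'); rewrite !inE eqxx ?orbT.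
Qed.

(** Either two vertices are idle and are deleted, or any two contain a busy one. *)
Lemma idle_split e W Q : gemfree_on e W -> Q \in cliques e 4 ->
  (exists f U, [/\ gemfree_on f U, #|U| = #|W| - 2,
    #|cliques e 3| <= 4 + #|cliques f 3| & exists u v, bare_edge f u v]) \/
  (forall p p', p \in Q -> p' \in Q -> p != p' -> 0 < #|hanging e Q p| + #|hanging e Q p'|).
Proof.
move=> G QK.
case: (boolP [exists p in Q, exists p' in Q, [&& p != p', #|hanging e Q p| == 0 & #|hanging e Q p'| == 0]]).
  case/exists_inP => p pQ /exists_inP[p' p'Q /and3P[pp' h h']]; left.
  by apply: (two_idle G QK pQ p'Q pp'); apply/eqP; rewrite -cards_eq0.
move=> no; right => p p' pQ p'Q pp'; rewrite lt0n addn_eq0; apply: contra no => /andP[h h'].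
by apply/exists_inP; exists p => //; apply/exists_inP; exists p'; rewrite // pp' h.
Qed.

Lemma busy_numbers e W Q : gemfree_on e W -> Q \in cliques e 4 ->
  (forall p p', p \in Q -> p' \in Q -> p != p' -> 0 < #|hanging e Q p| + #|hanging e Q p'|) ->
  exists a b c d, let h v := #|hanging e Q v| in
  [/\ [/\ a \in Q, b \in Q, c \in Q & d \in Q],
      forall f : V -> nat, \sum_(v in Q) f v = f a + f b + f c + f d,
      [/\ a != b, a != c, a != d, b != c & b != d] &
      [/\ 0 < h b, 0 < h c & 0 < h d] ].
Proof.
move=> G QK busy; have [a [b [c [d [U [aQ bQ cQ dQ] S]]]]] := tet_elems QK.
move: U; rewrite /= !inE !negb_or !andbT => /and3P[/and3P[ab ac ad] /andP[bc bd] cd].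
have [ba ca da] : [/\ b != a, c != a & d != a] by rewrite ![_ == a]eq_sym.
have [cb db dc] : [/\ c != b, d != b & d != c] by rewrite ![_ == b]eq_sym (eq_sym d).
have pos p : #|hanging e Q p| = 0 -> p \in Q -> forall q, q \in Q -> p != q -> 0 < #|hanging e Q q|.
  by move=> p0 pQ q qQ pq; have := busy p q pQ qQ pq; rewrite p0.
case: (posnP #|hanging e Q a|) => ha.
  by exists a, b, c, d; split=> //; split; apply: (pos a).
case: (posnP #|hanging e Q b|) => hb.
  exists b, a, c, d; split=> //.
  - by move=> f; rewrite S; move: (f a) (f b) (f c) (f d); clear; lia.
  - by split=> //; apply: (pos b).
case: (posnP #|hanging e Q c|) => hc.
  exists c, a, b, d; split=> //.
  - by move=> f; rewrite S; move: (f a) (f b) (f c) (f d); clear; lia.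
  - by split=> //; apply: (pos c).
exists d, a, b, c; split=> //.
by move=> f; rewrite S; move: (f a) (f b) (f c) (f d); clear; lia.
Qed.

Lemma triangles8 e W : gemfree_on e W -> #|W| = 8 -> #|cliques e 3| <= 8.
Proof.
move=> G W8; have [K0|[Q QK]] := set_0Vmem (cliques e 4).
  by have := k4free_bound G K0; rewrite W8; lia.
have [[f [U [GU cU le [u [v bare]]]]]|busy] := idle_split G QK.
  by have := triangles6_bare GU _ bare; rewrite cU W8 => /(_ erefl); lia.
have [a [b [c [d [_ S _ [hb hc hd]]]]]] := busy_numbers G QK busy.
have := sum_outer G QK; rewrite S W8.
have := busy_profile G QK hb; have := busy_profile G QK hc; have := busy_profile G QK hd.
by clear; lia.
Qed.

Lemma triangles9 e W : gemfree_on e W -> #|W| = 9 -> #|cliques e 3| <= 10.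
Proof.
move=> G W9; have [K0|[Q QK]] := set_0Vmem (cliques e 4).
  by have := k4free_bound G K0; rewrite W9; lia.
have [[f [U [GU cU le [u [v bare]]]]]|busy] := idle_split G QK.
  by have := triangles7_bare GU _ bare; rewrite cU W9 => /(_ erefl); lia.
have [a [b [c [d [_ S _ [hb hc hd]]]]]] := busy_numbers G QK busy.
have := sum_outer G QK; rewrite S W9.
have := busy_profile G QK hb; have := busy_profile G QK hc; have := busy_profile G QK hd.
by clear; lia.
Qed.

Lemma card_delQ e W Q : gemfree_on e W -> Q \in cliques e 4 -> #|W :\: Q| = #|W| - 4.
Proof.
by move=> G QK; rewrite card_del ?(cliques_card QK) // (clique_sub G _ QK).
Qed.

(** If three vertices of the K4 are busy, then each has two outer neighbours and one hanging
    triangle, and at most five triangles remain on the six vertices outside. *)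
Lemma triangles10 e W : gemfree_on e W -> #|W| = 10 -> #|cliques e 3| <= 12.
Proof.
move=> G W10; have [K0|[Q QK]] := set_0Vmem (cliques e 4).
  by have := k4free_bound G K0; rewrite W10; lia.
have [[f [U [GU cU le _]]]|busy] := idle_split G QK.
  by have := triangles8 GU; rewrite cU W10 => /(_ erefl); lia.
have [a [b [c [d [_ S _ [hb hc hd]]]]]] := busy_numbers G QK busy.
have := sum_outer G QK; rewrite S W10.
have := tri_del G QK (subxx Q); rewrite S.
have := triangles6 (gemfree_del G Q); rewrite (card_delQ G QK) W10 => /(_ erefl).
have := busy_profile G QK hb; have := busy_profile G QK hc; have := busy_profile G QK hd.
by have [+ _] := hanging_profile a G QK; clear; lia.
Qed.

Lemma hanging_not_in_tet e W Q v Q' x y : gemfree_on e W -> Q' \in cliques (del e W Q) 4 ->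
  v \in Q -> x \in outer e Q v -> y \in outer e Q v -> x != y ->
  x \in Q' -> y \in Q' -> False.
Proof.
move=> G; rewrite cliques_del // => /setIdP[Q'K Q'W] vQ; rewrite !inE.
case/andP => _ vx /andP[_ vy] xy xQ' yQ'.
have vQ' := tet_closed G Q'K xQ' yQ' xy vx vy.
by have := subsetP Q'W v vQ'; rewrite inE vQ.
Qed.

(** Unless two vertices are idle, the seven outer vertices are shared out among three busy
    vertices as 2, 2, 2 or 2, 2, 3. At most six triangles avoid the K4 Q, so only the case
    where five triangles hang at Q is left; then some v with outer
    neighbourhood of size three is in a second K4, Q2. For Q2 the same dichotomy holds, and
    if it too has three busy vertices, then the triangles outside Q number at most
    1 + 2 + 2: the triangle Q2 minus v, those hanging at it, and those on the last four
    vertices. *)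
Lemma triangles11 e W : gemfree_on e W -> #|W| = 11 -> cliques e 4 != set0 -> #|cliques e 3| <= 14.
Proof.
move=> G W11 /set0Pn[Q QK].
have via9 Q0 : (exists f U, [/\ gemfree_on f U, #|U| = #|W| - 2,
    #|cliques e 3| <= 4 + #|cliques f 3| & exists u v, bare_edge f u v]) -> #|cliques e 3| <= 14.
  by case=> f [U [GU cU le _]]; have := triangles9 GU; rewrite cU W11 => /(_ erefl); lia.
have [|busy] := idle_split G QK; first exact: via9 Q.
have [a [b [c [d [[aQ bQ cQ dQ] S [ab ac ad bc bd] [hb hc hd]]]]]] := busy_numbers G QK busy.
have So := sum_outer G QK; rewrite S W11 in So.
have tQ := tri_del G QK (subxx Q); rewrite S in tQ.
have GR := gemfree_del G Q; have cR : #|W :\: Q| = 7 by rewrite (card_delQ G QK) W11.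
have P v := hanging_profile v G QK.
have hanging_edge v T : T \in hanging e Q v -> exists x y,
    [/\ T = [set v; x; y], x \in outer e Q v, y \in outer e Q v & e x y].
  move=> Th; have [TT vT vQ _] := hangingP Th.
  have [x [y [TE vx xy vy]]] := triangle_vertex G TT vT.
  exists x, y; split=> //; apply: (hanging_outer Th);
    by rewrite ?TE ?inE ?eqxx ?orbT // eq_sym (edge_neq G).
(* Seven triangles outside Q would put every edge there into a K4; but the edge opposite to b
   in a hanging triangle is in no K4 outside Q. *)
have R6 : #|cliques (del e W Q) 3| <= 6.
  have [//|[_ allK]] := triangles7 GR cR.
  have /card_gt0P[T Th] := hb.
  have [x [y [TE xo yo xy]]] := hanging_edge b T Th.
  have [Q' [Q'K xQ' yQ']] : exists Q', [/\ Q' \in cliques (del e W Q) 4, x \in Q' & y \in Q'].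
    apply: allK; rewrite /del /induced xy !in_setD.
    move: xo yo; rewrite !in_setD => /andP[-> _] /andP[-> _].
    by rewrite (gf_supp G xy) (edge_supp_r G xy).
  by case: (hanging_not_in_tet G Q'K bQ xo yo (edge_neq G xy) xQ' yQ').
have [Pa _] := P a; have [Pb _] := P b; have [Pc _] := P c; have [Pd _] := P d.
have Bb := busy_profile G QK hb; have Bc := busy_profile G QK hc; have Bd := busy_profile G QK hd.
have [small|big] := leqP (#|hanging e Q a| + #|hanging e Q b| + #|hanging e Q c| + #|hanging e Q d|) 4.
  by move: tQ R6 small; clear; lia.
have [h5 full] : #|hanging e Q a| + #|hanging e Q b| + #|hanging e Q c| + #|hanging e Q d| = 5 /\
   [\/ #|hanging e Q b| = 3 /\ #|outer e Q b| = 3, #|hanging e Q c| = 3 /\ #|outer e Q c| = 3 |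
      #|hanging e Q d| = 3 /\ #|outer e Q d| = 3].
  exact: full_vertex Pa Pb Pc Pd Bb Bc Bd So big.
have [w [v [wQ vQ wv [hw hv ov]]]] : exists w v, [/\ w \in Q, v \in Q, w != v &
   [/\ 0 < #|hanging e Q w|, #|hanging e Q v| = 3 & #|outer e Q v| = 3]].
  by case: full => -[? ?]; [exists c, b|exists b, c|exists b, d]; split; rewrite // eq_sym.
have [|| Q2 [Q2K vQ2 Q2Q]] := hanging_full G QK (v := v); rewrite ?hv ?ov //.
(* The three outer neighbours of v make up its second K4. *)
have Q2o : Q2 :\ v = outer e Q v.
  apply/eqP; rewrite eqEcard ov; have := cardsD1 v Q2; rewrite vQ2 (cliques_card Q2K) => c2.
  apply/andP; split; last by move: c2; clear; lia.
  apply/subsetP => x /setD1P[xv xQ2]; rewrite !inE; apply/andP; split.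
    by apply: contra Q2Q => xQ; apply/eqP; apply: (tet_eq G Q2K QK xv).
  by apply: clique_edge Q2K _ _ _; rewrite // eq_sym.
have [|busy2] := idle_split G Q2K; first exact: via9 Q2.
have Q2v : Q2 :\ v \subset Q2 := subD1set _ _.
have TW : Q2 :\ v \subset W :\: Q.
  apply/subsetP => x; rewrite Q2o !inE => /andP[-> vx].
  by rewrite (edge_supp_r G vx).
have split2 := tri_split G (W :\: Q) Q2K Q2v.
(* Triangles outside Q: at most one inside Q2, two hanging at Q2, two on the last four vertices. *)
have one : #|[set T in cliques e 3 | (T \subset Q2 :&: (W :\: Q)) && ~~ [disjoint T & Q2 :\ v]]| <= 1.
  apply: (@leq_trans #|[set Q2 :\ v]|); last by rewrite cards1.
  apply: subset_leq_card; apply/subsetP => T.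
  case/setIdP => TT /andP[TS _]; rewrite inE eqEcard (cliques_card TT) Q2o ov leqnn andbT -Q2o.
  apply/subsetP => x xT; have := subsetP TS x xT; rewrite in_setI in_setD in_setD1 => /and3P[xQ2 xQ _].
  by rewrite xQ2 andbT; apply: contraNneq xQ => ->.
have G2 : #|[set T in cliques e 3 | T \subset (W :\: Q) :\: (Q2 :\ v)]| <= 2.
  rewrite -(cliques_induced e _ (isT : 1 < 3)).
  have GG := gemfree_induced G ((W :\: Q) :\: (Q2 :\ v)).
  have SW : (W :\: Q) :\: (Q2 :\ v) \subset W by rewrite setDDl subsetDl.
  have cS : #|(W :\: Q) :\: (Q2 :\ v)| = 4 by rewrite cardsD (setIidPr TW) cR Q2o ov.
  have cG : #|W :&: ((W :\: Q) :\: (Q2 :\ v))| = 4 by rewrite (setIidPr SW).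
  have [K0|[Q3 Q3K]] := set_0Vmem (cliques (induced e ((W :\: Q) :\: (Q2 :\ v))) 4).
    by have := k4free_bound GG K0; rewrite cG; clear; lia.
  move: (Q3K); rewrite cliques_induced // => /setIdP[Q3K' Q3S].
  have Q3E : Q3 = (W :\: Q) :\: (Q2 :\ v).
    by apply/eqP; rewrite eqEcard Q3S (cliques_card Q3K') cS.
  have /card_gt0P[T Th] := hw.
  have [x [y [TE xo yo xy]]] := hanging_edge w T Th.
  have inQ3 z : z \in outer e Q w -> z \in Q3.
    move=> zo; rewrite Q3E Q2o 2!in_setD; apply/andP; split.
      by apply: contraTN zo => zv; move/pred0P: (outer_disjoint G QK wQ vQ wv) => /(_ z) /=; rewrite zv andbT => ->.
    by move: zo; rewrite !inE => /andP[-> wz]; rewrite (edge_supp_r G wz).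
  have Q3K2 : Q3 \in cliques (del e W Q) 4.
    by rewrite cliques_del //; apply/setIdP; split=> //; rewrite Q3E subsetDl.
  by case: (hanging_not_in_tet G Q3K2 wQ xo yo (edge_neq G xy) (inQ3 x xo) (inQ3 y yo)).
have hs : \sum_(t in Q2 :\ v) #|hanging e Q2 t| <= 2.
  have P2 t := hanging_profile t G Q2K.
  have [p [q [r [s [[pQ qQ rQ sQ] S2 [pq pr ps qr qs] [hq hr hs]]]]]] := busy_numbers G Q2K busy2.
  have So2 := sum_outer G Q2K; rewrite W11 (big_setD1 v) //= in So2.
  have ov2 : 2 < #|outer e Q2 v|.
    have : Q :\ v \subset outer e Q2 v.
      apply/subsetP => x /setD1P[xv xQ]; rewrite !inE; apply/andP; split.
        by apply: contra Q2Q => xQ2; apply/eqP; apply: (tet_eq G Q2K QK xv).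
      by apply: clique_edge QK _ _ _; rewrite // eq_sym.
    move/subset_leq_card; have := cardsD1 v Q; rewrite vQ (cliques_card QK); clear; lia.
  have [x1 [x2 [x3 [n12 n13 n23 E3]]]] : exists x1 x2 x3,
     [/\ x1 != x2, x1 != x3, x2 != x3 & Q2 :\ v = [set x1; x2; x3]].
    have TT : Q2 :\ v \in cliques e 3.
      rewrite inE Q2o ov -Q2o /=; apply/cliqueP => x y /setD1P[_ xQ2] /setD1P[_ yQ2].
      exact: clique_edge Q2K xQ2 yQ2.
    have /card_gt0P[x1 x1T] : 0 < #|Q2 :\ v| by rewrite Q2o ov.
    have [x2 [x3 [E e12 e23 e13]]] := triangle_vertex G TT x1T.
    by exists x1, x2, x3; rewrite !(edge_neq G).
  have S3 (f : V -> nat) : \sum_(t in Q2 :\ v) f t = f x1 + f x2 + f x3.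
    rewrite E3 -setUA big_setU1 ?inE ?negb_or ?n12 //=.
    by rewrite big_setU1 ?inE //= big_set1 addnA.
  have inQ2 x : x \in Q2 :\ v -> x \in Q2 by case/setD1P.
  have [y1 y2 y3] : [/\ x1 \in Q2, x2 \in Q2 & x3 \in Q2].
    by split; apply: inQ2; rewrite E3 !inE eqxx ?orbT.
  rewrite S3 in So2; rewrite S3.
  have := busy2 x1 x2 y1 y2 n12; have := busy2 x1 x3 y1 y3 n13; have := busy2 x2 x3 y2 y3 n23.
  have [_ p1] := P2 x1; have [_ p2] := P2 x2; have [_ p3] := P2 x3 => b3 b2 b1.
  by apply: (busy_two_of_three p1 p2 p3 b1 b2 b3); move: So2 ov2; clear; lia.
have : #|cliques (del e W Q) 3| = #|[set T in cliques e 3 | T \subset W :\: Q]| by rewrite cliques_del.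
by move: tQ h5 split2 one hs G2; clear; lia.
Qed.

End Small.

(** * Graphs with a K4 are not extremal *)

Section Strict.
Variable V : finType.
Implicit Types (e : rel V) (W Q Z : {set V}).

(** The last inequality says, without division, that the number of triangles is less than
    n^2/8 rounded down. *)
Definition tet_deficient (n : nat) : Prop := forall e W,
  gemfree_on e W -> #|W| = n -> cliques e 4 != set0 -> 8 * #|cliques e 3| + 8 <= n ^ 2.

(** Squares are 0, 1 or 4 modulo 8. *)
Lemma sq_mod8 n t : n ^ 2 < 8 * t + 8 -> n ^ 2 <= 8 * t + 4.
Proof.
rewrite {1 2}(divn_eq n 4) -mulnn; move: (n %/ 4) (ltn_pmod n (isT : 0 < 4)) => q.
by case: (n %% 4) => [|[|[|[|]]]] // _; nia.
Qed.

(** Deleting v leaves the triangle Q minus v, whose edges are in no other triangle of the rest.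
    In an extremal graph without K4s every triangle contains a spine with at least two pages. *)
Lemma del_vertex_not_extremal e W Q v : gemfree_on e W -> Q \in cliques e 4 -> v \in Q ->
  6 < #|W| -> (#|W| - 1) ^ 2 <= 8 * #|cliques (del e W [set v]) 3| + 4 ->
  cliques (del e W [set v]) 4 != set0.
Proof.
move=> G QK vQ W6 Wt; apply/eqP => K0.
have vW : v \in W := subsetP (clique_sub G (isT : 1 < 4) QK) v vQ.
have cW : #|W :\: [set v]| = #|W| - 1 by rewrite card_del ?cards1 ?sub1set.
have [||X [Y [XY pj X2 _]]] := k4free_extremal (gemfree_del G [set v]) K0; rewrite ?cW //.
  by lia.
have inXY x : x \in Q -> x != v -> x \in X :|: Y.
  by move=> xQ xv; rewrite XY !inE xv (subsetP (clique_sub G (isT : 1 < 4) QK)).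
have del_e x y : del e W [set v] x y -> e x y by case/and3P.
have XQ a b : a \in Q -> b \in Q -> a != b -> a \in Y -> b \in Y -> X \subset Q.
  move=> aQ bQ ab aY bY; apply/subsetP => x xX.
  by apply: (tet_closed G QK aQ bQ ab); apply: del_e; apply: (pj_join pj).
have disj x : x \in X -> x \in Y -> False.
  by move=> xX xY; move/pred0P: (pj_disj pj) => /(_ x) /=; rewrite xX xY.
have cXQ : #|X :&: Q| <= 1.
  apply/card_le1P => x /setIP[xX xQ] y; rewrite !inE.
  apply/andP/eqP => [[yX yQ]|-> //]; apply/eqP/negPn/negP => yx.
  have xv z : z \in X -> z != v.
    by move=> zX; have : z \in X :|: Y by [rewrite inE zX]; rewrite XY !inE => /andP[].
  have := pj_indep pj yX xX; rewrite /del /induced (clique_edge QK yQ xQ yx) /=.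
  have: (y \in X :|: Y) && (x \in X :|: Y) by rewrite !inE yX xX.
  by rewrite XY => /andP[-> ->].
have : 1 < #|(Q :\ v) :\: X|.
  have c3 : #|Q :\ v| = 3 by have := cardsD1 v Q; rewrite vQ (cliques_card QK); lia.
  have := cardsID X (Q :\ v); rewrite c3.
  have : #|(Q :\ v) :&: X| <= #|X :&: Q|.
    by apply: subset_leq_card; apply/subsetP => x; rewrite !inE => /andP[/andP[_ ->] ->].
  by lia.
case/card_gt1P => a [b [/setDP[/setD1P[av aQ] aX] /setDP[/setD1P[bv bQ] bX] ab]].
have inY x : x \in Q -> x != v -> x \notin X -> x \in Y.
  by move=> xQ xv xX; have := inXY x xQ xv; rewrite inE (negPf xX).
have XsQ := XQ a b aQ bQ ab (inY a aQ av aX) (inY b bQ bv bX).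
by move: cXQ X2; rewrite (setIidPl XsQ); clear; lia.
Qed.

(** If the graph on n vertices that remains has a K4, it is deficient; otherwise it is not
    extremal by [del_vertex_not_extremal]. *)
Lemma tri_del_vertex e W Q v n : gemfree_on e W -> Q \in cliques e 4 -> v \in Q ->
  tet_deficient n -> 5 < n -> #|W| = n.+1 ->
  8 * #|cliques e 3| <= n ^ 2 + 8 * #|hanging e Q v| + 16.
Proof.
move=> G QK vQ def n5 cW; rewrite leqNgt; apply/negP => big.
have vW : v \in W := subsetP (clique_sub G (isT : 1 < 4) QK) v vQ.
have cD : #|W :\: [set v]| = n by rewrite card_del ?cards1 ?sub1set // cW; lia.
have le := tri_del1 G QK vQ.
have lt : n ^ 2 < 8 * #|cliques (del e W [set v]) 3| + 8 by lia.
have K : cliques (del e W [set v]) 4 != set0.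
  by apply: (del_vertex_not_extremal G QK vQ); rewrite cW ?subn1 //=; apply: sq_mod8.
by have := def _ _ (gemfree_del G [set v]) cD K; lia.
Qed.

Lemma deficient11 : tet_deficient 11.
Proof. by move=> e W G cW K; have := triangles11 G cW K; lia. Qed.

(** In a counterexample, by [tri_del_vertex], all four vertices of a K4 are busy, so each has exactly two of the
    eight outer vertices, and only one hanging triangle. *)
Lemma deficient12 : tet_deficient 12.
Proof.
move=> e W G cW /set0Pn[Q QK]; rewrite leqNgt; apply/negP => big.
have H v (vQ : v \in Q) := tri_del_vertex G QK vQ deficient11 (isT : 5 < 11) cW.
have [a [b [c [d [U [aQ bQ cQ dQ] S]]]]] := tet_elems QK.
have := sum_outer G QK; rewrite S cW.
have := tri_del G QK (subxx Q); rewrite S.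
have := triangles8 (gemfree_del G Q); rewrite (card_delQ G QK) cW => /(_ erefl).
have B v (vQ : v \in Q) : #|hanging e Q v| + 3 <= 2 * #|outer e Q v|.
  by apply: (busy_profile G QK); move: (H v vQ) big; clear; lia.
by move: (B a aQ) (B b bQ) (B c cQ) (B d dQ) big; clear; lia.
Qed.

Lemma deficient13 : tet_deficient 13.
Proof.
move=> e W G cW /set0Pn[Q QK]; rewrite leqNgt; apply/negP => big.
have H v (vQ : v \in Q) := tri_del_vertex G QK vQ deficient12 (isT : 5 < 12) cW.
have [a [b [c [d [U [aQ bQ cQ dQ] S]]]]] := tet_elems QK.
have := sum_outer G QK; rewrite S cW.
have := tri_del G QK (subxx Q); rewrite S.
have := triangles9 (gemfree_del G Q); rewrite (card_delQ G QK) cW => /(_ erefl).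
have B v (vQ : v \in Q) : #|hanging e Q v| + 3 <= 2 * #|outer e Q v|.
  by apply: (busy_profile G QK); move: (H v vQ) big; clear; lia.
by move: (B a aQ) (B b bQ) (B c cQ) (B d dQ) big; clear; lia.
Qed.

(** With ten outer vertices and eight hanging triangles, two vertices of the K4 have h = 1 and
    the other two h = o = 3. *)
Lemma two_and_two (ha hb hc hd oa ob oc od : nat) :
  ha <= oa -> hb <= ob -> hc <= oc -> hd <= od ->
  ha + 3 <= 2 * oa -> hb + 3 <= 2 * ob -> hc + 3 <= 2 * oc -> hd + 3 <= 2 * od ->
  oa + ob + oc + od + 4 <= 14 -> 8 <= ha + hb + hc + hd ->
  [\/ [/\ ha = 1, hb = 1, hc = 3 & oc = 3], [/\ ha = 1, hc = 1, hb = 3 & ob = 3],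
      [/\ ha = 1, hd = 1, hb = 3 & ob = 3] |
      [\/ [/\ hb = 1, hc = 1, ha = 3 & oa = 3], [/\ hb = 1, hd = 1, ha = 3 & oa = 3] |
          [/\ hc = 1, hd = 1, ha = 3 & oa = 3]]].
Proof.
move=> a b c d a' b' c' d' o h.
have [a2|a3] := leqP oa 2.
  have [b2|b3] := leqP ob 2; first by apply: Or41; split; lia.
  have [c2|c3] := leqP oc 2; first by apply: Or42; split; lia.
  by apply: Or43; split; lia.
apply: Or44; have [b2|b3] := leqP ob 2.
  have [c2|c3] := leqP oc 2; first by apply: Or31; split; lia.
  by apply: Or32; split; lia.
by apply: Or33; split; lia.
Qed.

(** In a counterexample, the only distribution that is not excluded by counting has two vertices s, s' with one
    hanging triangle each, and two with three each, which lie in further K4s. Deleting s and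
    s' costs only six triangles and leaves a K4 on twelve vertices. *)
Lemma deficient14 : tet_deficient 14.
Proof.
move=> e W G cW /set0Pn[Q QK]; rewrite leqNgt; apply/negP => big.
have H v (vQ : v \in Q) := tri_del_vertex G QK vQ deficient13 (isT : 5 < 13) cW.
have [a [b [c [d [U [aQ bQ cQ dQ] S]]]]] := tet_elems QK.
have := sum_outer G QK; rewrite S cW.
have := tri_del G QK (subxx Q); rewrite S.
have := triangles10 (gemfree_del G Q); rewrite (card_delQ G QK) cW => /(_ erefl).
have B v (vQ : v \in Q) : #|hanging e Q v| + 3 <= 2 * #|outer e Q v|.
  by apply: (busy_profile G QK); move: (H v vQ) big; clear; lia.
have O v : #|hanging e Q v| <= #|outer e Q v| := hanging_outer_le G v QK.
have Ba := B a aQ; have Bb := B b bQ; have Bc := B c cQ; have Bd := B d dQ => R12 tQ So.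
have [s [s' [r [sQ s'Q rQ [ss' rs rs' hs] [hs' hr or]]]]] : exists s s' r, [/\ s \in Q, s' \in Q, r \in Q,
   [/\ s != s', r != s, r != s' & #|hanging e Q s| = 1] &
   [/\ #|hanging e Q s'| = 1, #|hanging e Q r| = 3 & #|outer e Q r| = 3]].
  have tight : #|hanging e Q a| + #|hanging e Q b| + #|hanging e Q c| + #|hanging e Q d| >= 8.
    by move: R12 tQ big; clear; lia.
  move: U; rewrite /= !inE !negb_or !andbT => /and3P[/and3P[ab ac ad] /andP[bc bd] cd].
  have [ba ca da] : [/\ b != a, c != a & d != a] by rewrite ![_ == a]eq_sym.
  have [cb db dc] : [/\ c != b, d != b & d != c] by rewrite ![_ == b]eq_sym (eq_sym d).
  case: (two_and_two (O a) (O b) (O c) (O d) Ba Bb Bc Bd So tight).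
  - by case=> h1 h2 h3 h4; exists a, b, c.
  - by case=> h1 h2 h3 h4; exists a, c, b.
  - by case=> h1 h2 h3 h4; exists a, d, b.
  case=> -[h1 h2 h3 h4]; [by exists b, c, a | by exists b, d, a | by exists c, d, a].
have ZQ : [set s; s'] \subset Q by apply/subsetP => x; rewrite !inE => /orP[] /eqP->.
have tZ : #|cliques e 3| <= 6 + #|cliques (del e W [set s; s']) 3|.
  apply: leq_trans (tri_del G QK ZQ) _.
  by rewrite big_setU1 ?inE //= big_set1 hs hs'.
have QW := clique_sub G (isT : 1 < 4) QK.
have cD : #|W :\: [set s; s']| = 12.
  by rewrite card_del ?cards2 ?ss' ?cW // (subset_trans ZQ).
have [|| Q' [Q'K rQ' Q'Q]] := hanging_full G QK (v := r); rewrite ?hr ?or //.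
have : cliques (del e W [set s; s']) 4 != set0.
  apply/set0Pn; exists Q'; rewrite cliques_del //; apply/setIdP; split=> //.
  rewrite subsetD (clique_sub G _ Q'K) //=; apply/pred0P => x /=; apply/negP => /andP[xQ'].
  move=> xZ; have xQ := subsetP ZQ x xZ; case/negP: Q'Q; apply/eqP.
  apply: (tet_eq G Q'K QK (x := r) (y := x)) => //.
  by move: xZ; rewrite !inE => /orP[] /eqP->.
move/(deficient12 (gemfree_del G [set s; s']) cD); move: tZ big; clear.
by move: #|cliques e 3| #|cliques (del e W [set s; s']) 3| => x y; lia.
Qed.

(** In a counterexample every vertex of the K4 has two hanging triangles, hence three outer neighbours: twelve in
    all, but there are only eleven outer vertices. *)
Lemma deficient15 : tet_deficient 15.
Proof.
move=> e W G cW /set0Pn[Q QK]; rewrite leqNgt; apply/negP => big.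
have H v (vQ : v \in Q) := tri_del_vertex G QK vQ deficient14 (isT : 5 < 14) cW.
have [a [b [c [d [U [aQ bQ cQ dQ] S]]]]] := tet_elems QK.
have := sum_outer G QK; rewrite S cW.
have B v (vQ : v \in Q) : 3 <= #|outer e Q v|.
  have := H v vQ => h2; have := busy_profile G QK (v := v); move: h2 big; clear; lia.
by move: (B a aQ) (B b bQ) (B c cQ) (B d dQ); clear; lia.
Qed.

Lemma sum_weights e W : gemfree_on e W ->
  \sum_(v in W) (#|lnbr e v| + 4 * #|tets_at e v|) = 4 * #|cliques e 3|.
Proof.
move=> G; rewrite big_split -big_distrr /= (sum_lnbr G) (sum_tets_at G) (card_tri G); lia.
Qed.

(** Cauchy's inequality for the weights in the form (2x(v) - n)^2 >= 0, and >= 1 when n is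
    odd. *)
Lemma weighted_bound e W : gemfree_on e W ->
  24 * #|W| * #|cliques e 3| + 3 * #|W| * odd #|W| + 32 * #|W| * #|cliques e 4|
  <= 3 * #|W| ^ 3 + 512 * #|cliques e 4|.
Proof.
move=> G; have := weighted_count G; have := sum_weights G.
set x := fun v => #|lnbr e v| + 4 * #|tets_at e v|; rewrite -/(x _).
have C : 4 * #|W| * (\sum_(v in W) x v) + #|W| * odd #|W| <=
    4 * (\sum_(v in W) x v ^ 2) + #|W| * #|W| ^ 2.
  rewrite !big_distrr /= -!sum_nat_const -!big_split /=.
  apply: leq_sum => v _; move: (x v) #|W| => y n; rewrite -!mulnn; clear.
  have [ny|yn] := leqP n (2 * y); case: (odd n) (odd_double_half n) => /= E; nia.
move: C; move: (\sum_(v in W) x v ^ 2) (\sum_(v in W) x v).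
move: (\sum_(v in W) #|lnbr e v| * #|tets_at e v|) => pk s2 s1.
move: #|W| #|cliques e 3| #|cliques e 4| => n t k.
rewrite !expnS expn0 muln1; move: (odd n : nat) => o; clear => A E B; subst s1; lia.
Qed.

Lemma tri_bound_large e W : gemfree_on e W -> 16 <= #|W| -> 8 * #|cliques e 3| <= #|W| ^ 2.
Proof.
move=> G W16; have := weighted_bound G; move: W16.
move: #|W| #|cliques e 3| #|cliques e 4| => n t k n16.
rewrite !expnS expn0 muln1; move: (odd n : nat) => o; nia.
Qed.

(** Here n^2 = 1 mod 8, and the parity term of [weighted_bound] uses up this remainder, so the
    term of the K4s is in excess. *)
Lemma deficient_odd n : 17 <= n -> odd n -> tet_deficient n.
Proof.
move=> n17 on e W G cW K; have := weighted_bound G; rewrite cW on.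
rewrite -card_gt0 in K; move: #|cliques e 3| #|cliques e 4| K => t k k0 H.
rewrite leqNgt; apply/negP => /sq_mod8 lt; have := odd_double_half n; rewrite on => E.
have : n ^ 2 <= 8 * t + 1.
  move: lt; rewrite -E -mulnn; move: n./2 => m; clear; nia.
move: H; rewrite !expnS expn0 muln1; nia.
Qed.

End Strict.

(** * The bound for all orders *)

Section Bound.
Variable V : finType.
Implicit Types (e : rel V) (W Q Z : {set V}).

Lemma tri_bound e W : gemfree_on e W -> 8 <= #|W| -> 8 * #|cliques e 3| <= #|W| ^ 2.
Proof.
move=> G W8; have [K0|K] := eqVneq (cliques e 4) set0; first exact: k4free_bound G K0.
have [W16|W16] := leqP 16 #|W|; first exact: tri_bound_large.
move: W16 W8 (@triangles8 _ _ _ G) (@triangles9 _ _ _ G) (@triangles10 _ _ _ G) (@deficient11 _ _ _ G)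
  (@deficient12 _ _ _ G) (@deficient13 _ _ _ G) (@deficient14 _ _ _ G) (@deficient15 _ _ _ G).
rewrite K; move: #|W| #|cliques e 3| => n t; clear => n16 n8.
have : n \in iota 8 8 by rewrite mem_iota n8.
rewrite !inE => /or4P[/eqP-> h _ _ _ _ _ _ _|/eqP-> _ h _ _ _ _ _ _|/eqP-> _ _ h _ _ _ _ _|].
- by have := h erefl; lia.
- by have := h erefl; lia.
- by have := h erefl; lia.
case/or4P => [/eqP-> _ _ _ h _ _ _ _|/eqP-> _ _ _ _ h _ _ _|/eqP-> _ _ _ _ _ h _ _|].
- by have := h erefl isT; lia.
- by have := h erefl isT; lia.
- by have := h erefl isT; lia.
case/orP => /eqP-> _ _ _ _ _ _ h h'.
  by have := h erefl isT; lia.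
by have := h' erefl isT; lia.
Qed.

(** Deleting one vertex shows that all vertices of Q are busy. Deleting Q shows that the number
    of hanging triangles falls short of that of outer vertices by at most two, so two vertices
    of Q have as many hanging triangles as outer neighbours, as [hanging_full] requires. *)
Lemma shared_tets e W n Q : gemfree_on e W -> #|W| = n.+1 -> 17 <= n -> n %% 4 = 1 ->
  tet_deficient V n -> n.+1 ^ 2 <= 8 * #|cliques e 3| + 4 -> Q \in cliques e 4 ->
  exists p p', [/\ p \in Q, p' \in Q, p != p',
    exists2 Qp, Qp \in cliques e 4 & (p \in Qp) && (Qp != Q) &
    exists2 Qp', Qp' \in cliques e 4 & (p' \in Qp') && (Qp' != Q)].
Proof.
move=> G cW n17 n1 def Wt QK.
have H v (vQ : v \in Q) := tri_del_vertex G QK vQ def (leq_trans (isT : 5 < 17) n17) cW.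
have [a [b [c [d [U [aQ bQ cQ dQ] S]]]]] := tet_elems QK.
have So := sum_outer G QK; rewrite S cW in So.
have tQ := tri_del G QK (subxx Q); rewrite S in tQ.
have cD : #|W :\: Q| = n - 3 by rewrite (card_delQ G QK) cW; lia.
have tD := tri_bound (gemfree_del G Q); rewrite cD in tD.
have O v : #|hanging e Q v| <= #|outer e Q v| := hanging_outer_le G v QK.
have B v (vQ : v \in Q) : 0 < #|hanging e Q v|.
  by move: (H v vQ) Wt n17; clear; rewrite -!mulnn; nia.
have F v (vQ : v \in Q) : #|outer e Q v| <= #|hanging e Q v| ->
    exists2 Qp, Qp \in cliques e 4 & (v \in Qp) && (Qp != Q).
  move=> le; have [Q' [Q'K vQ' ne]] := hanging_full G QK (B v vQ) le.
  by exists Q'; rewrite // vQ'.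
(* Here (n - 3)^2 = 4 modulo 8, so the bound for the graph outside Q can be sharpened by 4. *)
have key : #|outer e Q a| + #|outer e Q b| + #|outer e Q c| + #|outer e Q d| <=
   #|hanging e Q a| + #|hanging e Q b| + #|hanging e Q c| + #|hanging e Q d| + 2.
  have {}tD : 8 * #|cliques (del e W Q) 3| + 4 <= (n - 3) ^ 2.
    have [q nE] : exists q, n - 3 = 4 * q + 2.
      by exists ((n - 3) %/ 4); move: n1 n17; clear; lia.
    have := tD _; rewrite nE; move/(_ ltac:(move: nE n17; clear; lia)).
    by rewrite -!mulnn; move: #|cliques (del e W Q) 3| => t; clear; lia.
  move: tD tQ Wt So n17; clear; rewrite -!mulnn.
  move: (#|outer e Q a| + #|outer e Q b| + #|outer e Q c| + #|outer e Q d|) => o.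
  move: (#|hanging e Q a| + #|hanging e Q b| + #|hanging e Q c| + #|hanging e Q d|) => h.
  move: #|cliques e 3| #|cliques (del e W Q) 3| => t t' A B C D n17.
  have [m E] : exists m, n = m + 3 by exists (n - 3); lia.
  by subst n; rewrite addnK in A; lia.
move: U; rewrite /= !inE !negb_or !andbT => /and3P[/and3P[ab ac ad] /andP[bc bd] cd].
have [Fa|na] := leqP #|outer e Q a| #|hanging e Q a|.
  have [Fb|nb] := leqP #|outer e Q b| #|hanging e Q b|.
    by exists a, b; split=> //; apply: F.
  have [Fc|nc] := leqP #|outer e Q c| #|hanging e Q c|.
    by exists a, c; split=> //; apply: F.
  exists a, d; split=> //; apply: F => //; move: (O a) nb nc key; clear; lia.
have [Fb|nb] := leqP #|outer e Q b| #|hanging e Q b|.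
  have [Fc|nc] := leqP #|outer e Q c| #|hanging e Q c|.
    by exists b, c; split=> //; apply: F.
  exists b, d; split=> //; apply: F => //; move: (O b) na nc key; clear; lia.
exists c, d; split=> //; apply: F => //; move: (O c) (O d) na nb key; clear; lia.
Qed.

(** Two K4s Qp, Qp' meet Q in different vertices p, p'; a second shared vertex r of Qp gives a
    fourth K4, as Qp' through r would make p, p', r a triangle across three K4s. *)
Lemma many_tets e W : gemfree_on e W -> cliques e 4 != set0 ->
  (forall Q, Q \in cliques e 4 -> exists p p', [/\ p \in Q, p' \in Q, p != p',
    exists2 Qp, Qp \in cliques e 4 & (p \in Qp) && (Qp != Q) &
    exists2 Qp', Qp' \in cliques e 4 & (p' \in Qp') && (Qp' != Q)]) ->
  4 <= #|cliques e 4|.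
Proof.
move=> G /set0Pn[Q QK] H.
have [p [p' [pQ p'Q pp' [Qp QpK /andP[pQp QpQ]] [Qp' Qp'K /andP[p'Qp' Qp'Q]]]]] := H Q QK.
have p'Qp : p' \notin Qp.
  by apply: contra QpQ => p'Qp; apply/eqP; apply: (tet_eq G QpK QK pp').
have QpQp' : Qp != Qp' by apply: contraNneq p'Qp => ->.
have other : exists r S, [/\ r \in Qp, r != p, S \in cliques e 4, r \in S & S != Qp].
  have [r [r' [rQ r'Q rr' [S SK /andP[rS ne]] [S' S'K /andP[r'S' ne']]]]] := H Qp QpK.
  have [rp|rp] := eqVneq r p; last by exists r, S.
  by exists r', S'; split=> //; rewrite -rp eq_sym.
have [r [S [rQp rp SK rS SQp]]] := other.
have rQ : r \notin Q by apply: contra QpQ => rQ; apply/eqP; apply: (tet_eq G QpK QK rp).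
have SQ : S != Q by apply: contraNneq rQ => <-.
(* Otherwise r would be joined to p and p' in Q. *)
have SQp' : S != Qp'.
  apply: contraNneq rQ => E; apply: (tet_closed G QK pQ p'Q pp').
    by apply: clique_edge QpK rQp pQp rp.
  apply: clique_edge Qp'K _ p'Qp' _; first by rewrite -E.
  by apply: contraNneq p'Qp => <-.
have U : uniq [:: Q; Qp; Qp'; S].
  by rewrite /= !inE !negb_or !andbT (eq_sym Q) QpQ (eq_sym Q) Qp'Q (eq_sym Q) SQ QpQp' (eq_sym Qp) SQp eq_sym SQp'.
rewrite cardE; apply: (@leq_trans (size [:: Q; Qp; Qp'; S])) => //.
apply: uniq_leq_size => // x; rewrite mem_enum !in_cons orbF => /or4P[] /eqP-> //.
Qed.

(** For n = 2 mod 4 one K4 does not suffice to contradict [weighted_bound], but four do. *)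
Lemma deficient n : 11 <= n -> n != 16 -> tet_deficient V n.
Proof.
move=> n11 n16; have [n17|] := leqP 17 n; last first.
  move=> n17; have : n \in iota 11 6 by rewrite mem_iota n11.
  rewrite !inE (negPf n16) orbF.
  move=> /or4P[/eqP->|/eqP->|/eqP->|/orP[]/eqP->].
  - exact: deficient11.
  - exact: deficient12.
  - exact: deficient13.
  - exact: deficient14.
  - exact: deficient15.
case: (boolP (odd n)) => on; first exact: deficient_odd.
move=> e W G cW K; rewrite leqNgt; apply/negP => /sq_mod8 lt.
have WB := weighted_bound G; rewrite cW (negPf on) in WB.
have k0 : 0 < #|cliques e 4| by rewrite card_gt0.
have [n4|n4] := eqVneq (n %% 4) 0.
  have n2 : n ^ 2 <= 8 * #|cliques e 3|.
    have [q nE] : exists q, n = 4 * q by exists (n %/ 4); move: n4; clear; lia.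
    by move: lt; rewrite nE -!mulnn; move: #|cliques e 3| => t; clear; lia.
  move: WB k0 n17 n2; clear; move: #|cliques e 3| #|cliques e 4| => t k.
  rewrite !expnS expn0 muln1 => A B C D.
  have : 3 * n * (n * n) <= 3 * n * (8 * t) by rewrite leq_mul2l D orbT.
  have := leq_mul (leq_mul (leqnn 32) C) (leqnn k); lia.
have nm : n = n.-1.+1 by move: n17; clear; lia.
have k4 : 4 <= #|cliques e 4|.
  apply: (many_tets G K) => Q; apply: (shared_tets (n := n.-1) G); rewrite -?nm //.
  - by move: n17 on; clear; lia.
  - by move: n17 on n4; clear; lia.
  - by apply: deficient_odd; move: n17 on; clear; lia.
move: WB k4 n17 lt on; clear; move: n => m.
move: #|cliques e 3| #|cliques e 4| => t k; rewrite !expnS expn0 muln1 => A B C D me.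
have : 3 * m * (m * m) <= 3 * m * (8 * t + 4) by rewrite leq_mul2l D orbT.
have [j mE] : exists j, m = 18 + j by exists (m - 18); move: C me; clear; lia.
have [i kE] : exists i, k = 4 + i by exists (k - 4); move: B; clear; lia.
by subst m k; move: A; lia.
Qed.

End Bound.

(** * The two extremal constructions *)

Lemma gemfree_pull (U V : finType) (f : U -> V) (e : rel V) : injective f ->
  gemfree_on e [set: V] -> gemfree_on (fun x y => e (f x) (f y)) [set: U].
Proof.
move=> fi G; split=> //.
- by move=> x y; rewrite (gf_sym G).
- by move=> x; rewrite (gf_irr G).
move=> a x b c y ax ab ac ay xb bc cy xc by'; apply: (fi).
by apply: (gf_gem G ax ab ac ay xb bc cy); rewrite (inj_eq fi).
Qed.

Lemma isomorphic_avoids (U V : finType) (F : {set {set U}}) (H : {set {set V}}) (e : rel V) :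
  gemfree_on e [set: V] -> H \subset cliques e 3 -> isomorphic F H ->
  [/\ triple_system F, avoids F [:: confA; confB; confD] & #|F| = #|H|].
Proof.
move=> G HT [f /bij_inj fi E]; have GU := gemfree_pull fi G.
have FT : F \subset cliques (fun x y => e (f x) (f y)) 3.
  apply/subsetP => T TF; have : f @: T \in cliques e 3.
    by apply: (subsetP HT); rewrite -E; apply: imset_f.
  move=> fT; have := cliques_card fT; rewrite card_imset // => cT.
  rewrite inE cT /=; apply/cliqueP => x y xT yT xy.
  by apply: (clique_edge fT); rewrite ?imset_f ?(inj_eq fi).
have [F3 av] := gemfree_avoids GU FT; split=> //.
by rewrite -E card_imset //; apply: imset_inj.
Qed.

Section BookFamily.
Variables n k : nat.

Definition book_rel : rel 'I_n := fun x y =>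
  (x != y) && (((x < 2 * k) && (y < 2 * k) && (x./2 == y./2)) ||
               ((x < 2 * k) != (y < 2 * k))).

Lemma same_half (a u v : 'I_n) : u./2 = a./2 -> v./2 = a./2 -> a != u -> a != v -> u = v.
Proof. by rewrite -!val_eqE /= => ? ? ? ?; apply: val_inj => /=; lia. Qed.

(** The neighbourhood of a page is a matching of spines; that of a spine vertex is a star whose
    centre is its mate. Neither contains a path on four vertices. *)
Lemma book_gemfree : gemfree_on book_rel [set: 'I_n].
Proof.
have sym : symmetric book_rel.
  move=> x y; rewrite /book_rel eq_sym [y./2 == _]eq_sym.
  by case: (x < _); case: (y < _).
split=> //; first by move=> x; rewrite /book_rel eqxx.
have inner x y : book_rel x y -> x < 2 * k -> y < 2 * k -> x != y /\ y./2 = x./2.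
  by case/andP => xy + xk yk; rewrite xk yk /= orbF => /eqP->.
have outer_inner x y : book_rel x y -> (x < 2 * k) = false -> y < 2 * k.
  by case/andP => _ + xk; rewrite xk /=; case: (y < _).
move=> a x b c y ax ab ac ay xb bc cy xc by'.
case ak: (a < 2 * k); last first.
  have [xk bk ck] : [/\ x < 2 * k, b < 2 * k & c < 2 * k].
    by split; [apply: outer_inner ax ak|apply: outer_inner ab ak|apply: outer_inner ac ak].
  have bx : book_rel b x by rewrite sym.
  have [nbx hx] := inner b x bx bk xk; have [nbc hc] := inner b c bc bk ck.
  by rewrite (same_half hx hc nbx nbc) eqxx in xc.
case bk: (b < 2 * k).
  have ck : (c < 2 * k) = false.
    apply/negP => ck; have [nab hb] := inner a b ab ak bk; have [nac hc] := inner a c ac ak ck.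
    by have [] := inner b c bc bk ck; rewrite (same_half hb hc nab nac) eqxx.
  have [nab hb] := inner a b ab ak bk.
  have [nay hy] := inner a y ay ak (outer_inner c y cy ck).
  by rewrite (same_half hb hy nab nay) eqxx in by'.
have bx : book_rel b x by rewrite sym.
have [nax hx] := inner a x ax ak (outer_inner b x bx bk).
have [nac hc] := inner a c ac ak (outer_inner b c bc bk).
by rewrite (same_half hx hc nax nac) eqxx in xc.
Qed.

Lemma card_from m : #|[set b : 'I_n | m <= b]| = n - m.
Proof.
rewrite -sum1dep_card big_mkcond /=.
elim: n => [|p IH]; first by rewrite big_ord0.
by rewrite big_ord_recr /= IH; case: leqP; lia.
Qed.

Hypothesis kn : 2 * k < n.

Lemma spine_lt (i : 'I_k) : (2 * i < n) && ((2 * i).+1 < n).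
Proof. by have := ltn_ord i; move: kn; clear; lia. Qed.

Definition lo (i : 'I_k) : 'I_n := Ordinal (proj1 (andP (spine_lt i))).
Definition hi (i : 'I_k) : 'I_n := Ordinal (proj2 (andP (spine_lt i))).

Lemma spineE (i : 'I_k) : [set v : 'I_n | v./2 == i] = [set lo i; hi i].
Proof.
apply/setP => v; rewrite !inE -!val_eqE /=; apply/eqP/orP.
  by move=> E; case: (boolP (odd v)) => o; [right|left]; apply/eqP; move: E o; clear; lia.
by case=> /eqP->; clear; lia.
Qed.

Lemma FnkP T : reflect (exists i : 'I_k, exists2 b : 'I_n, 2 * k <= b &
   T = [set lo i; hi i; b]) (T \in Fnk n k).
Proof.
apply: (iffP imset2P) => [[i b _ + ->]|[i [b kb ->]]].
  by rewrite inE => kb; exists i, b; rewrite // spineE.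
by exists i b; rewrite ?inE // spineE.
Qed.

Lemma Fnk_triangles : Fnk n k \subset cliques book_rel 3.
Proof.
apply/subsetP => _ /FnkP[i [b kb ->]].
have i2 : 2 * i < 2 * k by rewrite ltn_pmul2l.
have i2' : (2 * i).+1 < 2 * k by move: (ltn_ord i); clear; lia.
have b2 : (b < 2 * k) = false by rewrite ltnNge kb.
apply: (triangle_mk book_gemfree); rewrite /book_rel -val_eqE /= ?i2 ?i2' ?b2 /=.
- by clear; lia.
- by move: i2' kb; clear; lia.
- by move: i2 kb; clear; lia.
Qed.

Lemma card_Fnk : #|Fnk n k| = k * (n - 2 * k).
Proof.
pose F (p : 'I_k * 'I_n) := [set lo p.1; hi p.1; p.2].
pose D := setX [set: 'I_k] [set b : 'I_n | 2 * k <= b].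
have -> : Fnk n k = F @: D.
  apply/setP => T; apply/FnkP/imsetP => [[i [b kb ->]]|[[i b] + ->]].
    by exists (i, b); rewrite // !inE.
  by rewrite !inE => /andP[_ kb]; exists i, b.
rewrite card_in_imset; first by rewrite cardsX cardsT card_ord card_from.
move=> [i b] [i' b']; rewrite !inE /= => kb kb' E.
have small (j : 'I_k) : (lo j < 2 * k) && (hi j < 2 * k).
  have [-> ->] : (lo j = 2 * j :> nat) /\ (hi j = (2 * j).+1 :> nat) by [].
  by move: (nat_of_ord j) (ltn_ord j) => p; clear; lia.
have [/andP[l1 l2] /andP[l1' l2']] := (small i, small i').
have ne (x y : 'I_n) : x < 2 * k -> 2 * k <= y -> (x == y) = false.
  by move=> xk yk; apply/eqP => xy; move: xk; rewrite xy ltnNge yk.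
have : b \in F (i', b') by rewrite -E !inE eqxx !orbT.
rewrite !inE (eq_sym b (lo i')) (eq_sym b (hi i')) (ne (lo i') b) // (ne (hi i') b) // => /eqP bb'.
have : lo i \in F (i', b') by rewrite -E !inE eqxx.
rewrite !inE (ne (lo i) b') // orbF -!val_eqE /= => h.
by rewrite bb'; congr (_, _); apply: val_inj => /=; move: h; clear; lia.
Qed.

End BookFamily.

Section Rook.
Local Notation P := ('I_4 * 'I_4)%type.

Definition rook : rel P := fun p q => (p != q) && ((p.1 == q.1) || (p.2 == q.2)).

Definition line (l : 'I_4 + 'I_4) : {set P} :=
  match l with inl i => [set p | p.1 == i] | inr j => [set p | p.2 == j] end.

Lemma rook_same_line a u v : rook a u -> rook a v -> rook u v ->
  (a.1 == u.1) = (a.1 == v.1).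
Proof.
case: a u v => [a1 a2] [u1 u2] [v1 v2]; rewrite /rook /= !xpair_eqE.
move=> /andP[au /orP[]/eqP E1] /andP[av /orP[]/eqP E2] /andP[uv h]; subst.
- by rewrite !eqxx.
- by case/orP: h => /eqP E; subst; rewrite !eqxx in au av.
- by case/orP: h => /eqP E; subst; rewrite !eqxx in au av.
- by rewrite eqxx andbT in au; rewrite eqxx andbT in av; rewrite (negPf au) (negPf av).
Qed.

Lemma ord4_pigeonhole (a x b c y : 'I_4) : a != x -> a != b -> a != c -> a != y ->
  x != b -> b != c -> c != y -> x != c -> b != y -> x = y.
Proof.
rewrite -!val_eqE /= => ax ab ac ay xb bc cy xc by'; apply: val_inj => /=.
move: (ltn_ord a) (ltn_ord x) (ltn_ord b) (ltn_ord c) (ltn_ord y) ax ab ac ay xb bc cy xc by'.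
by clear; lia.
Qed.

(** Adjacent neighbours of a lie on the same line through a, so a gem would have five points
    on one line. *)
Lemma rook_gemfree : gemfree_on rook [set: P].
Proof.
split=> //.
- by move=> p q; rewrite /rook eq_sym [q.1 == _]eq_sym [q.2 == _]eq_sym.
- by move=> p; rewrite /rook eqxx.
move=> a x b c y ax ab ac ay xb bc cy.
have := rook_same_line ac ay cy; have := rook_same_line ab ac bc.
have := rook_same_line ax ab xb.
move: a x b c y ax ab ac ay xb bc cy => [a1 a2] [x1 x2] [b1 b2] [c1 c2] [y1 y2].
rewrite /rook /= !xpair_eqE.
have [->|na] := eqVneq a1 x1.
  move=> ax ab ac ay xb bc cy /esym/eqP E1; subst b1; rewrite eqxx => /esym/eqP E1; subst c1.
  rewrite eqxx => /esym/eqP E1; subst y1; move: ax ab ac ay xb bc cy; rewrite !eqxx /= !andbT.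
  by move=> *; congr (_, _); apply: (@ord4_pigeonhole a2 x2 b2 c2 y2).
move=> ax ab ac ay xb bc cy E1; rewrite -E1 => E2; rewrite -E2 => E3.
move: ax ab ac ay; rewrite -E1 -E2 -E3 /= => /eqP ax /eqP ab /eqP ac /eqP ay; subst x2 b2 c2 y2.
move: xb bc cy; rewrite !eqxx !andbT !orbT !andbT => xb bc cy xc by'; congr (_, _).
by apply: (@ord4_pigeonhole a1 x1 b1 c1 y1); rewrite // -?E1 -?E2 -?E3.
Qed.

Lemma card_line l : #|line l| = 4.
Proof.
case: l => i /=.
  have -> : [set p : P | p.1 == i] = setX [set i] [set: 'I_4].
    by apply/setP => -[a b]; rewrite !inE andbT.
  by rewrite cardsX cards1 cardsT card_ord.
have -> : [set p : P | p.2 == i] = setX [set: 'I_4] [set i].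
  by apply/setP => -[a b]; rewrite !inE.
by rewrite cardsX cards1 cardsT card_ord.
Qed.

Lemma Q44P (T : {set P}) : reflect (#|T| = 3 /\ exists l, T \subset line l) (T \in Q44).
Proof.
rewrite inE; apply: (iffP andP) => -[/eqP cT].
  by case/orP => /existsP[i Ti]; split=> //; [exists (inl i)|exists (inr i)].
by case=> -[] i Ti; split=> //; apply/orP; [left|right]; apply/existsP; exists i.
Qed.

Lemma line_meet l m (p q : P) : p != q -> p \in line l -> q \in line l ->
  p \in line m -> q \in line m -> l = m.
Proof.
case: p q => [p1 p2] [q1 q2]; rewrite xpair_eqE.
case: l m => i [] j; rewrite !inE /= => pq /eqP E1 /eqP E2 /eqP E3 /eqP E4; subst.
- by [].
- by rewrite !eqxx in pq.
- by rewrite !eqxx in pq.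
- by [].
Qed.

(** Each of the eight lines contains four triples, and no triple lies on two lines. *)
Lemma card_Q44 : #|Q44| = 32.
Proof.
rewrite (card_by_fibres (B := [set: 'I_4 + 'I_4]) (R := fun (T : {set P}) l => T \subset line l)).
- have -> : 32 = #|[set: 'I_4 + 'I_4]| * 4 by rewrite cardsT card_sum card_ord.
  rewrite -sum_nat_const; apply: eq_bigr => l _.
  transitivity 'C(#|line l|, 3); last by rewrite card_line.
  rewrite -cards_draws; apply: eq_card => T; rewrite inE [RHS]inE; case Tl: (T \subset line l); rewrite ?andbF //= andbT.
  apply/Q44P/eqP => [[]//|cT]; split=> //; by exists l.
- by move=> T /Q44P[_ [l Tl]]; exists l.
move=> T l m /Q44P[cT _] _ _ Tl Tm.
have : 1 < #|T| by rewrite cT.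
case/card_gt1P => p [q [pT qT pq]].
by apply: (line_meet pq); rewrite ?(subsetP Tl) ?(subsetP Tm).
Qed.

Lemma Q44_triangles : Q44 \subset cliques rook 3.
Proof.
apply/subsetP => T /Q44P[cT [l Tl]]; rewrite inE cT /=; apply/cliqueP => p q pT qT pq.
rewrite /rook pq /=; have := subsetP Tl p pT; have := subsetP Tl q qT.
by case: l {Tl} => i; rewrite !inE => /eqP-> /eqP->; rewrite eqxx ?orbT.
Qed.

End Rook.

(** * Recognizing the book family *)

Section BookIso.
Variables (V : finType) (e : rel V) (X Y : {set V}).
Hypotheses (G : gemfree_on e [set: V]) (XY : X :|: Y = [set: V]) (J : paired_join e X Y).
Hypothesis X0 : 0 < #|X|.
Let k := #|pairs e Y|.
Let n := #|V|.

Let cn : n = #|X| + 2 * k.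
Proof.
rewrite /n -cardsT -XY cardsU (disjoint_setI0 (pj_disj J)) cards0 subn0.
by rewrite (card_matched G (pj_mate J)).
Qed.

Let notXY v : v \in X -> v \in Y -> False.
Proof. by move=> vX vY; move/pred0P: (pj_disj J) => /(_ v) /=; rewrite vX vY. Qed.

Definition pair_of (v : V) : {set V} := odflt set0 [pick S in pairs e Y | v \in S].
Definition head_of (S : {set V}) (v : V) : V := odflt v [pick u in S].

(** The i-th pair of Y gets the numbers 2i, 2i + 1 and X the numbers from 2k on, in accordance
    with the labels of the book family. *)
Definition code (v : V) : nat :=
  if v \in Y then 2 * index (pair_of v) (enum (pairs e Y)) + (v != head_of (pair_of v) v)
  else 2 * k + index v (enum X).

Lemma pair_ofP v : v \in Y -> pair_of v \in pairs e Y /\ v \in pair_of v.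
Proof.
move=> vY; rewrite /pair_of; case: pickP => [S /andP[]|] //= no.
have [z [zY vz _]] := pj_mate J vY.
by have := no [set v; z]; rewrite (pair_mk G vY zY vz) !inE eqxx.
Qed.

Lemma pair_of_eq v S : S \in pairs e Y -> v \in S -> pair_of v = S.
Proof.
move=> SP vS; have [z [SE vY zY vz]] := pairsP SP vS.
have [SP' vS'] := pair_ofP vY; have [z' [SE' _ z'Y vz']] := pairsP SP' vS'.
by have [w [_ _ h]] := pj_mate J vY; rewrite SE' SE (h z) // (h z').
Qed.

Lemma index_pair v : v \in Y -> index (pair_of v) (enum (pairs e Y)) < k.
Proof. by move=> vY; rewrite /k cardE index_mem mem_enum; have [] := pair_ofP vY. Qed.

Lemma code_lt v : code v < n.
Proof.
rewrite cn /code; case: (boolP (v \in Y)) => vY.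
  by have := index_pair vY; case: (_ != _) => /=; move: X0; clear; lia.
have vX : v \in X by have := in_setT v; rewrite -XY inE (negPf vY) orbF.
by rewrite addnC ltn_add2r cardE index_mem mem_enum.
Qed.

Lemma code_lt2k v : (code v < 2 * k) = (v \in Y).
Proof.
rewrite /code; case: ifP => vY.
  by have := index_pair vY; case: (_ != _) => /=; clear; lia.
by rewrite ltnNge leq_addr.
Qed.

Lemma code_half v : v \in Y -> (code v)./2 = index (pair_of v) (enum (pairs e Y)).
Proof. by move=> vY; rewrite /code vY; case: (_ != _) => /=; clear; lia. Qed.

Lemma code_inj : injective code.
Proof.
move=> v w E; have EY : (v \in Y) = (w \in Y) by rewrite -!code_lt2k E.
case: (boolP (v \in Y)) => vY; last first.
  have wY : w \notin Y by rewrite -EY.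
  have inX u : u \notin Y -> u \in X.
    by move=> uY; have := in_setT u; rewrite -XY inE (negPf uY) orbF.
  move: E; rewrite /code (negPf vY) (negPf wY) => /addnI Ei.
  by rewrite -(nth_index v (s := enum X) (x := v)) ?mem_enum ?inX // Ei nth_index // mem_enum inX.
have wY : w \in Y by rewrite -EY.
have Eh : index (pair_of v) (enum (pairs e Y)) = index (pair_of w) (enum (pairs e Y)).
  by rewrite -!code_half // E.
have [vP vS] := pair_ofP vY; have [wP wS] := pair_ofP wY.
have ES : pair_of v = pair_of w.
  by rewrite -(nth_index set0 (s := enum (pairs e Y)) (x := pair_of v)) ?mem_enum // Eh nth_index // mem_enum.
apply/eqP; apply: contraT => vw.
have [z [SE _ zY vz]] := pairsP vP vS.
have zw : z = w.
  by move: wS; rewrite -ES SE !inE eq_sym (negPf vw) => /eqP.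
have hd : head_of (pair_of v) v = head_of (pair_of w) w /\
  (head_of (pair_of v) v == v) || (head_of (pair_of v) v == w).
  rewrite /head_of -ES; case: pickP => [u|/(_ v)]; last by rewrite vS.
  by rewrite SE zw !inE /= => ->.
move: E; rewrite /code vY wY -Eh => /addnI; case: hd => <-.
by case/orP => /eqP->; rewrite eqxx ?[w == v]eq_sym (negPf vw).
Qed.

Definition code_ord (v : V) : 'I_n := Ordinal (code_lt v).

Lemma code_ord_inj : injective code_ord.
Proof. by move=> v w [/code_inj]. Qed.

Lemma books_isomorphic : cliques e 3 != set0 -> #|X| * #|Y| = 2 * #|cliques e 3| ->
  isomorphic (cliques e 3) (Fnk n k).
Proof.
move=> T0 ct; have kn : 2 * k < n by rewrite cn; move: X0; clear; lia.
exists code_ord; first by apply: (inj_card_bij code_ord_inj); rewrite card_ord.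
apply/eqP; rewrite eqEcard (card_imset _ (imset_inj code_ord_inj)) card_Fnk //.
have cY := card_matched G (pj_mate J); apply/andP; split; last first.
  move: ct; rewrite cY cn addnK -/k; move: #|X| #|cliques e 3| k => x t m; clear; lia.
apply/subsetP => _ /imsetP[T TT ->].
have two : exists y z, [/\ y \in T, z \in T, y != z, y \in Y & z \in Y].
  have [a aT] : exists a, a \in T by apply/card_gt0P; rewrite (cliques_card TT).
  have [b [c [TE ab bc ac]]] := triangle_vertex G TT aT.
  have [nab nbc nac] : [/\ a != b, b != c & a != c] by rewrite !(edge_neq G).
  have inY u w : e u w -> u \notin Y -> w \in Y.
    move=> uw uY; apply: contraT => wY.
    have inX x : x \notin Y -> x \in X.
      by move=> xY; have := in_setT x; rewrite -XY inE (negPf xY) orbF.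
    by have := pj_indep J (inX u uY) (inX w wY); rewrite uw.
  have [aT' bT cT] : [/\ a \in T, b \in T & c \in T] by rewrite TE !inE !eqxx !orbT.
  case: (boolP (a \in Y)) => aY; last first.
    by exists b, c; split=> //; apply: (inY a).
  case: (boolP (b \in Y)) => bY; first by exists a, b.
  by exists a, c; split=> //; apply: (inY b).
have [y [z [yT zT yz yY zY]]] := two.
have [x [TE eyz ezx eyx]] := triangle_third G TT yT zT yz.
have xY : x \notin Y.
  apply/negP => xY; have [w [_ _ h]] := pj_mate J yY.
  by move: ezx; rewrite (h z) // (h x) // (gf_irr G).
have SP := pair_mk G yY zY eyz.
have [py pz] : pair_of y = [set y; z] /\ pair_of z = [set y; z].
  by split; apply: pair_of_eq; rewrite // !inE eqxx ?orbT.
have i0k : index [set y; z] (enum (pairs e Y)) < k by rewrite -py index_pair.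
pose i := Ordinal i0k.
have xk : 2 * k <= code_ord x by rewrite leqNgt code_lt2k.
apply/(FnkP kn); exists i; exists (code_ord x) => //.
apply/eqP; rewrite eqEcard (card_imset _ code_ord_inj) (cliques_card TT).
apply/andP; split; last first.
  by rewrite -setUA cardsU1 cards2; case: (_ \notin _); case: (_ != _).
rewrite -(spineE kn i) TE; apply/subsetP => _ /imsetP[u + ->].
rewrite !inE => /orP[/orP[]|] /eqP->; last by rewrite eqxx orbT.
- by rewrite /= code_half // py eqxx.
by rewrite /= code_half // pz eqxx.
Qed.

End BookIso.

(** * Recognizing the grid on sixteen vertices *)

Section Sixteen.
Variables (V : finType) (e : rel V).
Hypotheses (G : gemfree_on e [set: V]) (c16 : #|V| = 16).
Hypotheses (t32 : #|cliques e 3| = 32) (K : cliques e 4 != set0).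
Local Notation tet := (cliques e 4).

Let W16 : #|[set: V]| = 16. Proof. by rewrite cardsT. Qed.

(** The 32 triangles make [weighted_count] an equality, so all weights equal their mean 8 and
    the products pk vanish. *)
Lemma tight_weights v :
  #|lnbr e v| + 4 * #|tets_at e v| = 8 /\ #|lnbr e v| * #|tets_at e v| = 0.
Proof.
pose x v := #|lnbr e v| + 4 * #|tets_at e v|.
pose d v := x v ^ 2 + 64 - 16 * x v.
have dE u : d u + 16 * x u = x u ^ 2 + 64.
  by rewrite /d subnK //; have [+ _] := nat_Cauchy (x u) 8; clear; lia.
have sE : \sum_(u in [set: V]) d u + 16 * \sum_(u in [set: V]) x u =
    \sum_(u in [set: V]) x u ^ 2 + 1024.
  rewrite big_distrr -big_split /=; under eq_bigr do rewrite dE.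
  by rewrite big_split /= sum_nat_const W16.
have := weighted_count G; rewrite W16 t32 -/(x _) => H.
have := sum_weights G; rewrite t32 => S.
have Z : \sum_(u in [set: V]) (3 * d u + #|lnbr e u| * #|tets_at e u|) = 0.
  rewrite big_split /= -big_distrr /=; move: H sE; rewrite S.
  move: (\sum_(u in [set: V]) d u) (\sum_(u in [set: V]) x u ^ 2) => a b.
  by move: (\sum_(u in [set: V]) #|lnbr e u| * #|tets_at e u|) #|tet| => pk t; clear; lia.
have /eqP := Z; rewrite sum_nat_eq0 => /forall_inP/(_ v (in_setT v)).
rewrite addn_eq0 muln_eq0 /= => /andP[/eqP d0 /eqP ->]; split=> //.
have [_ eq8] := nat_Cauchy (x v) 8; apply/eqP; rewrite -[_ == 8]eq8 -[8 ^ 2]/64 -(dE v) d0.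
by rewrite add0n; apply/eqP; move: (x v) => y; clear; lia.
Qed.

(** On a K4 the weight 8 consists of two K4s and no light edge; the degrees of its four
    vertices then exhaust the bound of [sum_outer]. *)
Lemma tight_tet Q v : Q \in tet -> v \in Q ->
  [/\ #|tets_at e v| = 2, nbr e v = tnbr e v & #|outer e Q v| = 3].
Proof.
move=> QK vQ.
have H u (uQ : u \in Q) : #|tets_at e u| = 2 /\ 3 <= #|outer e Q u|.
  have [x8 pk] := tight_weights u.
  have kpos : 0 < #|tets_at e u| by apply/card_gt0P; exists Q; rewrite tets_atE QK.
  have k2 : #|tets_at e u| = 2.
    by move: x8 pk kpos; move: #|lnbr e u| #|tets_at e u| => p [|k] //; clear; nia.
  split=> //.
  have : tnbr e u \subset nbr e u by apply/subsetP => w /tnbr_edge; rewrite inE.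
  move/subset_leq_card; rewrite (card_tnbr G) k2 (card_nbr_outer G QK uQ); clear; lia.
have o3 : #|outer e Q v| = 3.
  have So := sum_outer G QK; rewrite W16 (bigD1 v) //= in So.
  have : \sum_(u in Q | u != v) 3 <= \sum_(u in Q | u != v) #|outer e Q u|.
    by apply: leq_sum => u /andP[uQ _]; have [] := H u uQ.
  have -> : \sum_(u in Q | u != v) 3 = 9.
    rewrite sum_nat_const; have -> : #|[pred u in Q | u != v]| = 3 by
      have := cardsD1 v Q; rewrite vQ (cliques_card QK) => -[->]; apply: eq_card => u; rewrite !inE andbC.
    by [].
  by have [_] := H v vQ; move: So; clear; lia.
have [k2 _] := H v vQ; split=> //; apply/esym/eqP; rewrite eqEcard.
rewrite (card_tnbr G) k2 (card_nbr_outer G QK vQ) o3 andbT.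
by apply/subsetP => w /tnbr_edge; rewrite inE.
Qed.

Lemma tight_cover Q u : Q \in tet -> u \notin Q -> exists2 v, v \in Q & e v u.
Proof.
move=> QK uQ; pose O := [set w in [set: V] :\: Q | [exists v in Q, e v w]].
have cO : #|O| = 12.
  rewrite (card_by_fibres (B := Q) (R := fun w v => e v w)).
  - transitivity (\sum_(v in Q) 3); last by rewrite sum_nat_const (cliques_card QK).
    apply: eq_bigr => v vQ; have [_ _ <-] := tight_tet QK vQ; apply: eq_card => w.
    rewrite !inE andbT; case evw: (e v w); rewrite ?andbF // !andbT.
    by case: (w \in Q) => //=; apply/exists_inP; exists v.
  - by move=> w; rewrite inE => /andP[_ /exists_inP].
  move=> w v v' /setIdP[/setDP[_ wQ] _] vQ v'Q vw v'w.
  apply/eqP; apply: contraNT wQ => vv'.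
  by apply: (tet_closed G QK vQ v'Q vv'); rewrite (gf_sym G).
have OE : O = [set: V] :\: Q.
  apply/eqP; rewrite eqEcard cO (card_delQ G QK) W16 andbT.
  by apply/subsetP => w /setIdP[].
have : u \in O by rewrite OE !inE uQ.
by case/setIdP => _ /exists_inP.
Qed.

Lemma tight_all v : exists2 Q, Q \in tet & v \in Q.
Proof.
have /set0Pn[Q QK] := K; case: (boolP (v \in Q)) => vQ; first by exists Q.
have [q qQ qv] := tight_cover QK vQ.
have [_ E _] := tight_tet QK qQ.
have : v \in tnbr e q by rewrite -E inE.
by case/tnbrP => _ [Q' [Q'K vQ' _]]; exists Q'.
Qed.

Lemma two_tets v P Q R : P \in tet -> Q \in tet -> R \in tet ->
  v \in P -> v \in Q -> v \in R -> P != Q -> (R == P) || (R == Q).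
Proof.
move=> PK QK RK vP vQ vR PQ; have [k2 _ _] := tight_tet PK vP.
have E : [set P; Q] = tets_at e v.
  apply/eqP; rewrite eqEcard k2 cards2 PQ andbT; apply/subsetP => S.
  by rewrite tets_atE in_set2 => /orP[] /eqP->; rewrite ?PK ?QK.
have : R \in [set P; Q] by rewrite E tets_atE RK.
by rewrite in_set2.
Qed.

(** For a K4 in the role of an axis, the projection of the grid onto it. *)
Definition foot (Q : {set V}) (v : V) : V :=
  if v \in Q then v else odflt v [pick q in Q | e q v].

Lemma footP Q v : Q \in tet -> foot Q v \in Q /\ (foot Q v = v \/ v \notin Q /\ e (foot Q v) v).
Proof.
move=> QK; rewrite /foot; case: ifP => vQ; first by split=> //; left.
case: pickP => [q /andP[qQ qv]|no] /=; first by split=> //; right.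
by have [q qQ qv] := tight_cover QK (negbT vQ); have := no q; rewrite qQ qv.
Qed.

Lemma foot_eq Q q v : Q \in tet -> q \in Q -> v \notin Q -> e q v -> foot Q v = q.
Proof.
move=> QK qQ vQ qv; have [fQ [fv|[_ fv]]] := footP v QK.
  by rewrite fv in fQ; rewrite fQ in vQ.
apply/eqP; apply: contraNT vQ => ne.
by apply: (tet_closed G QK fQ qQ ne); rewrite (gf_sym G).
Qed.

Lemma foot_tet Q v : Q \in tet -> v \notin Q ->
  exists2 S, S \in tet & [/\ v \in S, foot Q v \in S & S != Q].
Proof.
move=> QK vQ; have [fQ [fv|[_ fv]]] := footP v QK.
  by rewrite fv in fQ; rewrite fQ in vQ.
have [_ E _] := tight_tet QK fQ.
have : v \in tnbr e (foot Q v) by rewrite -E inE.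
case/tnbrP => _ [S [SK vS fS]]; exists S => //; split=> //.
by apply: contraNneq vQ => <-.
Qed.

Lemma same_foot Q v w : Q \in tet -> v != w -> foot Q v = foot Q w ->
  exists2 S, S \in tet & [/\ v \in S, w \in S, foot Q v \in S & S != Q].
Proof.
move=> QK vw E; have [fQ _] := footP v QK.
case: (boolP (v \in Q)) => vQ.
  have fv : foot Q v = v by rewrite /foot vQ.
  have wQ : w \notin Q.
    by apply: contra vw => wQ; rewrite -fv E /foot wQ.
  have [S SK [wS fS SQ]] := foot_tet QK wQ; exists S => //; split=> //; last by rewrite E.
  by rewrite -fv E.
have [S SK [vS fS SQ]] := foot_tet QK vQ; exists S => //; split=> //.
case: (boolP (w \in Q)) => wQ; first by rewrite (_ : w = foot Q v) // E /foot wQ.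
have [S' S'K [wS' fS' S'Q]] := foot_tet QK wQ; rewrite -E in fS'.
have := two_tets QK SK S'K fQ fS fS'; rewrite eq_sym SQ => /(_ isT).
by rewrite (negPf S'Q) /= => /eqP <-.
Qed.

Section Grid.
Variables (Q D : {set V}) (c : V).
Hypotheses (QK : Q \in tet) (DK : D \in tet) (QD : Q != D) (cQ : c \in Q) (cD : c \in D).

(** A third K4 through q in Q and r in D would contain c, as c is joined to both; but Q and D are the
    only K4s through c. *)
Lemma no_transversal S q r : S \in tet -> S != Q -> S != D -> q \in Q -> r \in D ->
  q \in S -> r \in S -> False.
Proof.
move=> SK SQ SD qQ rD qS rS.
have cS : c \notin S.
  apply/negP => cS; have := two_tets QK DK SK cQ cD cS QD.
  by rewrite (negPf SQ) (negPf SD).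
have qc : q != c by apply: contraNneq cS => <-.
have rc : r != c by apply: contraNneq cS => <-.
have qr : q != r.
  apply: contraNneq QD => E; apply/eqP; apply: (tet_eq G QK DK qc) => //.
  by rewrite E.
case/negP: cS; apply: (tet_closed G SK qS rS qr).
  by apply: clique_edge QK _ _ _; rewrite // eq_sym.
by apply: clique_edge DK _ _ _; rewrite // eq_sym.
Qed.

(** Two vertices with the same feet would lie in a common K4 that meets both axes. *)
Lemma feet_inj v w : foot Q v = foot Q w -> foot D v = foot D w -> v = w.
Proof.
move=> EQ ED; apply/eqP; apply: contraT => vw.
have [S SK [vS wS qS SQ]] := same_foot QK vw EQ.
have [S' S'K [vS' wS' rS' S'D]] := same_foot DK vw ED.
have E := tet_eq G SK S'K vw vS wS vS' wS'; subst S'.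
have [qQ _] := footP v QK; have [rD _] := footP v DK.
by case: (no_transversal SK SQ S'D qQ rD qS rS').
Qed.

Lemma foot_const Q0 S q : Q0 \in tet -> S \in tet -> q \in S -> q \in Q0 -> S != Q0 ->
  forall v, v \in S -> foot Q0 v = q.
Proof.
move=> Q0K SK qS qQ SQ v vS; have [->|vq] := eqVneq v q; first by rewrite /foot qQ.
have vQ : v \notin Q0.
  by apply: contra SQ => vQ; apply/eqP; apply: (tet_eq G SK Q0K vq).
by apply: foot_eq => //; apply: clique_edge SK _ _ _; rewrite // eq_sym.
Qed.

(** A vertex v of a K4 S disjoint from both axes would be joined to its two feet by K4s other
    than S, hence by one and the same K4, which is excluded by [no_transversal]. *)
Lemma meets_axis S : S \in tet -> (exists2 q, q \in S & q \in Q) \/ (exists2 r, r \in S & r \in D).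
Proof.
move=> SK; case: (boolP [exists q in S, q \in Q]) => [/exists_inP|/exists_inPn noQ]; first by left.
case: (boolP [exists r in S, r \in D]) => [/exists_inP|/exists_inPn noD]; first by right.
have [v vS] : exists v, v \in S by apply/card_gt0P; rewrite (cliques_card SK).
have [qQ _] := footP v QK; have [rD _] := footP v DK.
have [S1 S1K [vS1 qS1 S1Q]] := foot_tet QK (noQ v vS).
have [S2 S2K [vS2 rS2 S2D]] := foot_tet DK (noD v vS).
have S1S : S1 != S by apply: contraTneq qS1 => ->; apply/negP => /noQ; rewrite qQ.
have S2S : S2 != S by apply: contraTneq rS2 => ->; apply/negP => /noD; rewrite rD.
have := two_tets SK S1K S2K vS vS1 vS2; rewrite eq_sym S1S => /(_ isT).
rewrite (negPf S2S) /= => /eqP E; subst S2.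
by case: (no_transversal S1K S1Q S2D qQ rD qS1 rS2).
Qed.

Definition coord (v : V) : 'I_4 * 'I_4 :=
  (inord (index (foot D v) (enum D)), inord (index (foot Q v) (enum Q))).

Lemma inord_index_inj (S : {set V}) x y : S \in tet -> x \in S -> y \in S ->
  inord (index x (enum S)) = inord (index y (enum S)) :> 'I_4 -> x = y.
Proof.
move=> SK xS yS /(congr1 val); have lt z : z \in S -> index z (enum S) < 4.
  by move=> zS; rewrite -(cliques_card SK) cardE index_mem mem_enum.
rewrite /= !inordK ?lt // => E.
by rewrite -(nth_index x (s := enum S) (x := x)) ?mem_enum // E nth_index // mem_enum.
Qed.

Lemma coord_inj : injective coord.
Proof.
move=> v w [E1 E2]; have [vQ _] := footP v QK; have [wQ _] := footP w QK.
have [vD _] := footP v DK; have [wD _] := footP w DK.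
by apply: feet_inj; [apply: inord_index_inj E2|apply: inord_index_inj E1].
Qed.

Lemma triangle_in_tet T : T \in cliques e 3 -> exists2 S, S \in tet & T \subset S.
Proof.
move=> TT; have [a aT] : exists a, a \in T by apply/card_gt0P; rewrite (cliques_card TT).
have [b [c' [TE ab bc ac]]] := triangle_vertex G TT aT.
have [S0 S0K aS0] := tight_all a; have [_ E _] := tight_tet S0K aS0.
have : b \in tnbr e a by rewrite -E inE.
case/tnbrP => ba [S [SK bS aS]]; exists S => //.
by apply: (tet_triangle G SK TT ba) => //; rewrite TE !inE eqxx orbT.
Qed.

(** Every triangle lies in a K4 S. All vertices of S have the same foot on an axis that S meets,
    so S is a line of the grid. *)
Lemma coord_triangle T : T \in cliques e 3 -> coord @: T \in Q44.
Proof.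
move=> TT; have [S SK TS] := triangle_in_tet TT.
apply/Q44P; rewrite (card_imset _ coord_inj) (cliques_card TT); split=> //.
(* A K4 that meets the axis Q in q projects to q, and likewise for D. *)
have byQ q : q \in S -> q \in Q -> S != Q -> exists l, coord @: T \subset line l.
  move=> qS qQ SQ; exists (inr (inord (index q (enum Q)))).
  apply/subsetP => _ /imsetP[v vT ->]; rewrite inE /=.
  by rewrite (foot_const QK SK qS qQ SQ) // (subsetP TS).
have byD r : r \in S -> r \in D -> S != D -> exists l, coord @: T \subset line l.
  move=> rS rD SD; exists (inl (inord (index r (enum D)))).
  apply/subsetP => _ /imsetP[v vT ->]; rewrite inE /=.
  by rewrite (foot_const DK SK rS rD SD) // (subsetP TS).
have [SQ|SQ] := eqVneq S Q; first by apply: (byD c); rewrite ?SQ.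
have [SD|SD] := eqVneq S D; first by apply: (byQ c); rewrite ?SD // eq_sym.
by case: (meets_axis SK) => [[q qS qQ]|[r rS rD]]; [apply: (byQ q)|apply: (byD r)].
Qed.

End Grid.

(** Two K4s through a common vertex serve as the axes of the grid. *)
Lemma sixteen_isomorphic : isomorphic (cliques e 3) Q44.
Proof.
have /set0Pn[Q QK] := K.
have [c cQ] : exists c, c \in Q by apply/card_gt0P; rewrite (cliques_card QK).
have [k2 _ _] := tight_tet QK cQ.
have : 0 < #|tets_at e c :\ Q|.
  by have := cardsD1 Q (tets_at e c); rewrite tets_atE QK cQ k2 /=; lia.
case/card_gt0P => D /setD1P[DQ]; rewrite tets_atE => /andP[DK cD].
have QD : Q != D by rewrite eq_sym.
have inj := coord_inj QK DK QD cQ cD.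
exists (coord Q D); first by apply: (inj_card_bij inj); rewrite card_prod card_ord c16.
apply/eqP; rewrite eqEcard card_Q44 (card_imset _ (imset_inj inj)) t32 leqnn andbT.
by apply/subsetP => _ /imsetP[T TT ->]; apply: (coord_triangle QK DK QD cQ cD).
Qed.

End Sixteen.

(** * The theorem *)

Lemma book_size_le n j : 2 * j <= n -> j * (n - 2 * j) <= n ^ 2 %/ 8.
Proof.
move=> jn; rewrite leq_divRL //; have [+ _] := nat_AGM2 (2 * j) (n - 2 * j).
by rewrite subnKC //; move: (n - 2 * j) (n ^ 2) => m s; clear; lia.
Qed.

(** The maximum is attained near n/4, at k = (n + 1)/4 rounded down. *)
Lemma book_size_max n : 8 <= n -> exists2 k, admissible n k & k * (n - 2 * k) = n ^ 2 %/ 8.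
Proof.
move=> n8; exists ((n + 1) %/ 4).
  by rewrite /admissible; apply/andP; split; move: n8; clear; lia.
have : n = n %/ 4 * 4 + n %% 4 := divn_eq n 4.
move: (n %/ 4) (n %% 4) (ltn_pmod n (isT : 0 < 4)) => q r r4 nE.
have kE : (n + 1) %/ 4 = q + (r == 3) by move: r4 nE; clear; lia.
have mE : n - 2 * (q + (r == 3)) = 2 * q + (if r == 3 then 1 else r).
  by move: r4 nE; clear; case: r => [|[|[|[|r]]]] //= _ ->; lia.
rewrite kE mE nE -mulnn; case: r r4 {nE kE mE} => [|[|[|[|//]]]] _ /=.
- rewrite (_ : (q * 4 + 0) * (q * 4 + 0) = (2 * q * q) * 8); last by lia.
  by rewrite mulnK //; lia.
- rewrite (_ : (q * 4 + 1) * (q * 4 + 1) = (2 * q * q + q) * 8 + 1); last by lia.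
  by rewrite divnMDl // addn0; lia.
- rewrite (_ : (q * 4 + 2) * (q * 4 + 2) = (2 * q * q + 2 * q) * 8 + 4); last by lia.
  by rewrite divnMDl // addn0; lia.
rewrite (_ : (q * 4 + 3) * (q * 4 + 3) = (2 * q * q + 3 * q + 1) * 8 + 1); last by lia.
by rewrite divnMDl // addn0; lia.
Qed.

Lemma size_bound (V : finType) (F : {set {set V}}) : 8 <= #|V| ->
  triple_system F -> avoids F [:: confA; confB; confD] ->
  #|F| <= #|cliques (shadow F) 3| <= #|V| ^ 2 %/ 8.
Proof.
move=> V8 F3 av; have G := shadow_gemfree F3 av.
rewrite subset_leq_card ?sub_shadow_triangles //= leq_divRL // mulnC -cardsT.
by apply: (tri_bound G); rewrite cardsT.
Qed.

Lemma Fnk_extremal (V : finType) (F : {set {set V}}) n k : 8 <= n -> optimal n k ->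
  isomorphic F (Fnk n k) ->
  [/\ triple_system F, avoids F [:: confA; confB; confD] & #|F| = n ^ 2 %/ 8].
Proof.
move=> n8 [/andP[k0 kn] kopt] /(isomorphic_avoids (book_gemfree n k) (Fnk_triangles kn)).
case=> F3 av ->; split=> //; apply/eqP; rewrite card_Fnk // eqn_leq book_size_le ?(ltnW kn) //=.
by have [j adm <-] := book_size_max n8; apply: kopt.
Qed.

(** An extremal system contains all triangles of its shadow, so the extremal graphs determine
    it. *)
Lemma extremal_structure (V : finType) (F : {set {set V}}) : 11 <= #|V| ->
  triple_system F -> avoids F [:: confA; confB; confD] -> #|F| = #|V| ^ 2 %/ 8 ->
  (exists2 k, optimal #|V| k & isomorphic F (Fnk #|V| k)) \/
  (#|V| = 16 /\ isomorphic F Q44).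
Proof.
move=> V11 F3 av cF; have G := shadow_gemfree F3 av.
have /andP[F_le le_n] := size_bound (leq_trans (isT : 8 <= 11) V11) F3 av.
have FE : F = cliques (shadow F) 3.
  by apply/eqP; rewrite eqEcard sub_shadow_triangles // cF.
have ct : #|cliques (shadow F) 3| = #|V| ^ 2 %/ 8 by rewrite -FE.
have near : #|V| ^ 2 < 8 * #|cliques (shadow F) 3| + 8.
  by rewrite ct; move: (#|V| ^ 2); clear; lia.
have t0 : 0 < #|cliques (shadow F) 3|.
  by rewrite ct divn_gt0 // -mulnn; move: V11; clear; nia.
have [K0|K] := eqVneq (cliques (shadow F) 4) set0; [left|right].
  have [||X [Y [XY J X2 cXY]]] := k4free_extremal G K0.
  - by rewrite cardsT (leq_trans _ V11).
  - by rewrite cardsT sq_mod8.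
  have X0 : 0 < #|X| := ltnW X2.
  have T0 : cliques (shadow F) 3 != set0 by rewrite -card_gt0.
  have iso := books_isomorphic G XY J X0 T0 cXY.
  have cY := card_matched G (pj_mate J).
  have cV : #|V| = #|X| + #|Y|.
    by rewrite -cardsT -XY cardsU (disjoint_setI0 (pj_disj J)) cards0 subn0.
  set k := #|pairs _ Y| in iso cY; exists k; last by rewrite {1}FE.
  have kX : k * #|X| = #|V| ^ 2 %/ 8.
    have halve (x m t : nat) : x * (2 * m) = 2 * t -> m * x = t by lia.
    by rewrite -ct; apply: halve; rewrite -cY.
  have VX : #|V| - 2 * k = #|X| by rewrite cV cY addnK.
  split; last by move=> j /andP[_ jn]; rewrite VX kX book_size_le // ltnW.
  have -> : admissible #|V| k = (0 < k).
    by rewrite /admissible cV cY -{1}[2 * k]add0n ltn_add2r X0 andbT.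
  by rewrite lt0n; apply: contraTneq t0 => k0; rewrite ct -kX k0.
have [V16|V16] := eqVneq #|V| 16; last first.
  by have := deficient V11 V16 G (cardsT V) K; move: near; clear; lia.
split=> //; rewrite {1}FE; apply: sixteen_isomorphic => //.
by rewrite ct V16.
Qed.

Theorem theorem19 (n : nat) (hn : 8 <= n) :
  ex n [:: confA; confB; confD] = n ^ 2 %/ 8 /\
  (11 <= n ->
   forall (V : finType) (F : {set {set V}}), #|V| = n ->
     [/\ triple_system F,
         avoids F [:: confA; confB; confD] &
         #|F| = n ^ 2 %/ 8] <->
     (exists2 k : nat, optimal n k & isomorphic F (Fnk n k)) \/
     (n = 16 /\ isomorphic F Q44)).
Proof.
split.
  apply/eqP; rewrite eqn_leq; apply/andP; split.
    apply/bigmax_leqP => F /andP[F3 av].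
    have := @size_bound 'I_n F; rewrite card_ord => /(_ hn F3 av)/andP[le1 le2].
    exact: leq_trans le1 le2.
  have [k adm <-] := book_size_max hn; have /andP[_ kn] := adm.
  have [F3 av] := gemfree_avoids (book_gemfree n k) (Fnk_triangles kn).
  by rewrite -(card_Fnk kn); apply: leq_bigmax_cond; rewrite F3.
move=> n11 V F cV; split=> [[F3 av]|[[k kopt iso]|[n16 iso]]]; first 1 last.
- exact: Fnk_extremal kopt iso.
- have [F3 av ->] := isomorphic_avoids rook_gemfree Q44_triangles iso.
  by split; rewrite // card_Q44 n16.
by subst n; apply: extremal_structure.
Qed.
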